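(* Let $\Omega\subseteq\mathbb{R}^n$ be open. The set $\mathcal{M}(\Omega)$ of moderate elements is a subalgebra of $\mathcal{B}(\Omega)$, and the set $\mathcal{N}(\Omega)$ of negligible elements is an ideal in $\mathcal{M}(\Omega)$.
   Context: Notation: $\mathbb{N}_0=\{0,1,2,\dots\}$, $\mathbb{R}^+=[0,\infty)$. $K\Subset L$ means that $K$ is compact and contained in the interior of $L$. $\mathcal{U}_x(\Omega)$ is the set of open neighborhoods of $x$ in $\Omega$. $C^\infty(U)$ is the space of complex-valued smooth functions on $U$, $\mathcal{D}(\Omega)$ the space of test functions with its usual topology, $\mathcal{D}_L(U)$ the space of test functions on $U$ with support in $L$. Smoothness of maps between locally convex spaces is understood in the sense of convenient calculus (Kriegl--Michor), and $\mathrm{d}^k R$ denotes the $k$-th differential. Basic space: $\mathcal{B}(\Omega)$ is the set of sheaf homomorphisms from $C^\infty(-,\mathcal{D}(\Omega))$ to $C^\infty(-)$, both regarded as sheaves on $\Omega$ with values in the category of locally convex spaces with smooth maps. That is, $R\in\mathcal{B}(\Omega)$ is a family $(R_U)_U$ of smooth maps $R_U: C^\infty(U,\mathcal{D}(\Omega))\to C^\infty(U)$ ($U\subseteq\Omega$ open) with $R_U(\vec\varphi)|_V=R_V(\vec\varphi|_V)$ for all open $V\subseteq U$. One writes $R$ for $R_U$. $\mathcal{B}(\Omega)$ is an associative commutative algebra with product $(R\cdot S)_U(\vec\varphi)=R_U(\vec\varphi)\cdot S_U(\vec\varphi)$. Seminorms: for $U\subseteq\Omega$ open, $K,L\Subset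 U$, $m,c,l\in\mathbb{N}_0$, $B$ a bounded set of smooth functions on $\Omega$, and $\vec\varphi\in C^\infty(U,\mathcal{D}_L(U))$: $\|f\|_{K,m}=\sup_{x\in K,|\alpha|\le m}|\partial^\alpha f(x)|$; $\|\vec\varphi\|_{K,c;L,l}=\sup_{x\in K,|\alpha|\le c,\,y\in L,|\beta|\le l}|\partial_x^\alpha\partial_y^\beta\vec\varphi(x)(y)|$; $\|\vec\varphi\|_{K,c;B}=\sup_{x\in K,|\alpha|\le c,\,f\in B}|\int f(y)\,\partial_x^\alpha\vec\varphi(x)(y)\,dy|$; $\|\vec\varphi-\vec\delta\|_{K,c;B}=\sup_{x\in K,|\alpha|\le c,\,f\in B}|\int f(y)\,\partial_x^\alpha\vec\varphi(x)(y)\,dy-\partial^\alpha f(x)|$ (here $\vec\delta(x)=\delta_x$). Polynomials: $\mathcal{P}_k=\mathbb{R}^+[y_0,\dots,y_k]$ (polynomials with coefficients in $\mathbb{R}^+$); $\mathcal{I}_k=\{\lambda\in\mathbb{R}^+[y_0,\dots,y_k,z_0,\dots,z_k] : \lambda(y_0,\dots,y_k,0,\dots,0)=0\}$. $R\in\mathcal{B}(\Omega)$ is moderate ($R\in\mathcal{M}(\Omega)$) if: $(\forall x\in\Omega)(\exists U\in\mathcal{U}_x(\Omega))(\forall K,L\Subset U)(\forall m,k\in\mathbb{N}_0)(\exists c,l\in\mathbb{N}_0)(\exists\lambda\in\mathcal{P}_k)(\forall\vec\varphi_0,\dots,\vec\varphi_k\in C^\infty(U,\mathcal{D}_L(U)))$: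 $\|\mathrm{d}^kR(\vec\varphi_0)(\vec\varphi_1,\dots,\vec\varphi_k)\|_{K,m}\le\lambda(\|\vec\varphi_0\|_{K,c;L,l},\dots,\|\vec\varphi_k\|_{K,c;L,l})$. $R\in\mathcal{B}(\Omega)$ is negligible ($R\in\mathcal{N}(\Omega)$) if: $(\forall x\in\Omega)(\exists U\in\mathcal{U}_x(\Omega))(\forall K,L\Subset U)(\forall m,k\in\mathbb{N}_0)(\exists c,l\in\mathbb{N}_0)(\exists\lambda\in\mathcal{I}_k)(\exists B\subseteq C^\infty(\Omega)\text{ bounded})(\forall\vec\varphi_0,\dots,\vec\varphi_k\in C^\infty(U,\mathcal{D}_L(U)))$: $\|\mathrm{d}^kR(\vec\varphi_0)(\vec\varphi_1,\dots,\vec\varphi_k)\|_{K,m}\le\lambda(\|\vec\varphi_0\|_{K,c;L,l},\dots,\|\vec\varphi_k\|_{K,c;L,l},\|\vec\varphi_0-\vec\delta\|_{K,c;B},\|\vec\varphi_1\|_{K,c;B},\dots,\|\vec\varphi_k\|_{K,c;B})$. *)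

(* Defs.v *)
From HB Require Import structures.
From mathcomp Require Import all_boot all_order all_algebra.
From mathcomp Require Import complex.
From mathcomp Require Import all_classical all_reals all_analysis.
From mathcomp Require mpoly.
Set Implicit Arguments.
Unset Strict Implicit.
Unset Printing Implicit Defensive.
Import Order.TTheory GRing.Theory Num.Theory.
Import numFieldNormedType.Exports.

Local Open Scope classical_set_scope.
Local Open Scope ring_scope.
Local Open Scope complex_scope.

Section LocallyConvex.
Variable R : realType.

(* A locally convex space, presented as a subspace [dom E] of an ambient complex
   vector space, with a set [sn E] of seminorms on it that defines its topology.
   Seminorms are only ever evaluated on [dom E]. *)
Record lcs := Lcs {
  lcs_sort :> lmodType R[i];
  dom : set lcs_sort;
  sn : set (lcs_sort -> R) }.

(* v is the derivative of the curve c at t, in the topology of E. *)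
Definition is_lderiv (E : lcs) (c : R -> E) (t : R) (v : E) : Prop :=
  forall p, sn p ->
    p ((h^-1)%:C *: (c (t + h) - c t) - v) @[h --> (0 : R)^'] --> (0 : R).

Definition lderiv (E : lcs) (c : R -> E) (t : R) : E :=
  xget 0 [set v | @dom E v /\ is_lderiv c t v].

Definition smooth_curve (E : lcs) (c : R -> E) : Prop :=
  exists d : nat -> R -> E,
    [/\ d 0%N = c, forall k t, dom (d k t) &
        forall k t, is_lderiv (d k) t (d k.+1 t)].

(* Smoothness in the sense of convenient calculus: smooth curves are mapped to
   smooth curves. *)
Definition smooth_map (E F : lcs) (f : E -> F) : Prop :=
  (forall x, dom x -> dom (f x)) /\
  (forall c : R -> E, smooth_curve c -> smooth_curve (f \o c)).

(* kdiff f [:: v1; ...; vk] x is d^k f (x)(v1, ..., vk), obtained by iterating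
   df (x)(v) = lim_(t -> 0) (f (x + t v) - f x) / t. *)
Fixpoint kdiff (E F : lcs) (f : E -> F) (vs : seq E) (x : E) : F :=
  if vs is v :: vs' then lderiv (fun t : R => kdiff f vs' (x + t%:C *: v)) 0
  else f x.

Definition bounded_subset (E : lcs) (B : set E) : Prop :=
  B `<=` @dom E /\
  forall p, sn p -> exists M : R, forall f, B f -> p f <= M.

Definition Clcs : lcs :=
  @Lcs R[i]^o setT [set fun z : R[i] => Normc.normc z].

End LocallyConvex.

Section SmoothFunctions.
Variables (R : realType) (n : nat).
Local Notation X := 'rV[R]_n.
Local Notation C := R[i].

Definition compactly_inside (K L : set X) : Prop := compact K /\ K `<=` L^°.

Definition pder (E : lcs R) (i : 'I_n) (f : X -> E) : X -> E :=
  fun x => lderiv (fun t : R => f (x + t *: delta_mx 0 i)) 0.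

Definition pders (E : lcs R) (w : seq 'I_n) (f : X -> E) : X -> E :=
  foldr (@pder E) f w.

Definition multi := {ffun 'I_n -> nat}.

Definition mdeg (a : multi) : nat := (\sum_i a i)%N.

Definition mder (E : lcs R) (a : multi) (f : X -> E) : X -> E :=
  pders (flatten [seq nseq (a i) i | i <- enum 'I_n]) f.

(* Smoothness of a function of n real variables, in terms of iterated partial
   derivatives in the topology of E; [w] lists the successive directions.  For
   open U and convenient E, in particular E = C and E = D(Omega), this is
   equivalent to being smooth along smooth curves (Boman). *)
Definition smooth_on (E : lcs R) (U : set X) (f : X -> E) : Prop :=
  forall x, U x ->
    dom (f x) /\
    forall w : seq 'I_n,
      (forall i, exists2 v : E, dom v &
         is_lderiv (fun t : R => pders w f (x + t *: delta_mx 0 i)) 0 v) /\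
      (forall p, sn p -> p (pders w f y - pders w f x) @[y --> x] --> (0 : R)).

(* The indices range over all (x, a) with x in K and |a| <= m.  As everywhere
   below, the set is bounded in the situations of interest and [sup set0 = 0]. *)
Definition sup_der (E : lcs R) (p : E -> R) (K : set X) (m : nat)
    (f : X -> E) : R :=
  sup [set p (mder xa.2 f xa.1) |
         xa in [set xa : X * multi | K xa.1 /\ (mdeg xa.2 <= m)%N]].

(* The space of smooth maps from U to E, with the topology of uniform convergence
   on compact sets of all derivatives.  A function on U is encoded by its
   extension by zero to the whole of R^n. *)
Definition Cinf (U : set X) (E : lcs R) : lcs R :=
  @Lcs R (X -> E)
    [set f | smooth_on U f /\ forall x, ~ U x -> f x = 0]
    [set q | exists K m p, [/\ compactly_inside K U, sn p & q = @sup_der E p K m]].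

Definition CinfC (U : set X) : lcs R := Cinf U (Clcs R).

Definition norm_f (K : set X) (m : nat) (f : X -> C) : R :=
  @sup_der (Clcs R) (fun z : C => Normc.normc z) K m f.

Definition tsupport (f : X -> C) : set X := closure [set y | f y != 0].

Definition is_test (Omega : set X) : set (X -> C) :=
  [set f | [/\ @dom _ (CinfC Omega) f, compact (tsupport f)
             & tsupport f `<=` Omega]].

(* A seminorm on D(Omega) is continuous for the inductive limit topology iff its
   restrictions to the Frechet spaces D_K(Omega) are continuous. *)
Definition test_seminorm (Omega : set X) : set ((X -> C) -> R) :=
  [set p | [/\ forall f g, is_test Omega f -> is_test Omega g ->
                 p (f + g) <= p f + p g,
               forall (a : C) f, is_test Omega f ->
                 p (a *: (f : X -> C^o)) = Normc.normc a * p f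
             & forall K, compactly_inside K Omega ->
                 exists (M : R) (m : nat), forall f, is_test Omega f ->
                   tsupport f `<=` K -> p f <= M * norm_f K m f]].

Definition Dtest (Omega : set X) : lcs R :=
  @Lcs R (X -> C^o) (is_test Omega) (test_seminorm Omega).

Definition test_in (U L : set X) : set (X -> C) :=
  [set f | is_test U f /\ tsupport f `<=` L].

Definition CinfD (Omega U : set X) : lcs R := Cinf U (Dtest Omega).

(* C^oo(U, D_L(U)); the topology of D_L(U) is the one induced by D(Omega). *)
Definition CinfDL (Omega U L : set X) : set (X -> X -> C) :=
  [set phi | @dom _ (CinfD Omega U) phi /\ forall x, U x -> test_in U L (phi x)].

Definition restr (V : set X) (T : nmodType) (f : X -> T) : X -> T :=
  patch (fun=> 0) V f.

Definition sheaf_family := set X -> (X -> X -> C) -> X -> C.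

(* B(Omega); only the values of S U on C^oo(U, D(Omega)), for U an open subset
   of Omega, are relevant. *)
Definition basic_space (Omega : set X) : set sheaf_family :=
  [set S | forall U, open U -> U `<=` Omega ->
     @smooth_map R (CinfD Omega U) (CinfC U) (S U) /\
     forall V, open V -> V `<=` U ->
       forall phi, @dom _ (CinfD Omega U) phi ->
         restr V (S U phi) = S V (restr V phi)].

End SmoothFunctions.

Section Integral.
Variable R : realType.

(* Lebesgue integral over R^n as an iterated integral; it is only applied to
   continuous functions with compact support (Fubini). *)
Fixpoint rintegral (n : nat) : ('rV[R]_n -> R) -> R :=
  match n with
  | 0 => fun g => g 0
  | n'.+1 => fun g =>
      (\int[lebesgue_measure]_(t in setT)
         @rintegral n' (fun y => g (row_mx (const_mx t : 'rV[R]_1) y)))%R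
  end.

Definition cintegral (n : nat) (g : 'rV[R]_n -> R[i]) : R[i] :=
  rintegral (fun y => complex.Re (g y)) +i* rintegral (fun y => complex.Im (g y)).

End Integral.

Section Moderateness.
Variables (R : realType) (n : nat) (Omega : set 'rV[R]_n).
Local Notation X := 'rV[R]_n.
Local Notation C := R[i].
Local Notation multi := (multi n).

(* The derivative of x |-> phi x as a function with values in D(Omega). *)
Definition xder (a : multi) (phi : X -> X -> C) : X -> X -> C :=
  @mder R n (Dtest Omega) a phi.

Definition norm_phi (K : set X) (c : nat) (L : set X) (l : nat)
    (phi : X -> X -> C) : R :=
  sup [set r | exists x y a b,
         [/\ K x, L y, (mdeg a <= c)%N, (mdeg b <= l)%N
           & r = Normc.normc (@mder R n (Clcs R) b (xder a phi x) y)]].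

Definition pairing (f : X -> C) (a : multi) (phi : X -> X -> C) (x : X) : C :=
  cintegral (fun y => f y * xder a phi x y).

Definition norm_B (K : set X) (c : nat) (B : set (X -> C))
    (phi : X -> X -> C) : R :=
  sup [set r | exists x a f,
         [/\ K x, (mdeg a <= c)%N, B f
           & r = Normc.normc (pairing f a phi x)]].

Definition dist_delta (K : set X) (c : nat) (B : set (X -> C))
    (phi : X -> X -> C) : R :=
  sup [set r | exists x a f,
         [/\ K x, (mdeg a <= c)%N, B f
           & r = Normc.normc
                   (pairing f a phi x - @mder R n (Clcs R) a f x)]].

(* d^k S_U (phi_0)(phi_1, ..., phi_k); [lift ord0 i] is the index i + 1. *)
Definition kdiffS (S : sheaf_family R n) (U : set X) (k : nat)
    (phi : 'I_k.+1 -> X -> X -> C) : X -> C :=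
  @kdiff R (CinfD Omega U) (CinfC U) (S U)
    [seq phi (lift ord0 i) | i <- enum 'I_k] (phi ord0).

Definition nonneg_coef (N : nat) (lam : mpoly.mpoly N R) : Prop :=
  forall mon, 0 <= mpoly.mcoeff mon lam.

Definition join_val (k : nat) (y z : 'I_k.+1 -> R) : 'I_(k.+1 + k.+1) -> R :=
  fun i => match fintype.split i with inl j => y j | inr j => z j end.

Definition Pk (k : nat) : set (mpoly.mpoly k.+1 R) := [set lam | nonneg_coef lam].

(* The variables are ordered as y_0, ..., y_k, z_0, ..., z_k. *)
Definition Ik (k : nat) : set (mpoly.mpoly (k.+1 + k.+1) R) :=
  [set lam | nonneg_coef lam /\
     forall y, mpoly.meval (join_val y (fun=> 0)) lam = 0].

Definition moderate_elements : set (sheaf_family R n) :=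
  [set S | basic_space Omega S /\
   forall x, Omega x -> exists U, [/\ open U, U x, U `<=` Omega &
   forall K L, compactly_inside K U -> compactly_inside L U ->
   forall m k : nat, exists (c l : nat), exists2 lam, @Pk k lam &
   forall phi : 'I_k.+1 -> X -> X -> C,
     (forall i, CinfDL Omega U L (phi i)) ->
     norm_f K m (kdiffS S U phi)
       <= mpoly.meval (fun i => norm_phi K c L l (phi i)) lam]].

Definition negligible_elements : set (sheaf_family R n) :=
  [set S | basic_space Omega S /\
   forall x, Omega x -> exists U, [/\ open U, U x, U `<=` Omega &
   forall K L, compactly_inside K U -> compactly_inside L U ->
   forall m k : nat, exists (c l : nat), exists2 lam, @Ik k lam &
   exists2 B, @bounded_subset R (CinfC Omega) B &
   forall phi : 'I_k.+1 -> X -> X -> C,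
     (forall i, CinfDL Omega U L (phi i)) ->
     norm_f K m (kdiffS S U phi)
       <= mpoly.meval
            (join_val (fun i => norm_phi K c L l (phi i))
               (fun i => if i == ord0 then dist_delta K c B (phi i)
                         else norm_B K c B (phi i))) lam]].

End Moderateness.

Section Algebra.
Variables (R : realType) (n : nat).
Local Notation fam := (sheaf_family R n).

Definition fam0 : fam := fun U phi x => 0.
(* The constant function 1 on U, extended by zero. *)
Definition fam1 : fam := fun U phi => restr U (fun=> 1).
Definition famD (S T : fam) : fam := fun U phi x => S U phi x + T U phi x.
Definition famZ (a : R[i]) (S : fam) : fam := fun U phi x => a * S U phi x.
Definition famM (S T : fam) : fam := fun U phi x => S U phi x * T U phi x.

Definition subspace_of (A M : set fam) : Prop :=
  [/\ M `<=` A, M fam0, forall S T, M S -> M T -> M (famD S T)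
    & forall a S, M S -> M (famZ a S)].

Definition subalgebra_of (A M : set fam) : Prop :=
  [/\ subspace_of A M, M fam1 & forall S T, M S -> M T -> M (famM S T)].

(* [famM] is commutative, so there is no left/right distinction. *)
Definition ideal_of (A N : set fam) : Prop :=
  subspace_of A N /\ forall S T, A S -> N T -> N (famM S T).

End Algebra.

(* Main.v *)
Require Import Defs.
From mathcomp Require Import all_boot all_order all_algebra.
From mathcomp Require Import complex.
From mathcomp Require Import all_classical all_reals all_analysis.
From mathcomp Require mpoly.
From mathcomp Require Import ring lra.
Import Order.TTheory GRing.Theory Num.Theory.
Import numFieldNormedType.Exports.
Set Implicit Arguments.
Unset Strict Implicit.
Unset Printing Implicit Defensive.

Local Open Scope classical_set_scope.
Local Open Scope ring_scope.
Local Open Scope complex_scope.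

(** The crucial point is that the iterated directional derivatives [d^k S] of a
    map that is only known to be smooth along smooth curves exist, are linear in
    [S] and obey the Leibniz rule. It suffices to see that, for
    [h : R^2 -> F] mapping smooth curves to smooth curves,
    [s |-> d_t h (s, 0)] is a smooth curve (a theorem of Boman). By the special
    curve lemma the pure directional derivatives of [h] are locally bounded.
    Polarization expresses mixed differences by pure ones; hence the pure
    derivatives are Lipschitz, and a mixed difference of step [r] is [r ^ m]
    times a fixed combination [mixed] of pure derivatives, up to [O(r ^ (m + 1))].
    Summing differences over a fine subdivision shows that [mixed] with one more
    direction is the derivative of [mixed]; no completeness of [F] is needed.

    Two elements satisfy their estimates on different neighbourhoods [U1], [U2]
    of a point; both estimates are moved to a common box inside [U1] and [U2] by
    multiplying the arguments with a cut-off function and using the sheaf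
    property. Negligible elements are moderate because the pairings with a
    bounded set of functions are bounded by the seminorms of the arguments. *)

(** * Locally convex spaces *)

(** [lderiv] is a choice with default 0, so no identity between iterated differentials can be
    computed before existence is known. On lines the first derivative exists by hypothesis; for the
    next one, [x |-> df(x)(v)] must itself send smooth curves to smooth curves. Only the surface
    [(s, t) |-> f (c s + t v)] enters there, so the analysis takes place on R^2 although the
    arguments form an infinite-dimensional space.

    The polarization formula is Djokovic's: mixed derivatives are defined through pure ones, which
    exist on every line, and only afterwards shown to be derivatives. Estimates use one seminorm at
    a time; [good_sep] makes derivatives unique, so that chosen ones can be identified.

    An element of C^oo(V, D_L(V)) need not extend to a larger open set, so an estimate on [U] does
    not restrict to [V] directly. The cut-off acts on the parameter [x] alone and leaves the
    supports in [L]; it lives on cubes, being a product of functions of one coordinate. A flag [neg]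
    treats moderate and negligible elements at once; under products the flags combine by [||], which
    is the ideal property. *)

Record good (R : realType) (E : lcs R) : Prop := Good {
  good0 : @dom R E 0;
  goodP : forall (a : R[i]) (x y : E), dom x -> dom y -> dom (a *: x + y);
  good_le : forall p, @sn R E p -> forall x y : E, dom x -> dom y ->
    p (x + y) <= p x + p y;
  goodZ : forall p, @sn R E p -> forall a (x : E), dom x ->
    p (a *: x) = Normc.normc a * p x;
  good_sep : forall x : E, dom x -> (forall p, @sn R E p -> p x = 0) -> x = 0 }.

Section Normc.
Variable R : realType.
Implicit Types z : R[i].

Lemma normcR (r : R) : Normc.normc r%:C = `|r|.
Proof. by rewrite /= expr0n /= addr0 sqrtr_sqr. Qed.

Lemma normc_ge0 z : 0 <= Normc.normc z.
Proof. by case: z => a b /=; rewrite sqrtr_ge0. Qed.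

Lemma normcD z z' : Normc.normc (z + z') <= Normc.normc z + Normc.normc z'.
Proof. exact: le_normcD. Qed.

Lemma real_complex_scale (E : lmodType R[i]) (a b : R) (x : E) :
  a%:C *: (b%:C *: x) = (a * b)%:C *: x.
Proof. by rewrite scalerA -rmorphM. Qed.

End Normc.

Section GoodTheory.
Variables (R : realType) (E : lcs R) (gE : good E).
Implicit Types (x y v : E) (p : E -> R).

Lemma domZ a x : dom x -> dom (a *: x).
Proof. by move=> dx; rewrite -[_ *: _]addr0; apply: goodP => //; apply: good0. Qed.

Lemma domD x y : dom x -> dom y -> dom (x + y).
Proof. by move=> dx dy; rewrite -[x]scale1r; apply: goodP. Qed.

Lemma domN x : dom x -> dom (- x).
Proof. by move=> dx; rewrite -scaleN1r; apply: domZ. Qed.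

Lemma domB x y : dom x -> dom y -> dom (x - y).
Proof. by move=> dx dy; apply: domD => //; apply: domN. Qed.

Lemma dom_sum (I : Type) (s : seq I) (F : I -> E) :
  (forall i, dom (F i)) -> dom (\sum_(i <- s) F i).
Proof.
move=> dF; elim: s => [|i s IH]; first by rewrite big_nil; exact: good0.
by rewrite big_cons; apply: domD.
Qed.

Lemma snZ p a x : sn p -> dom x -> p (a%:C *: x) = `|a| * p x.
Proof. by move=> sp dx; rewrite goodZ// normcR. Qed.

Lemma sn0 p : sn p -> p 0 = 0.
Proof.
move=> sp; have := goodZ gE sp 0 (good0 gE).
by rewrite scale0r Normc.normc0 mul0r.
Qed.

Lemma snN p x : sn p -> dom x -> p (- x) = p x.
Proof.
move=> sp dx; rewrite -scaleN1r.
have -> : (-1 : R[i]) = (-1)%:C by rewrite rmorphN1.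
by rewrite snZ// normrN1 mul1r.
Qed.

Lemma sn_ge0 p x : sn p -> dom x -> 0 <= p x.
Proof.
move=> sp dx; have := good_le gE sp dx (domN dx).
by rewrite subrr sn0// snN// => h; lra.
Qed.

Lemma sn_leB p x y : sn p -> dom x -> dom y -> p (x - y) <= p x + p y.
Proof. by move=> sp dx dy; rewrite -(snN sp dy); apply: good_le => //; apply: domN. Qed.

Lemma sn_distC p x y : sn p -> dom x -> dom y -> p (x - y) = p (y - x).
Proof. by move=> sp dx dy; rewrite -opprB snN//; apply: domB. Qed.

Lemma sn_tri p x y z : sn p -> dom x -> dom y -> dom z ->
  p (x - z) <= p (x - y) + p (y - z).
Proof.
move=> sp dx dy dz; rewrite -[x - z](_ : (x - y) + (y - z) = _); last by rewrite addrA subrK.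
by apply: good_le => //; apply: domB.
Qed.

Lemma sn_lower p x y : sn p -> dom x -> dom y -> p x - p y <= p (x - y).
Proof.
move=> sp dx dy; have := good_le gE sp (domB dx dy) dy.
by rewrite subrK lerBlDr.
Qed.

Lemma sn_sum p (I : Type) (s : seq I) (F : I -> E) : sn p ->
  (forall i, dom (F i)) -> p (\sum_(i <- s) F i) <= \sum_(i <- s) p (F i).
Proof.
move=> sp dF; elim: s => [|i s IH]; first by rewrite !big_nil sn0.
rewrite !big_cons; apply: le_trans (good_le gE sp (dF i) (dom_sum _ dF)) _.
by rewrite lerD2l.
Qed.

Lemma is_lderivP (c : R -> E) t v : (\forall h \near (0 : R), dom (c (t + h))) ->
  dom v -> is_lderiv c t v <->
  forall p, sn p -> forall e, 0 < e ->
    \forall h \near (0 : R), p (c (t + h) - c t - h%:C *: v) <= e * `|h|.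
Proof.
move=> dc dv.
have dct : dom (c t) by have /= := nbhs_singleton dc; rewrite addr0.
have key p h : sn p -> h != 0 -> dom (c (t + h)) ->
  p ((h^-1)%:C *: (c (t + h) - c t) - v) =
  `|h|^-1 * p (c (t + h) - c t - h%:C *: v).
  move=> sp h0 dch; rewrite -normfV -snZ//; last first.
    by apply: domB; [apply: domB|apply: domZ].
  by rewrite [in RHS]scalerBr real_complex_scale mulVf// scale1r.
split=> H p sp.
  move=> e e0; have /cvgrPdist_le/(_ _ e0) := H p sp.
  rewrite near_withinE => K; near=> h; have [->|h0] := eqVneq h 0.
    by rewrite addr0 subrr scale0r subrr sn0// normr0 mulr0.
  have hh : dom (c (t + h)) by near: h.
  have : `|0 - p ((h^-1)%:C *: (c (t + h) - c t) - v)| <= e by move: h0; near: h.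
  rewrite sub0r normrN key// ger0_norm; last first.
    rewrite mulr_ge0// ?invr_ge0//; apply: sn_ge0 => //.
    by apply: domB; [apply: domB|apply: domZ].
  by rewrite mulrC ler_pdivrMr ?normr_gt0.
apply/cvgrPdist_le => e e0; have K := H p sp _ e0.
rewrite near_withinE; near=> h => h0.
have hh : dom (c (t + h)) by near: h.
have : p (c (t + h) - c t - h%:C *: v) <= e * `|h| by near: h.
move=> K'; rewrite sub0r normrN key// ger0_norm; last first.
  rewrite mulr_ge0// ?invr_ge0//; apply: sn_ge0 => //.
  by apply: domB; [apply: domB|apply: domZ].
by rewrite mulrC ler_pdivrMr ?normr_gt0.
Unshelve. all: by end_near. Qed.

End GoodTheory.

Ltac solve_dom := repeat first
  [ eassumption | apply: domB | apply: domD | apply: domZ | apply: domN | apply: good0 ].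

Lemma addrBB (V : zmodType) (x y x' y' x'' y'' : V) :
  x + y - (x' + y') - (x'' + y'') = (x - x' - x'') + (y - y' - y'').
Proof. by rewrite !opprD (addrACA x y) (addrACA (x - x')). Qed.

(** Algebra of the product rule: [c] stands for the product with only the second factor moved, and
    [p'] for the first derivative term with the second factor at the moved point. *)
Lemma addr_telescope (V : zmodType) (a b c p p' q : V) :
  a - b - (p + q) = (a - c - p') + ((p' - p) + (c - b - q)).
Proof.
by rewrite [RHS]addrA [_ - p' + (p' - p)]addrA subrK addrACA [a - c + _]addrA subrK -opprD.
Qed.

Lemma near0W (R : realType) (P : R -> Prop) : (forall h, P h) -> \forall h \near (0 : R), P h.
Proof. by move=> H; near=> h. Unshelve. all: by end_near. Qed.

Lemma near0_le (R : realType) (e : R) : 0 < e -> \forall h \near (0 : R), `|h| <= e.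
Proof. exact: nbhs0_le. Qed.

Lemma near0_shift (R : realType) (P : R -> Prop) (t : R) :
  (\forall s \near t, P s) -> \forall h \near (0 : R), P (t + h).
Proof.
move=> H; have : (fun h : R => t + h) x @[x --> (0 : R)] --> t.
  by rewrite -[X in _ --> X]addr0; apply: cvgD; [exact: cvg_cst|exact: cvg_id].
by apply.
Qed.

Lemma is_derive1P (R : realType) (f : R -> R) (t s : R) :
  is_derive t 1 f s <->
  forall e, 0 < e -> \forall h \near (0 : R), `|f (t + h) - f t - h * s| <= e * `|h|.
Proof.
have key h : h != 0 -> `|s - h^-1 *: (f (h *: 1 + t) - f t)| =
    `|h|^-1 * `|f (t + h) - f t - h * s|.
  move=> h0; rewrite -normfV -normrM distrC /GRing.scale /= mulr1 [h + t]addrC.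
  by congr `|_|; rewrite [RHS]mulrBr mulrA mulVf// mul1r.
have E : is_derive t 1 f s <->
    (h^-1 *: (f (h *: 1 + t) - f t) @[h --> (0 : R)^'] --> s).
  split=> [[df <-]|H]; first exact: df.
  apply: DeriveDef; first by apply/cvg_ex; exists s.
  exact/cvg_lim.
rewrite E; split.
  move=> /cvgrPdist_le H e e0; have := H e e0; rewrite near_withinE => K.
  near=> h; have [->|h0] := eqVneq h 0.
    by rewrite addr0 subrr mul0r subrr normr0 mulr0.
  have : `|s - h^-1 *: (f (h *: 1 + t) - f t)| <= e by move: h0; near: h.
  by rewrite key// mulrC ler_pdivrMr ?normr_gt0.
move=> H; apply/cvgrPdist_le => e e0; have K := H e e0.
rewrite near_withinE; near=> h => h0.
have : `|f (t + h) - f t - h * s| <= e * `|h| by near: h.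
by move=> ?; rewrite key// mulrC ler_pdivrMr ?normr_gt0.
Unshelve. all: by end_near. Qed.

(** * Derivatives of curves: uniqueness, linearity, chain rule and product rule *)

Section Curves.
Variable R : realType.
Implicit Types (E F : lcs R) (t : R).

Lemma is_lderiv_near E (c c' : R -> E) t v :
  (\forall h \near (0 : R), c (t + h) = c' (t + h)) ->
  is_lderiv c t v -> is_lderiv c' t v.
Proof.
move=> H D p sp; apply: cvg_trans (D p sp); apply: near_eq_cvg.
have H0 : c t = c' t by have /= := nbhs_singleton H; rewrite addr0.
by rewrite near_withinE; near=> h => _; rewrite -H0 (near H h).
Unshelve. all: by end_near. Qed.

Lemma lderiv_near E (c c' : R -> E) t :
  (\forall h \near (0 : R), c (t + h) = c' (t + h)) -> lderiv c t = lderiv c' t.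
Proof.
move=> H; rewrite /lderiv; congr xget; apply/seteqP; split=> v [dv D]; split => //.
  exact: is_lderiv_near D.
by apply: is_lderiv_near D; apply: filterS H => h ->.
Qed.

Section Good.
Variables (E : lcs R) (gE : good E).
Implicit Types c : R -> E.

(** The two remainders at one common nonzero step differ by that step times [v - w]; dividing by the
    step bounds [p (v - w)] by every e > 0, and the seminorms separate points. *)
Lemma is_lderiv_unique c t v w : (\forall h \near (0 : R), dom (c (t + h))) ->
  dom v -> dom w -> is_lderiv c t v -> is_lderiv c t w -> v = w.
Proof.
move=> dc dv dw /(is_lderivP gE dc dv) Hv /(is_lderivP gE dc dw) Hw.
have dct : dom (c t) by have /= := nbhs_singleton dc; rewrite addr0.
apply/subr0_eq/(good_sep gE); first exact: domB.
move=> p sp; apply/eqP; rewrite eq_le sn_ge0 ?andbT//; last exact: domB.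
apply/ler_addgt0Pl => e e0; rewrite addr0.
have e20 : 0 < e / 2 by rewrite divr_gt0.
have [d /= d0 Hd] : \forall h \near (0 : R), [/\ dom (c (t + h)),
    p (c (t + h) - c t - h%:C *: v) <= e / 2 * `|h| &
    p (c (t + h) - c t - h%:C *: w) <= e / 2 * `|h|].
  near=> h; split; first by near: h.
    by near: h; exact: Hv.
  by near: h; exact: Hw.
have [|dch A B] := Hd (d / 2); first by rewrite /= sub0r normrN ger0_norm; lra.
have dd : d / 2 != 0 by rewrite mulf_neq0// gt_eqF.
have X : p ((d / 2)%:C *: (v - w)) <= e * `|d / 2|.
  have -> : (d / 2)%:C *: (v - w) = (c (t + d / 2) - c t - (d / 2)%:C *: w) -
     (c (t + d / 2) - c t - (d / 2)%:C *: v).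
    by rewrite scalerBr opprB [RHS]addrC addrA subrK.
  apply: le_trans (sn_leB gE sp _ _) _; solve_dom => //.
  by lra.
move: X; rewrite snZ//; last exact: domB.
by rewrite mulrC ler_pM2r ?normr_gt0.
Unshelve. all: by end_near. Qed.

Lemma lderivE c t v : (\forall h \near (0 : R), dom (c (t + h))) ->
  dom v -> is_lderiv c t v -> lderiv c t = v.
Proof.
by move=> dc dv D; apply: xget_unique => // w [dw Dw]; apply: is_lderiv_unique Dw D.
Qed.

Lemma is_lderiv_cont c t v : (\forall h \near (0 : R), dom (c (t + h))) ->
  dom v -> is_lderiv c t v -> forall p, sn p -> forall e, 0 < e ->
  \forall h \near (0 : R), p (c (t + h) - c t) <= e.
Proof.
move=> dc dv /(is_lderivP gE dc dv) D p sp e e0.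
have pv := sn_ge0 gE sp dv.
have dct : dom (c t) by have /= := nbhs_singleton dc; rewrite addr0.
have ep : 0 < e / (1 + p v) by rewrite divr_gt0// ltr_pwDl.
near=> h.
have dch : dom (c (t + h)) by near: h.
have -> : c (t + h) - c t = (c (t + h) - c t - h%:C *: v) + h%:C *: v by rewrite subrK.
apply: le_trans (good_le gE sp _ _) _; solve_dom => //.
rewrite snZ//.
have A : p (c (t + h) - c t - h%:C *: v) <= 1 * `|h|.
  by near: h; exact: D.
apply: (@le_trans _ _ (`|h| * (1 + p v))); first by lra.
rewrite -ler_pdivlMr ?ltr_pwDl//; near: h; exact: nbhs0_le.
Unshelve. all: by end_near. Qed.

Lemma is_lderiv_cst (x : E) t : is_lderiv (fun=> x) t 0.
Proof.
move=> p sp; rewrite (_ : (fun _ => _) = cst 0); first exact: cvg_cst.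
by apply/funext => h /=; rewrite subrr scaler0 subrr sn0.
Qed.

Lemma is_lderivP_lin (a : R[i]) c1 c2 t v1 v2 :
  (\forall h \near (0 : R), dom (c1 (t + h))) ->
  (\forall h \near (0 : R), dom (c2 (t + h))) -> dom v1 -> dom v2 ->
  is_lderiv c1 t v1 -> is_lderiv c2 t v2 ->
  is_lderiv (fun s => a *: c1 s + c2 s) t (a *: v1 + v2).
Proof.
move=> dc1 dc2 dv1 dv2 D1 D2.
have d1 : dom (c1 t) by have /= := nbhs_singleton dc1; rewrite addr0.
have d2 : dom (c2 t) by have /= := nbhs_singleton dc2; rewrite addr0.
apply/(is_lderivP gE).
- by near=> h; apply: (goodP gE); [near: h; exact: dc1|near: h; exact: dc2].
- exact: (goodP gE).
move=> p sp e e0.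
have na := normc_ge0 a.
have K1 := (is_lderivP gE dc1 dv1).1 D1 p sp (e / 2 / (1 + Normc.normc a)).
have K2 := (is_lderivP gE dc2 dv2).1 D2 p sp (e / 2).
near=> h.
have dch1 : dom (c1 (t + h)) by near: h.
have dch2 : dom (c2 (t + h)) by near: h.
have -> : a *: c1 (t + h) + c2 (t + h) - (a *: c1 t + c2 t) - h%:C *: (a *: v1 + v2) =
  a *: (c1 (t + h) - c1 t - h%:C *: v1) + (c2 (t + h) - c2 t - h%:C *: v2).
  by rewrite scalerDr addrBB !scalerBr !scalerA [a * _]mulrC.
apply: le_trans (good_le gE sp _ _) _; solve_dom => //.
rewrite (goodZ gE)//; last by solve_dom.
have A2 : p (c2 (t + h) - c2 t - h%:C *: v2) <= e / 2 * `|h|.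
  by near: h; apply: K2; lra.
have A1 : p (c1 (t + h) - c1 t - h%:C *: v1) <= e / 2 / (1 + Normc.normc a) * `|h|.
  by near: h; apply: K1; rewrite divr_gt0 ?ltr_pwDl//; lra.
have : Normc.normc a * p (c1 (t + h) - c1 t - h%:C *: v1) <= e / 2 * `|h|.
  apply: (@le_trans _ _ ((1 + Normc.normc a) * (e / 2 / (1 + Normc.normc a) * `|h|))).
    apply: ler_pM => //; last by lra.
    by apply: sn_ge0 => //; solve_dom.
  have : 1 + Normc.normc a != 0 by rewrite gt_eqF// ltr_pwDl.
  by move=> ?; rewrite le_eqVlt; apply/orP; left; apply/eqP; field.
lra.
Unshelve. all: by end_near. Qed.

(** The remainder splits into the remainder of [c] at the increment of [s] and the remainder of [s]
    times [v]; the increment of [s] is O(h), which keeps the first part o(h). *)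
Lemma is_lderiv_comp c (s : R -> R) (t r : R) v :
  (\forall h \near (0 : R), dom (c (s t + h))) -> dom v ->
  is_lderiv c (s t) v -> is_derive t 1 s r ->
  is_lderiv (c \o s) t (r%:C *: v).
Proof.
move=> dc dv D /is_derive1P Ds.
have dct : dom (c (s t)) by have /= := nbhs_singleton dc; rewrite addr0.
have cs : (s (t + h) - s t) @[h --> (0 : R)] --> (0 : R).
  apply/cvgrPdist_le => e e0; have e1 : 0 < e / (1 + `|r|) by rewrite divr_gt0// ltr_pwDl.
  near=> h.
  have A : `|s (t + h) - s t - h * r| <= 1 * `|h| by near: h; exact: Ds.
  have B : `|h| <= e / (1 + `|r|).
    by near: h; exact: near0_le.
  rewrite sub0r normrN.
  have -> : s (t + h) - s t = (s (t + h) - s t - h * r) + h * r by rewrite subrK.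
  apply: le_trans (ler_normD _ _) _; rewrite normrM.
  move: B; rewrite ler_pdivlMr ?ltr_pwDl// => B.
  by apply: le_trans B; lra.
have dc' : \forall h \near (0 : R), dom (c (s (t + h))).
  have K : \forall h \near (0 : R), dom (c (s t + (s (t + h) - s t))) := cs _ dc.
  by apply: filterS K => h; rewrite addrC subrK.
apply/(is_lderivP gE) => //; first exact: domZ.
move=> p sp e e0.
have pv := sn_ge0 gE sp dv.
have nr := normr_ge0 r.
have K := (is_lderivP gE dc dv).1 D p sp (e / 2 / (1 + `|r|)).
have e1 : 0 < e / 2 / (1 + `|r|) by rewrite divr_gt0 ?ltr_pwDl//; lra.
have K1 : \forall h \near (0 : R), p (c (s t + (s (t + h) - s t)) - c (s t) -
  (s (t + h) - s t)%:C *: v) <= e / 2 / (1 + `|r|) * `|s (t + h) - s t| := cs _ (K e1).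
near=> h.
have A : p (c (s (t + h)) - c (s t) - (s (t + h) - s t)%:C *: v) <=
   e / 2 / (1 + `|r|) * `|s (t + h) - s t|.
  have -> : c (s (t + h)) = c (s t + (s (t + h) - s t)) by rewrite [s t + _]addrC subrK.
  by near: h.
have dh : dom (c (s (t + h))) by near: h.
have B1 : `|s (t + h) - s t - h * r| <= 1 * `|h| by near: h; exact: Ds.
have B2 : `|s (t + h) - s t - h * r| <= e / 2 / (1 + p v) * `|h|.
  by near: h; apply: Ds; rewrite divr_gt0 ?ltr_pwDl//; lra.
have -> : (c \o s) (t + h) - (c \o s) t - h%:C *: (r%:C *: v) =
  (c (s (t + h)) - c (s t) - (s (t + h) - s t)%:C *: v) +
  (s (t + h) - s t - h * r)%:C *: v.
  rewrite real_complex_scale [in RHS](rmorphB _ (_ - _)) [in RHS]scalerBl addrA.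
  by rewrite subrK.
apply: le_trans (good_le gE sp _ _) _; solve_dom => //.
rewrite snZ//.
have C1 : `|s (t + h) - s t| <= (1 + `|r|) * `|h|.
  have -> : s (t + h) - s t = (s (t + h) - s t - h * r) + h * r by rewrite subrK.
  by apply: le_trans (ler_normD _ _) _; rewrite normrM; lra.
have C2 : e / 2 / (1 + `|r|) * `|s (t + h) - s t| <= e / 2 * `|h|.
  apply: le_trans (ler_wpM2l (ltW e1) C1) _.
  by rewrite mulrA divfK// gt_eqF// ltr_pwDl.
have C3 : `|s (t + h) - s t - h * r| * p v <= e / 2 * `|h|.
  apply: (@le_trans _ _ ((e / 2 / (1 + p v) * `|h|) * (1 + p v))).
    by apply: ler_pM => //; lra.
  by rewrite mulrAC divfK// gt_eqF// ltr_pwDl.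
lra.
Unshelve. all: by end_near. Qed.

End Good.

(** Joint continuity is stated with one seminorm on each factor, a form that fits scalar
    multiplication and the pointwise product on [CinfC U]. *)
Record bilin (E F G : lcs R) (mu : E -> F -> G) : Prop := Bilin {
  bil_dom : forall x y, dom x -> dom y -> dom (mu x y);
  bilDl : forall a x x' y, dom x -> dom x' -> dom y ->
    mu (a *: x + x') y = a *: mu x y + mu x' y;
  bilDr : forall a x y y', dom x -> dom y -> dom y' ->
    mu x (a *: y + y') = a *: mu x y + mu x y';
  bil_le : forall p, sn p -> exists q1 q2 C, [/\ sn q1, sn q2, 0 <= C &
    forall x y, dom x -> dom y -> p (mu x y) <= C * (q1 x * q2 y)] }.

Section Bilinear.
Variables (E F G : lcs R) (gE : good E) (gF : good F) (gG : good G).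
Variables (mu : E -> F -> G) (bmu : bilin mu).

Lemma bilBl x x' y : dom x -> dom x' -> dom y -> mu (x - x') y = mu x y - mu x' y.
Proof.
by move=> dx dx' dy; rewrite addrC -scaleN1r (bilDl bmu)// scaleN1r addrC.
Qed.

Lemma bilBr x y y' : dom x -> dom y -> dom y' -> mu x (y - y') = mu x y - mu x y'.
Proof.
by move=> dx dx' dy; rewrite addrC -scaleN1r (bilDr bmu)// scaleN1r addrC.
Qed.

Lemma bil0l y : dom y -> mu 0 y = 0.
Proof.
by move=> dy; rewrite -[0](subrr 0) bilBl//; [rewrite subrr|exact: good0..].
Qed.

Lemma bil0r x : dom x -> mu x 0 = 0.
Proof.
by move=> dy; rewrite -[0](subrr 0) bilBr//; [rewrite subrr|exact: good0..].
Qed.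

Lemma bilZl a x y : dom x -> dom y -> mu (a *: x) y = a *: mu x y.
Proof.
move=> dx dy; rewrite -[a *: x]addr0 (bilDl bmu)//; last exact: good0.
by rewrite bil0l// addr0.
Qed.

Lemma bilZr a x y : dom x -> dom y -> mu x (a *: y) = a *: mu x y.
Proof.
move=> dx dy; rewrite -[a *: y]addr0 (bilDr bmu)//; last exact: good0.
by rewrite bil0r// addr0.
Qed.

Lemma is_lderiv_bil (c : R -> E) (d : R -> F) t v w :
  (\forall h \near (0 : R), dom (c (t + h))) ->
  (\forall h \near (0 : R), dom (d (t + h))) -> dom v -> dom w ->
  is_lderiv c t v -> is_lderiv d t w ->
  is_lderiv (fun s => mu (c s) (d s)) t (mu v (d t) + mu (c t) w).
Proof.
move=> dc dd dv dw Dc Dd.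
have dct : dom (c t) by have /= := nbhs_singleton dc; rewrite addr0.
have ddt : dom (d t) by have /= := nbhs_singleton dd; rewrite addr0.
have bd := bil_dom bmu.
apply/(is_lderivP gG).
- by near=> h; apply: bd; [near: h; exact: dc|near: h; exact: dd].
- by apply: domD => //; apply: bd.
move=> p sp e e0.
have [q1 [q2 [C [s1 s2 C0 Hb]]]] := bil_le bmu sp.
have Kc := (is_lderivP gE dc dv).1 Dc q1 s1.
have Kd := (is_lderivP gF dd dw).1 Dd q2 s2.
have Ld := is_lderiv_cont gF dd dw Dd s2.
have n1 := sn_ge0 gE s1 dv; have n2 := sn_ge0 gE s1 dct; have n3 := sn_ge0 gF s2 ddt.
(* [M] collects the coefficients of the three error terms: [q2 (d (t + h))] is at most
   [q2 (d t) + 1] for small h, and 1 + C instead of C keeps [M] positive. *)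
pose M := (1 + C) * ((q2 (d t) + 1) + q1 v + q1 (c t)).
have M0 : 0 < M by apply: mulr_gt0; lra.
pose e' := e / M.
have e'0 : 0 < e' by rewrite divr_gt0.
near=> h.
have dch : dom (c (t + h)) by near: h.
have ddh : dom (d (t + h)) by near: h.
have A1 : q1 (c (t + h) - c t - h%:C *: v) <= e' * `|h| by near: h; exact: Kc.
have A2 : q2 (d (t + h) - d t - h%:C *: w) <= e' * `|h| by near: h; exact: Kd.
have A3 : q2 (d (t + h) - d t) <= e' by near: h; exact: Ld.
have A4 : q2 (d (t + h) - d t) <= 1 by near: h; exact: Ld.
have dz : dom (c (t + h) - c t - h%:C *: v) by apply: domB => //; [apply: domB|apply: domZ].
have dy : dom (d (t + h) - d t - h%:C *: w) by apply: domB => //; [apply: domB|apply: domZ].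
have du : dom (d (t + h) - d t) by apply: domB.
have -> : mu (c (t + h)) (d (t + h)) - mu (c t) (d t) -
     h%:C *: (mu v (d t) + mu (c t) w) =
  mu (c (t + h) - c t - h%:C *: v) (d (t + h)) +
  (h%:C *: mu v (d (t + h) - d t) + mu (c t) (d (t + h) - d t - h%:C *: w)).
  rewrite !bilBl ?bilBr ?bilZl ?bilZr//; do ?[exact: domB|exact: domZ].
  rewrite scalerDr scalerBr.
  exact: addr_telescope.
apply: le_trans (good_le gG sp _ _) _; first exact: bd.
  by apply: domD => //; [apply: domZ => //; exact: bd|exact: bd].
apply: le_trans (lerD (lexx _) (good_le gG sp _ _)) _.
- by apply: domZ => //; exact: bd.
- exact: bd.
rewrite snZ//; last exact: bd.
have B1 := Hb _ _ dz ddh; have B2 := Hb _ _ dv du; have B3 := Hb _ _ dct dy.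
have N1 := sn_ge0 gE s1 dz; have N2 := sn_ge0 gF s2 du; have N3 := sn_ge0 gF s2 dy.
have N4 := sn_ge0 gF s2 ddh; have N5 := normr_ge0 h.
have A5 : q2 (d (t + h)) <= q2 (d t) + 1.
  by have := sn_lower gF s2 ddh ddt; lra.
have F1 : q1 (c (t + h) - c t - h%:C *: v) * q2 (d (t + h)) <= e' * `|h| * (q2 (d t) + 1).
  exact: ler_pM.
have F2 : `|h| * (C * (q1 v * q2 (d (t + h) - d t))) <= `|h| * (C * (q1 v * e')).
  by do 3!apply: ler_wpM2l => //.
have F3 : q1 (c t) * q2 (d (t + h) - d t - h%:C *: w) <= q1 (c t) * (e' * `|h|).
  exact: ler_wpM2l.
apply: (@le_trans _ _ (C * (e' * `|h| * (q2 (d t) + 1)) + (`|h| * (C * (q1 v * e')) +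
    C * (q1 (c t) * (e' * `|h|))))).
  apply: lerD; first by apply: le_trans B1 _; apply: ler_wpM2l.
  apply: lerD; last by apply: le_trans B3 _; apply: ler_wpM2l.
  by apply: le_trans F2; apply: ler_wpM2l.
have -> : e * `|h| = M * (e' * `|h|) by rewrite mulrA /e' mulrC [M * _]mulrC divfK ?gt_eqF// mulrC.
have eh : 0 <= e' * `|h| by apply: mulr_ge0 => //; apply: ltW.
rewrite /M; set X := e' * `|h| in eh *; set S := _ + q1 v + q1 _.
have -> : C * (X * (q2 (d t) + 1)) + (`|h| * (C * (q1 v * e')) + C * (q1 (c t) * X)) = C * S * X.
  by rewrite /S /X; ring.
by apply: ler_wpM2r => //; apply: ler_wpM2r; rewrite /S; lra.
Unshelve. all: by end_near. Qed.

End Bilinear.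
End Curves.

(** * Iterated derivatives and finite differences *)

Definition fdiff (V W : zmodType) (u : V) (f : V -> W) : V -> W :=
  fun x => f (x + u) - f x.

Section DerivativeSequences.
Variables (R : realType) (E : lcs R) (gE : good E).
Implicit Types (c : R -> E) (d : nat -> R -> E) (p : E -> R).

(** A smooth curve together with all its derivatives as data, so that differences and affine
    reparametrizations are carried through every order at once. *)
Definition dseq d := forall k t, dom (d k t) /\ is_lderiv (d k) t (d k.+1 t).

Lemma dseq_dom d k t : dseq d -> dom (d k t).
Proof. by move=> H; have [] := H k t. Qed.

Lemma dseq_lin (a : R[i]) d d' : dseq d -> dseq d' ->
  dseq (fun k t => a *: d k t + d' k t).
Proof.
move=> H H' k t; have [? ?] := H k t; have [? ?] := H' k t.
have [? _] := H k.+1 t; have [? _] := H' k.+1 t.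
split; first exact: goodP.
by apply: is_lderivP_lin => //; apply: near0W => h; apply: dseq_dom.
Qed.

Lemma dseq_comp_aff d (a b : R) : dseq d ->
  dseq (fun k t => (a ^+ k)%:C *: d k (a * t + b)).
Proof.
move=> H k t; split; first by solve_dom; exact: dseq_dom.
have -> : (a ^+ k.+1)%:C *: d k.+1 (a * t + b) =
  (a ^+ k)%:C *: (a%:C *: d k.+1 (a * t + b)) + 0.
  by rewrite addr0 real_complex_scale exprSr.
rewrite (_ : (fun s => _) = fun s => (a ^+ k)%:C *: (d k \o (fun t => a * t + b)) s + 0); last first.
  by apply/funext => s; rewrite addr0.
apply: is_lderivP_lin => //.
- by apply: near0W => h; apply: dseq_dom.
- by apply: near0W => h; exact: good0.
- by solve_dom; exact: dseq_dom.
- exact: good0.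
- apply: is_lderiv_comp => //.
  + by apply: near0W => h; apply: dseq_dom.
  + exact: dseq_dom.
  + exact: (H k _).2.
  + apply/is_derive1P => e e0; apply: near0W => h.
    rewrite (_ : a * (t + h) + b - _ - _ = 0); last by ring.
    by rewrite normr0 mulr_ge0// ltW.
- exact: is_lderiv_cst.
Qed.

Lemma dseq_shift d (b : R) : dseq d -> dseq (fun k t => d k (t + b)).
Proof.
move=> /(@dseq_comp_aff d 1 b).
by congr dseq; apply/funext => k; apply/funext => t; rewrite expr1n scale1r mul1r.
Qed.

Lemma dseq_iter d j : dseq d -> dseq (fun k => d (k + j)%N).
Proof. by move=> H k t; exact: H. Qed.

Lemma dseq_fdiff d (r : R) : dseq d -> dseq (fun k => fdiff r (d k)).
Proof.
move=> H; have := dseq_lin (-1) H (dseq_shift r H).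
by congr dseq; apply/funext => k; apply/funext => t; rewrite scaleN1r addrC.
Qed.

Section Estimates.
Variables (p : E -> R) (sp : sn p).

(** Continuous induction: with the slope enlarged from C to C + n, every point of [a, b] has a
    neighbourhood in which increments obey the bound, and the set of endpoints up to which the bound
    holds throughout has supremum [b]. *)
Lemma mean_value (c c' : R -> E) (C a b : R) : (forall t, dom (c t)) ->
  (forall t, dom (c' t)) -> (forall t, is_lderiv c t (c' t)) ->
  (forall t, a <= t <= b -> p (c' t) <= C) -> a <= b ->
  p (c b - c a) <= C * (b - a).
Proof.
move=> dc dc' D B ab; apply/ler_addgt0Pl => e e0.
have [->|ab'] := eqVneq a b; first by rewrite !subrr (sn0 gE)// mulr0 addr0 ltW.
have {ab'} ab' : a < b by rewrite lt_neqAle ab'.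
pose n := e / (b - a); have n0 : 0 < n by rewrite divr_gt0 ?subr_gt0.
have -> : e + C * (b - a) = (C + n) * (b - a).
  have ba : b - a != 0 by rewrite gt_eqF// subr_gt0.
  by rewrite mulrDl [n * _]divfK// addrC.
have loc t : a <= t <= b -> exists2 d, 0 < d & forall h, `|h| < d ->
    p (c (t + h) - c t) <= (C + n) * `|h|.
  move=> tab; have := (is_lderivP gE (near0W (fun h => dc (t + h))) (dc' t)).1 (D t) p sp n n0.
  case=> d /= d0 H; exists d => // h hd.
  have {}H : p (c (t + h) - c t - h%:C *: c' t) <= n * `|h|.
    by apply: H; rewrite /= sub0r normrN.
  rewrite -[c (t + h) - c t](subrK (h%:C *: c' t)).
  apply: le_trans (good_le gE sp _ _) _; do ?by solve_dom.
  rewrite (snZ gE)// mulrDl addrC; apply: lerD => //.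
  by rewrite mulrC; apply: ler_wpM2r => //; exact: B.
pose S := [set u | a <= u <= b /\ forall w, a <= w <= u -> p (c w - c a) <= (C + n) * (w - a)].
have C0 : 0 <= C by apply: le_trans (B a _); [exact: sn_ge0|rewrite lexx].
have Cn : 0 <= C + n by lra.
have Sa : S a.
  split; first by rewrite lexx.
  by move=> w /le_anti <-; rewrite !subrr (sn0 gE)// mulr0.
have hS : has_sup S by split; [exists a | exists b => u [/andP[]]].
have Sub u : S u -> u <= sup S by move=> Su; apply: ub_le_sup => //; exact: hS.2.
have as_ : a <= sup S by exact: Sub.
have sb : sup S <= b by apply: ge_sup; [exists a|move=> u [/andP[]]].
set s := sup S in Sub as_ sb *.
have [d d0 Hd] := loc s (introT andP (conj as_ sb)).
have low w : a <= w -> w < s -> p (c w - c a) <= (C + n) * (w - a).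
  move=> aw ws; have [u [_ Su] uw] := sup_adherent (eps := s - w) (ltac:(by rewrite subr_gt0)) hS.
  by apply: Su; rewrite aw /= ltW//; move: uw; rewrite -/s; lra.
have Ps : p (c s - c a) <= (C + n) * (s - a).
  have [sa|sa] := eqVneq a s; first by rewrite -sa !subrr (sn0 gE)// mulr0.
  have {}sa : a < s by rewrite lt_neqAle sa.
  (* [s - h] lies below the supremum, where the bound is known, and within the radius at [s]; this
     gives the bound at [s] itself. *)
  pose h := Num.min (d / 2) (s - a).
  have h0 : 0 < h by rewrite lt_min divr_gt0//= subr_gt0.
  have hd : h < d by rewrite gt_min; apply/orP; left; lra.
  have hs : h <= s - a by rewrite ge_min lexx orbT.
  have A := low (s - h) (ltac:(lra)) (ltac:(lra)).
  have := Hd (- h); rewrite normrN gtr0_norm// => /(_ hd) A'.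
  apply: le_trans (sn_tri gE sp _ (dc (s - h)) _) _ => //.
  by rewrite (sn_distC gE)//; lra.
have near_s h : 0 <= h -> h < d -> p (c (s + h) - c a) <= (C + n) * (s + h - a).
  move=> h0 hd; have := Hd h; rewrite ger0_norm// => /(_ hd) A'.
  by apply: le_trans (sn_tri gE sp _ (dc s) _) _ => //; lra.
have [sb'|sb'] := eqVneq s b; first by rewrite -sb'.
have {}sb' : s < b by rewrite lt_neqAle sb'.
(* If [s < b], the bound extends to [s + h], against the choice of the supremum. *)
pose h := Num.min (d / 2) (b - s).
have h0 : 0 < h by rewrite lt_min divr_gt0//= subr_gt0.
have hd : h < d by rewrite gt_min; apply/orP; left; lra.
have hs : h <= b - s by rewrite ge_min lexx orbT.
have : s + h <= s; last by lra.
apply: Sub; split; first by lra.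
move=> w /andP[aw wh]; have [ws|ws] := ltP w s; first exact: low.
by have := near_s (w - s); rewrite [s + _]addrC subrK; apply; lra.
Qed.

Lemma dseq_mean d (C a b : R) : dseq d ->
  (forall t, a <= t <= b -> p (d 1%N t) <= C) -> a <= b ->
  p (d 0%N b - d 0%N a) <= C * (b - a).
Proof.
move=> H B ab; apply: mean_value B ab => t; [exact: dseq_dom..|exact: (H 0%N t).2].
Qed.

(** The mean value inequality is used twice: for [d 0 - (t - s) d 1 s], whose derivative is an
    increment of [d 1], and for that increment, which is at most C r. *)
Lemma dseq_taylor2 d (C s r : R) : dseq d -> 0 <= r ->
  (forall t, s <= t <= s + r -> p (d 2%N t) <= C) ->
  p (d 0%N (s + r) - d 0%N s - r%:C *: d 1%N s) <= C * r ^+ 2.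
Proof.
move=> H r0 B.
have C0 : 0 <= C by apply: le_trans (B s _); [apply: sn_ge0 => //; exact: dseq_dom|lra].
have dd k t := dseq_dom k t H.
pose g (t : R) := d 0%N t - (t - s)%:C *: d 1%N s.
have Dg t : is_lderiv g t (d 1%N t - d 1%N s).
  have -> : d 1%N t - d 1%N s = (-1) *: d 1%N s + d 1%N t by rewrite scaleN1r addrC.
  rewrite (_ : g = fun u => (-1) *: ((u - s)%:C *: d 1%N s) + d 0%N u); last first.
    by apply/funext => u; rewrite scaleN1r addrC.
  apply: is_lderivP_lin => //; do ?by apply: near0W => h; solve_dom.
    apply/(is_lderivP gE) => //; first by apply: near0W => h; solve_dom.
    move=> q sq e e0; apply: near0W => h.
    rewrite -!scalerBl -!rmorphB (_ : t + h - s - (t - s) - h = 0); last by ring.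
    by rewrite scale0r (sn0 gE)// mulr_ge0// ltW.
  exact: (H 0%N t).2.
have := @mean_value g _ (C * r) s (s + r) _ _ Dg.
have -> : g (s + r) - g s = d 0%N (s + r) - d 0%N s - r%:C *: d 1%N s.
  by rewrite /g subrr scale0r subr0 (_ : s + r - s = r) 1?addrAC//; ring.
move=> /(_ _ _ _ _)/le_trans; apply.
- by move=> t; rewrite /g; solve_dom.
- by move=> t; rewrite /g; solve_dom.
- move=> t /andP[st tr].
  apply: le_trans (@dseq_mean _ C s t (dseq_iter 1 H) _ st) _.
    by move=> u /andP[su ut]; apply: B; lra.
  by apply: ler_wpM2l => //; lra.
- by lra.
- by rewrite (_ : s + r - s = r); [rewrite -mulrA expr2|ring].
Qed.

Lemma fdiff_linear (f g : R -> E) (a : R[i]) r m x :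
  iter m (fdiff r) (fun t => a *: f t + g t) x =
  a *: iter m (fdiff r) f x + iter m (fdiff r) g x.
Proof.
elim: m x => // m IH x; rewrite !iterS /fdiff !IH.
by rewrite scalerBr opprD addrACA.
Qed.

Lemma dseq_iter_fdiff d m (r : R) : dseq d -> dseq (fun k => iter m (fdiff r) (d k)).
Proof. by move=> H; elim: m => // m IH; exact: dseq_fdiff. Qed.

(** One difference replaces [d] by [fdiff r (d k)], whose derivative of order one less is at most C
    r by the mean value inequality; the sampled points stay in [a, a + m r]. *)
Lemma iter_fdiff_le d m (C a r : R) : dseq d -> 0 <= r ->
  (forall t, a <= t <= a + m%:R * r -> p (d m t) <= C) ->
  p (iter m (fdiff r) (d 0%N) a) <= C * r ^+ m.
Proof.
move=> H r0; elim: m d a C H => [|m IH] d a C H B.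
  by rewrite expr0 mulr1; apply: B; lra.
rewrite iterSr.
have C0 : 0 <= C.
  apply: le_trans (B a _); first by apply: sn_ge0 => //; exact: dseq_dom.
  by rewrite lexx/= lerDl mulr_ge0.
rewrite exprS mulrA; apply: (IH (fun k => fdiff r (d k))); first exact: dseq_fdiff.
move=> t /andP[at_ tm]; rewrite /fdiff -natr1 in B *.
have := @dseq_mean (fun k => d (k + m)%N) C t (t + r) (dseq_iter m H).
rewrite [_ + r - _](_ : _ = r); last by ring.
apply; last by lra.
by move=> u /andP[tu ur]; apply: B; lra.
Qed.

(** Induction through Delta^(m+1) c = Delta^m g + r Delta^m c' with g = Delta c - r c'. The m-th
    derivative of g is at most C r^2 by the second-order estimate, so every step adds one C r^(m+2);
    this accounts for the factor m. *)
Lemma iter_fdiff_approx d m (C a r : R) : dseq d -> 0 <= r ->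
  (forall t, a <= t <= a + m%:R * r -> p (d m.+1 t) <= C) ->
  p (iter m (fdiff r) (d 0%N) a - (r ^+ m)%:C *: d m a) <= C * m%:R * r ^+ m.+1.
Proof.
move=> H r0; elim: m d a H => [|m IH] d a H B.
  by rewrite expr0 scale1r subrr (sn0 gE)// mulr0 mul0r.
have dd k t := dseq_dom k t H.
have C0 : 0 <= C.
  apply: le_trans (B a _); first by apply: sn_ge0 => //; exact: dseq_dom.
  by rewrite lexx/= lerDl mulr_ge0.
pose g k t := (- r%:C) *: d k.+1 t + fdiff r (d k) t.
have Hg : dseq g.
  apply: (dseq_lin _ (d := fun k => d k.+1)); last exact: dseq_fdiff.
  by move=> k t; exact: H.
have E1 : iter m.+1 (fdiff r) (d 0%N) a =
    iter m (fdiff r) (g 0%N) a + r%:C *: iter m (fdiff r) (d 1%N) a.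
  rewrite iterSr addrC -fdiff_linear; congr (iter m _ _ _); apply/funext => t.
  by rewrite /g scaleNr addNKr.
rewrite E1 -addrA.
have -> : r%:C *: iter m (fdiff r) (d 1%N) a - (r ^+ m.+1)%:C *: d m.+1 a =
  r%:C *: (iter m (fdiff r) (d 1%N) a - (r ^+ m)%:C *: d m.+1 a).
  by rewrite scalerBr real_complex_scale exprS.
have dom_it (e : nat -> R -> E) : dseq e -> dom (iter m (fdiff r) (e 0%N) a).
  by move=> He; exact: (dseq_dom 0%N a (dseq_iter_fdiff m r He)).
have dg := dom_it _ Hg.
have dd1 := dom_it _ (dseq_iter 1 H).
have mr : 0 <= m%:R * r by rewrite mulr_ge0.
apply: le_trans (good_le gE sp _ _) _ => //; first by solve_dom.
have A1 : p (iter m (fdiff r) (g 0%N) a) <= (C * r ^+ 2) * r ^+ m.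
  apply: iter_fdiff_le => // t /andP[at_ tm].
  rewrite /g scaleNr addrC.
  have := @dseq_taylor2 (fun k => d (k + m)%N) C t r (dseq_iter m H) r0.
  apply=> u /andP[tu ur]; apply: B; rewrite -natr1; lra.
have A2 : p (iter m (fdiff r) (d 1%N) a - (r ^+ m)%:C *: d m.+1 a) <= C * m%:R * r ^+ m.+1.
  apply: (IH (fun k => d k.+1)); first by move=> k t; exact: H.
  by move=> t /andP[at_ tm]; apply: B; rewrite -natr1; lra.
rewrite (snZ gE)//; last by solve_dom.
rewrite ger0_norm//.
have := ler_wpM2l r0 A2.
rewrite -natr1 !exprS; set X := r ^+ m; move: A1; rewrite expr2 -/X.
set u := p _; set w := p _; rewrite !mulrA; lra.
Qed.

End Estimates.
End DerivativeSequences.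

(** * Polarization of finite differences *)

Section Djokovic.
Variables (R : realType) (V : lmodType R) (W : lmodType R[i]).
Implicit Types (us : seq V) (f : V -> W).

Definition fdiffs us f : V -> W := foldr (fun u g => fdiff u g) f us.

(* For each set [A] of directions, the triple of the sign [(-1)^|A|], the
   direction [- \sum_(j in A) u_j / j] and the shift [\sum_(j in A) u_j]. *)
Fixpoint polar_terms (i : nat) us : seq (R * V * V) :=
  if us is u :: us' then
    let T := polar_terms i.+1 us' in
    T ++ [seq (- z.1.1, z.1.2 - i%:R^-1 *: u, z.2 + u) | z <- T]
  else [:: (1, 0, 0)].

(** The signed binomial coefficient (-1)^(m-q) binom(m, q), given by Pascal's rule. *)
Fixpoint fdiff_weight (m q : nat) : R :=
  if m is m'.+1 then
    (if q is q'.+1 then fdiff_weight m' q' else 0) - fdiff_weight m' q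
  else (q == 0)%:R.

Lemma fdiff_weight0 m : fdiff_weight m 0 = (-1) ^+ m.
Proof. by elim: m => //= m ->; rewrite sub0r exprS mulN1r. Qed.

Lemma fdiff_weight_gt m q : (m < q)%N -> fdiff_weight m q = 0.
Proof.
elim: m q => [|m IH] [|q]//= mq.
by rewrite !IH ?subrr// ltnW.
Qed.

Lemma iter_fdiffE m (a : V) f x :
  iter m (fdiff a) f x =
  \sum_(q < m.+1) (fdiff_weight m q)%:C *: f (x + q%:R *: a).
Proof.
elim: m x => [|m IH] x; first by rewrite big_ord1 /= scale0r addr0 scale1r.
rewrite iterS /fdiff !IH.
rewrite [RHS]big_ord_recl /= scale0r addr0 sub0r.
under [in RHS]eq_bigr => i _ do rewrite rmorphB scalerBl.
rewrite sumrB /= [in RHS]addrCA; congr (_ + _).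
  apply: eq_bigr => i _; rewrite /bump /= add1n -nat1r scalerDl scale1r addrA.
  by [].
rewrite [in RHS]big_ord_recr /= /bump /= add1n (fdiff_weight_gt (ltnSn m)) rmorph0 scale0r addr0.
by rewrite big_ord_recl /= scale0r addr0 opprD rmorphN scaleNr.
Qed.

Lemma fdiffs_has0 us f x : 0 \in us -> fdiffs us f x = 0.
Proof.
elim: us x => //= u us IH x; rewrite in_cons /fdiff => /orP[/eqP <-|h].
  by rewrite addr0 subrr.
by rewrite !IH// subrr.
Qed.

(** The directions that appear when [q] times the pure direction of [polar_terms] is added to its
    shift: [u_j] keeps the weight 1 - q/j and is therefore killed for j = q. *)
Fixpoint tilt (q i : nat) us : seq V :=
  if us is u :: us' then (1 - q%:R / i%:R) *: u :: tilt q i.+1 us' else [::].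

(** For fixed [q] the sum over all sets of directions is inclusion-exclusion along the tilted
    directions; the signs (-1)^|A| differ from those of [fdiffs] by (-1)^(size us). *)
Lemma polar_terms_tilt (q i : nat) us f x :
  \sum_(z <- polar_terms i us) (z.1.1)%:C *: f (x + z.2 + q%:R *: z.1.2) =
  ((-1) ^+ size us)%:C *: fdiffs (tilt q i us) f x.
Proof.
elim: us i x => [|u us IH] i x /=.
  by rewrite big_seq1 /= scaler0 !addr0 expr0.
rewrite big_cat big_map /= IH.
under eq_bigr => z _ do rewrite rmorphN scaleNr.
rewrite sumrN.
have -> : \sum_(z <- polar_terms i.+1 us) (z.1.1)%:C *:
    f (x + (z.2 + u) + q%:R *: (z.1.2 - i%:R^-1 *: u)) =
  \sum_(z <- polar_terms i.+1 us) (z.1.1)%:C *: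
    f (x + (1 - q%:R / i%:R) *: u + z.2 + q%:R *: z.1.2).
  apply: eq_bigr => z _; congr (_ *: f _).
  rewrite scalerBr scalerA scalerBl scale1r [z.2 + u]addrC -!addrA; congr (_ + (_ + _)).
  by rewrite [RHS]addrC -!addrA.
by rewrite IH exprS mulN1r rmorphN scaleNr /fdiff -scalerBr -scalerN opprB.
Qed.

Lemma tilt0 i us : tilt 0 i us = us.
Proof. by elim: us i => //= u us IH i; rewrite IH mul0r subr0 scale1r. Qed.

Lemma tilt_has0 q i us : (0 < i)%N -> (i <= q < i + size us)%N -> 0 \in tilt q i us.
Proof.
elim: us i => [|u us IH] i i0 /=; first by rewrite addn0 => /andP[/leq_ltn_trans/[apply]]; rewrite ltnn.
rewrite addnS => /andP[]; rewrite leq_eqVlt => /orP[/eqP <- _|iq qi].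
  by rewrite divff ?pnatr_eq0 -?lt0n// subrr scale0r mem_head.
by rewrite in_cons IH ?orbT// iq addSn.
Qed.

(* Expanding the pure differences, the terms with [q >= 1] cancel because the
   [q]-th tilted direction vanishes. *)
Lemma polarization us f x :
  fdiffs us f x = \sum_(z <- polar_terms 1 us)
    (z.1.1)%:C *: iter (size us) (fdiff z.1.2) f (x + z.2).
Proof.
under eq_bigr => z _ do rewrite iter_fdiffE scaler_sumr.
rewrite exchange_big /= big_ord_recl [X in _ + X]big1 => [|q _].
  (* For q = 0 the tilt is trivial, and the weight (-1)^m cancels the sign of [polar_terms_tilt]. *)
  rewrite addr0.
  under eq_bigr => z _ do rewrite scalerA mulrC -scalerA.
  rewrite -scaler_sumr (polar_terms_tilt 0) tilt0 scalerA -rmorphM fdiff_weight0.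
  by rewrite -exprD addnn -mul2n exprM sqrrN !expr1n scale1r.
under eq_bigr => z _ do rewrite scalerA mulrC -scalerA.
rewrite -scaler_sumr (polar_terms_tilt q.+1) fdiffs_has0 ?scaler0//.
by apply: tilt_has0 => //=; rewrite add1n ltnS ltn_ord.
Qed.

Lemma polar_terms_scale (r : R) i us :
  polar_terms i [seq r *: u | u <- us] =
  [seq (z.1.1, r *: z.1.2, r *: z.2) | z <- polar_terms i us].
Proof.
elim: us i => [|u us IH] i /=; first by rewrite !scaler0.
rewrite IH map_cat -!map_comp; congr (_ ++ _); apply: eq_map => z /=.
by rewrite scalerBr scalerDr !scalerA [r * _]mulrC.
Qed.

Lemma fdiffs_nseq m u f : fdiffs (nseq m u) f = iter m (fdiff u) f.
Proof. by elim: m => //= m ->. Qed.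

End Djokovic.

(** * Iterated derivatives of a curve *)

Section NthDerivative.
Variables (R : realType) (E : lcs R).
Implicit Types c : R -> E.

Definition nder (m : nat) c : R -> E := iter m (@lderiv R E) c.

Lemma is_lderiv_shift c b t v : is_lderiv (fun s => c (s + b)) t v <-> is_lderiv c (t + b) v.
Proof.
by split=> H p sp; have := H p sp;
  rewrite (_ : (fun h => p ((h^-1)%:C *: (c (t + h + b) - _) - v)) =
    (fun h => p ((h^-1)%:C *: (c (t + b + h) - c (t + b)) - v)))//;
  apply/funext => h; rewrite [t + h + b]addrAC.
Qed.

Lemma lderiv_shift c b t : lderiv (fun s => c (s + b)) t = lderiv c (t + b).
Proof.
rewrite /lderiv; congr xget; apply/seteqP; split=> v [dv D]; split => //; exact/is_lderiv_shift.
Qed.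

Lemma nder_shift m c b t : nder m (fun s => c (s + b)) t = nder m c (t + b).
Proof.
elim: m t => // m IH t; change (lderiv (nder m (fun s => c (s + b))) t = lderiv (nder m c) (t + b)).
by rewrite -lderiv_shift; congr (lderiv _ t); apply/funext => s; exact: IH.
Qed.

Lemma nder_near m c c' (t : R) : (\forall s \near t, c s = c' s) ->
  \forall s \near t, nder m c s = nder m c' s.
Proof.
move=> H; elim: m => // m IH; rewrite /nder.
move/nbhs_interior: IH; apply: filterS => s Hs.
apply: lderiv_near.
exact: (@near0_shift R (fun u => nder m c u = nder m c' u) s).
Qed.

Lemma nder_of_dseq (gE : good E) d m : dseq d -> nder m (d 0%N) = d m.
Proof.
move=> H; elim: m => // m IH; rewrite /nder iterS -/(nder m _) IH.
apply/funext => t; apply: lderivE => //; last exact: (H m t).2.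
  by apply: near0W => h; exact: dseq_dom.
exact: dseq_dom.
Qed.

Lemma smooth_curveP c : smooth_curve c <-> exists2 d, dseq d & d 0%N = c.
Proof.
split=> [[d [d0 dd D]]|[d H d0]].
  by exists d; [move=> k t; split; [exact: dd|exact: D]|].
by exists d; split=> // k t; have [] := H k t.
Qed.

Lemma nder_dseq (gE : good E) c : smooth_curve c -> dseq (fun m => nder m c).
Proof.
move=> /smooth_curveP[d H <-].
by rewrite (_ : (fun m => _) = d)//; apply/funext => m; apply: nder_of_dseq.
Qed.

End NthDerivative.

(** * Mixed derivatives built from pure ones *)

Section MixedDerivatives.
Variables (R : realType) (F : lcs R) (gF : good F) (V : normedModType R).
Variable h : V -> F.

Definition dirder (m : nat) (v x : V) : F := nder m (fun r : R => h (x + r *: v)) 0.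

Hypothesis smooth_lines : forall x v, smooth_curve (fun r : R => h (x + r *: v)).
Variables (p : F -> R) (sp : sn p).
Hypothesis bounded_dirder : forall m v x0, exists d C, [/\ 0 < d, 0 <= C &
  forall x, `|x - x0| < d -> p (dirder m v x) <= C].

(** Uniformity in the base point permits moving [x] by multiples of [r] and subdividing segments.
    Steps are nonnegative; [mixed_is_lderiv] handles negative ones by starting from the other
    end. *)
Definition near_bigO (k : nat) (x0 : V) (G : V -> R -> R) := exists d C,
  [/\ 0 < d, 0 <= C & forall x r, `|x - x0| < d -> 0 <= r < d -> G x r <= C * r ^+ k].

Lemma near_bigO_le k x0 G G' : (forall x r, 0 <= r -> G x r <= G' x r) ->
  near_bigO k x0 G' -> near_bigO k x0 G.
Proof.
move=> le [d [C [d0 C0 H]]]; exists d, C; split=> // x r xd rd.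
by apply: le_trans (H x r xd rd); apply: le; case/andP: rd.
Qed.

Lemma near_bigOD k x0 G G' : near_bigO k x0 G -> near_bigO k x0 G' ->
  near_bigO k x0 (fun x r => G x r + G' x r).
Proof.
move=> [d [C [d0 C0 H]]] [d' [C' [d0' C0' H']]].
exists (Num.min d d'), (C + C'); split; [by rewrite lt_min d0|exact: addr_ge0|].
move=> x r; rewrite !lt_min => /andP[xd xd'] /and3P[r0 rd rd'].
by rewrite mulrDl lerD ?H ?H'// r0.
Qed.

Lemma near_bigO0 k x0 : near_bigO k x0 (fun _ _ => 0).
Proof. by exists 1, 0; split=> // x r _ _; rewrite mul0r. Qed.

Lemma near_bigO_sum k x0 (T : eqType) (s : seq T) (G : T -> V -> R -> R) :
  (forall z, z \in s -> near_bigO k x0 (G z)) ->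
  near_bigO k x0 (fun x r => \sum_(z <- s) G z x r).
Proof.
elim: s => [|z s IH] H.
  by apply: near_bigO_le (near_bigO0 k x0) => x r _; rewrite big_nil.
apply: near_bigO_le (near_bigOD (H z _) (IH _)) => [x r _||z' zs].
- by rewrite big_cons.
- by rewrite mem_head.
- by apply: H; rewrite in_cons zs orbT.
Qed.

Lemma near_bigO_shift k x0 (b : V) G : near_bigO k x0 G ->
  near_bigO k x0 (fun x r => G (x + r *: b) r).
Proof.
move=> [d [C [d0 C0 H]]]; pose e := d / (2 * (1 + `|b|)).
have b0 : 0 < 1 + `|b| by rewrite ltr_pwDl.
have e0 : 0 < e by rewrite divr_gt0// mulr_gt0.
have ed : e * (1 + `|b|) = d / 2 by rewrite /e invfM mulrA divfK// gt_eqF.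
have eb : 0 <= e * `|b| by rewrite mulr_ge0// ltW.
exists e, C; split=> // x r xd /andP[r0 re]; apply: H; last by rewrite r0; nra.
rewrite addrAC; apply: le_lt_trans (ler_normD _ _) _.
rewrite normrZ ger0_norm//.
by have : r * `|b| <= e * `|b| by [apply: ler_wpM2r => //; exact: ltW]; lra.
Qed.

Lemma near_bigO_mul k j x0 G : near_bigO k x0 G ->
  near_bigO (j + k) x0 (fun x r => r ^+ j * G x r).
Proof.
move=> [d [C [d0 C0 H]]]; exists d, C; split=> // x r xd /andP[r0 rd].
by rewrite exprD mulrCA; apply: ler_wpM2l; rewrite ?exprn_ge0// H// r0.
Qed.

Lemma near_bigO_scale k x0 (a : R) G : 0 <= a -> near_bigO k x0 G ->
  near_bigO k x0 (fun x r => a * G x r).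
Proof.
move=> a0 [d [C [d0 C0 H]]]; exists d, (a * C); split=> //; first exact: mulr_ge0.
by move=> x r xd rd; rewrite -mulrA ler_wpM2l// H.
Qed.

(** The value at r = 0 is supplied separately, because there the factor r^j may vanish. *)
Lemma near_bigO_div j k x0 G : (forall x, G x 0 <= 0) ->
  near_bigO (j + k.+1) x0 (fun x r => r ^+ j * G x r) -> near_bigO k.+1 x0 G.
Proof.
move=> G0 [d [C [d0 C0 H]]]; exists d, C; split=> // x r xd /andP[r0 rd].
have [r0'|r0'] := eqVneq r 0; first by rewrite r0' expr0n /= mulr0.
have rj : 0 < r ^+ j by rewrite exprn_gt0// lt_neqAle eq_sym r0'.
rewrite -(ler_pM2l rj) mulrCA -exprD; apply: H => //; exact/andP.
Qed.

Lemma dirder_line m v x r : dirder m v (x + r *: v) = nder m (fun r => h (x + r *: v)) r.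
Proof.
rewrite /dirder -[in RHS](add0r r) -nder_shift; congr (nder m _ 0).
by apply/funext => s; rewrite -addrA -scalerDl [r + s]addrC.
Qed.

Lemma dseq_dirder x v : dseq (fun m r => dirder m v (x + r *: v)).
Proof.
rewrite (_ : (fun m => _) = fun m => nder m (fun r : R => h (x + r *: v))).
  exact: nder_dseq.
by apply/funext => m; apply/funext => r; exact: dirder_line.
Qed.

Lemma dom_dirder m v x : dom (dirder m v x).
Proof.
by have := dseq_dom m 0 (dseq_dirder x v); rewrite scale0r addr0.
Qed.

Lemma dirder0 v x : dirder 0 v x = h x.
Proof. by rewrite /dirder /nder /= scale0r addr0. Qed.

Lemma domh x : dom (h x).
Proof. by rewrite -(dirder0 0); exact: dom_dirder. Qed.

Lemma dom_fdiffs us x : dom (fdiffs us h x).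
Proof. by elim: us x => [|u us IH] x /=; [exact: domh|rewrite /fdiff; solve_dom]. Qed.

Lemma iter_fdiff_line m r v x s :
  iter m (fdiff r) (fun t : R => h (x + t *: v)) s = iter m (fdiff (r *: v)) h (x + s *: v).
Proof.
elim: m s => // m IH s; rewrite !iterS /fdiff !IH.
by rewrite scalerDl addrA.
Qed.

Lemma bounded_dirder_line m v x0 (N : R) : 0 <= N -> exists d C, [/\ 0 < d, 0 <= C &
  forall x r t, `|x - x0| < d -> 0 <= r < d -> 0 <= t <= 0 + N * r ->
    p (dirder m v (x + t *: v)) <= C].
Proof.
move=> N0; have [d [C [d0 C0 H]]] := bounded_dirder m v x0.
have b0 : 0 < 1 + N * `|v| by rewrite ltr_pwDl// mulr_ge0.
pose e := d / (2 * (1 + N * `|v|)).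
have e0 : 0 < e by rewrite divr_gt0// mulr_gt0.
have ed : e * (1 + N * `|v|) = d / 2 by rewrite /e invfM mulrA divfK// gt_eqF.
have eb : 0 <= e * (N * `|v|) by apply: mulr_ge0; [exact: ltW|exact: mulr_ge0].
exists e, C; split=> // x r t xe /andP[r0 re] /andP[t0 tr]; apply: H.
rewrite addrAC; apply: le_lt_trans (ler_normD _ _) _.
rewrite normrZ ger0_norm//.
have : t * `|v| <= e * (N * `|v|).
  rewrite mulrA; apply: ler_wpM2r => //; rewrite [e * N]mulrC.
  by apply: le_trans tr _; rewrite add0r; apply: ler_wpM2l => //; exact: ltW.
lra.
Qed.

Lemma pure_approx m v x0 : near_bigO m.+1 x0 (fun x r =>
  p (iter m (fdiff (r *: v)) h x - (r ^+ m)%:C *: dirder m v x)).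
Proof.
have [d [C [d0 C0 H]]] := bounded_dirder_line m.+1 v x0 (ler0n R m).
exists d, (C * m%:R); split=> //; first by rewrite mulr_ge0.
move=> x r xd rd.
have := iter_fdiff_approx gF sp (a := 0) (dseq_dirder x v) (proj1 (andP rd))
  (fun t => H x r t xd rd).
rewrite (_ : (fun r0 => dirder 0 v (x + r0 *: v)) = fun t : R => h (x + t *: v)).
  by rewrite iter_fdiff_line scale0r addr0.
by apply/funext => t; rewrite dirder0.
Qed.

Lemma pure_bound m v x0 : near_bigO m x0 (fun x r => p (iter m (fdiff (r *: v)) h x)).
Proof.
have [d [C [d0 C0 H]]] := bounded_dirder_line m v x0 (ler0n R m).
exists d, C; split=> // x r xd rd.
have := iter_fdiff_le gF sp (a := 0) (dseq_dirder x v) (proj1 (andP rd))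
  (fun t => H x r t xd rd).
rewrite (_ : (fun r0 => dirder 0 v (x + r0 *: v)) = fun t : R => h (x + t *: v)).
  by rewrite iter_fdiff_line scale0r addr0.
by apply/funext => t; rewrite dirder0.
Qed.

Lemma polarization_scale us r x :
  fdiffs [seq r *: u | u <- us] h x = \sum_(z <- polar_terms 1 us)
    (z.1.1)%:C *: iter (size us) (fdiff (r *: z.1.2)) h (x + r *: z.2).
Proof. by rewrite polarization polar_terms_scale big_map size_map. Qed.

Lemma dom_iter_fdiff m u x : dom (iter m (fdiff u) h x).
Proof. by rewrite -fdiffs_nseq; exact: dom_fdiffs. Qed.

Lemma mixed_bound us x0 : near_bigO (size us) x0 (fun x r =>
  p (fdiffs [seq r *: u | u <- us] h x)).
Proof.
apply: near_bigO_le; last first.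
  apply: (@near_bigO_sum _ _ _ (polar_terms 1 us) (fun z x r =>
    `|z.1.1| * p (iter (size us) (fdiff (r *: z.1.2)) h (x + r *: z.2)))).
  move=> z _; apply: near_bigO_scale => //; exact: (near_bigO_shift z.2 (pure_bound (size us) z.1.2 x0)).
move=> x r r0; rewrite polarization_scale.
apply: le_trans (sn_sum gF _ sp _) _.
  by move=> z; apply: domZ => //; exact: dom_iter_fdiff.
by apply: ler_sum => z _; rewrite (snZ gF)//; exact: dom_iter_fdiff.
Qed.

(** Times r^m, the increment of the derivative is the increment of an m-th pure difference up to
    O(r^(m+1)). That increment is a mixed difference of order m + 1 along [w] and m copies of [v],
    again O(r^(m+1)). *)
Lemma dirder_lipschitz m v w x0 : near_bigO 1 x0 (fun x r =>
  p (dirder m v (x + r *: w) - dirder m v x)).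
Proof.
apply: (near_bigO_div (j := m)) => [x|].
  by rewrite scale0r addr0 subrr (sn0 gF).
have A := pure_approx m v x0.
have B := mixed_bound (w :: nseq m v) x0.
rewrite addn1; rewrite /= size_nseq in B.
apply: near_bigO_le (near_bigOD (near_bigOD (near_bigO_shift w A) A) B) => x r r0.
rewrite /= map_nseq fdiffs_nseq /fdiff -/(fdiff _).
set P1 := iter _ _ _ _; set P2 := iter _ _ _ _.
have d1 : dom P1 by exact: dom_iter_fdiff.
have d2 : dom P2 by exact: dom_iter_fdiff.
set D1 := dirder _ _ _; set D2 := dirder _ _ _.
have e1 : dom D1 by exact: dom_dirder.
have e2 : dom D2 by exact: dom_dirder.
have rm : 0 <= r ^+ m by exact: exprn_ge0.
rewrite -[in leLHS](ger0_norm rm) -(snZ gF)//; last by solve_dom.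
rewrite scalerBr.
have f1 : dom ((r ^+ m)%:C *: D1) by solve_dom.
have f2 : dom ((r ^+ m)%:C *: D2) by solve_dom.
apply: le_trans (sn_tri gF sp f1 d1 f2) _.
apply: le_trans (lerD (lexx _) (sn_tri gF sp d1 d2 f2)) _.
rewrite (sn_distC gF sp f1 d1); lra.
Qed.

(** The iterated derivative along [us], written by polarization through pure derivatives, so that it
    is available before any mixed derivative is known to exist. *)
Definition mixed us x : F := \sum_(z <- polar_terms 1 us) (z.1.1)%:C *: dirder (size us) z.1.2 x.

Lemma dom_mixed us x : dom (mixed us x).
Proof. by apply: (dom_sum gF) => z; apply: domZ => //; exact: dom_dirder. Qed.

(** Polarization evaluates pure differences at points shifted by multiples of [r]; each is
    approximated at its own point, and the Lipschitz bound moves the derivatives back to [x] at the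
    same order of error. *)
Lemma mixed_approx us x0 : near_bigO (size us).+1 x0 (fun x r =>
  p (fdiffs [seq r *: u | u <- us] h x - (r ^+ size us)%:C *: mixed us x)).
Proof.
set m := size us.
apply: near_bigO_le; last first.
  apply: (@near_bigO_sum _ _ _ (polar_terms 1 us) (fun z x r =>
    `|z.1.1| * (p (iter m (fdiff (r *: z.1.2)) h (x + r *: z.2) -
      (r ^+ m)%:C *: dirder m z.1.2 (x + r *: z.2)) +
      r ^+ m * p (dirder m z.1.2 (x + r *: z.2) - dirder m z.1.2 x)))).
  move=> z _; apply: near_bigO_scale => //; apply: near_bigOD.
    exact: (near_bigO_shift z.2 (pure_approx m z.1.2 x0)).
  by rewrite -addn1; exact: (near_bigO_mul m (dirder_lipschitz m z.1.2 z.2 x0)).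
move=> x r r0; rewrite polarization_scale /mixed scaler_sumr -sumrB.
have di := dom_iter_fdiff; have dd := dom_dirder.
under eq_bigr => z _ do rewrite scalerA mulrC -scalerA -scalerBr.
apply: le_trans (sn_sum gF _ sp _) _; first by move=> z; solve_dom.
apply: ler_sum => z _; rewrite (snZ gF)//; last by solve_dom.
apply: ler_wpM2l => //.
apply: le_trans (sn_tri gF sp (y := (r ^+ m)%:C *: dirder m z.1.2 (x + r *: z.2)) _ _ _) _;
  try by solve_dom.
apply: lerD => //; rewrite -scalerBr (snZ gF)//; last by solve_dom.
by rewrite ger0_norm// exprn_ge0.
Qed.

Lemma mixed_lipschitz us w x0 : near_bigO 1 x0 (fun x r =>
  p (mixed us (x + r *: w) - mixed us x)).
Proof.
have dd := dom_dirder.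
apply: near_bigO_le; last first.
  apply: (@near_bigO_sum _ _ _ (polar_terms 1 us) (fun z x r =>
    `|z.1.1| * p (dirder (size us) z.1.2 (x + r *: w) - dirder (size us) z.1.2 x))).
  move=> z _; apply: near_bigO_scale => //; exact: dirder_lipschitz.
move=> x r r0; rewrite /mixed -sumrB.
under eq_bigr => z _ do rewrite -scalerBr.
apply: le_trans (sn_sum gF _ sp _) _; first by move=> z; solve_dom.
by apply: ler_sum => z _; rewrite (snZ gF)//; solve_dom.
Qed.

(* Subdivide the segment from [x] to [x + r v] into [N] steps of length [r / N],
   on each of which differences approximate derivatives, and let [N] grow. *)
Lemma mixed_taylor us v x0 : near_bigO 2 x0 (fun x r =>
  p (mixed us (x + r *: v) - mixed us x - r%:C *: mixed (v :: us) x)).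
Proof.
have [d1 [C1 [d10 C10 H1]]] := mixed_approx us x0.
have [d2 [C2 [d20 C20 H2]]] := mixed_approx (v :: us) x0.
have [d3 [C3 [d30 C30 H3]]] := mixed_lipschitz (v :: us) v x0.
set j := size us in H1; rewrite [size (v :: us)](_ : _ = j.+1)// in H2.
pose d := Num.min d1 (Num.min d2 d3).
have d0 : 0 < d by rewrite !lt_min d10 d20.
have b0 : 0 < 1 + `|v| by rewrite ltr_pwDl.
pose e := d / (2 * (1 + `|v|)).
have e0 : 0 < e by rewrite divr_gt0// mulr_gt0.
have ed : e * (1 + `|v|) = d / 2 by rewrite /e invfM mulrA divfK// gt_eqF.
have eb : 0 <= e * `|v| by rewrite mulr_ge0 // ltW.
exists e, C3; split=> // x r xe /andP[r0 re].
have [->|rn0] := eqVneq r 0.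
  by rewrite !scale0r addr0 subrr subr0 (sn0 gF)// expr0n mulr0.
have {rn0} rp : 0 < r by rewrite lt_neqAle eq_sym rn0.
have inball t : 0 <= t <= r -> `|x + t *: v - x0| < d.
  move=> /andP[t0 tr]; rewrite addrAC; apply: le_lt_trans (ler_normD _ _) _.
  rewrite normrZ ger0_norm//.
  have : t * `|v| <= e * `|v| by apply: ler_wpM2r => //; lra.
  lra.
have dmix := dom_mixed; have dfd := dom_fdiffs.
apply/ler_addgt0Pl => eps eps0.
(* After division by rho^j the subdivision errors are 2 C1 rho, from replacing differences by
   [mixed us] at both ends, and r C2 rho, from the N steps; their sum is K / N. *)
pose K := (2 * C1 + r * C2) * r.
have K0 : 0 <= K by rewrite mulr_ge0// addr_ge0 ?mulr_ge0.
pose N := (Num.truncn (K / eps)).+1.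
have N0 : 0 < (N%:R : R) by rewrite ltr0n.
have NK : K / N%:R <= eps.
  rewrite ler_pdivrMr// mulrC -ler_pdivrMr//; apply: ltW; exact: truncnS_gt.
pose rho := r / N%:R.
have rho0 : 0 < rho by rewrite divr_gt0.
have rhor : rho <= r by rewrite ler_pdivrMr// -[leLHS]mulr1 ler_pM2l// ler1n.
have rhod : rho < d by nra.
have Nrho : N%:R * rho = r by rewrite mulrC divfK// gt_eqF.
pose A i := fdiffs [seq rho *: u | u <- us] h (x + (i%:R * rho) *: v).
have dA i : dom (A i) by exact: dfd.
have irho i : (i <= N)%N -> 0 <= i%:R * rho <= r.
  move=> iN; apply/andP; split; first by apply: mulr_ge0 => //; exact: ltW.
  by rewrite -[leRHS]Nrho; apply: ler_wpM2r; [exact: ltW|rewrite ler_nat].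
have lt1 t : t < d -> [/\ t < d1, t < d2 & t < d3].
  by rewrite !lt_min => /and3P[].
have [rd1 rd2 rd3] := lt1 _ rhod.
(* A step is a difference of order j + 1 along [v :: us]. Moving its derivative from the i-th node
   back to [x] costs rho^(j+1) C3 r; summed over the N steps this is the surviving term C3 r^2 times
   rho^j. *)
have step i : (i < N)%N ->
    p (A i.+1 - A i - (rho ^+ j.+1)%:C *: mixed (v :: us) x) <=
    C2 * rho ^+ j.+2 + rho ^+ j.+1 * (C3 * r).
  move=> iN; have ir := irho i (ltnW iN).
  have [xd1 xd2 xd3] := lt1 _ (inball _ ir).
  have E1 : A i.+1 - A i = fdiffs [seq rho *: u | u <- v :: us] h (x + (i%:R * rho) *: v).
    by rewrite /= /fdiff /A -natr1 mulrDl mul1r scalerDl addrA.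
  have := H2 _ rho xd2 (introT andP (conj (ltW rho0) rd2)).
  rewrite -E1 => B1.
  have x0d : `|x - x0| < d by have := inball 0; rewrite scale0r addr0 lexx; apply.
  have [_ _ xd3'] := lt1 _ x0d.
  have [i0 ir'] := andP ir.
  have rd : r < d by nra.
  have B2 : p (mixed (v :: us) (x + (i%:R * rho) *: v) - mixed (v :: us) x) <= C3 * r.
    apply: le_trans (H3 x (i%:R * rho) xd3' _) _; last by rewrite expr1; apply: ler_wpM2l.
    by rewrite i0/=; have [] := lt1 _ rd => _ _; apply: le_lt_trans.
  apply: le_trans (sn_tri gF sp
    (y := (rho ^+ j.+1)%:C *: mixed (v :: us) (x + (i%:R * rho) *: v)) _ _ _) _;
    try by solve_dom.
  apply: lerD => //; rewrite -scalerBr (snZ gF)//; last by solve_dom.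
  have rj1 : 0 <= rho ^+ j.+1 by apply: exprn_ge0; exact: ltW.
  by rewrite ger0_norm//; apply: ler_wpM2l.
have tele i : (i <= N)%N ->
    p (A i - A 0%N - (i%:R * rho ^+ j.+1)%:C *: mixed (v :: us) x) <=
    i%:R * (C2 * rho ^+ j.+2 + rho ^+ j.+1 * (C3 * r)).
  elim: i => [|i IH] iN; first by rewrite subrr !mul0r scale0r subrr (sn0 gF).
  rewrite -natr1 !mulrDl !mul1r.
  have -> : A i.+1 - A 0%N - (i%:R * rho ^+ j.+1 + rho ^+ j.+1)%:C *: mixed (v :: us) x =
     (A i - A 0%N - (i%:R * rho ^+ j.+1)%:C *: mixed (v :: us) x) +
     (A i.+1 - A i - (rho ^+ j.+1)%:C *: mixed (v :: us) x).
    by rewrite rmorphD scalerDl addrACA -opprD; congr (_ - _); rewrite addrC addrA subrK.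
  apply: le_trans (good_le gF sp _ _) _; try by solve_dom.
  by apply: lerD; [apply: IH; exact: ltnW|exact: step].
have T := tele N (leqnn N).
have EN : N%:R * rho ^+ j.+1 = rho ^+ j * r by rewrite exprSr mulrCA Nrho.
have x0d := inball 0; rewrite scale0r addr0 lexx ltW// in x0d.
have {x0d} [xd1 _ _] := lt1 _ (x0d isT).
have [xd1' _ _] := lt1 _ (inball r (introT andP (conj r0 (lexx r)))).
have B1 := H1 _ rho xd1 (introT andP (conj (ltW rho0) rd1)).
have B2 := H1 _ rho xd1' (introT andP (conj (ltW rho0) rd1)).
have A0 : A 0%N = fdiffs [seq rho *: u | u <- us] h x by rewrite /A mul0r scale0r addr0.
have AN : A N = fdiffs [seq rho *: u | u <- us] h (x + r *: v) by rewrite /A Nrho.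
rewrite -A0 in B1; rewrite -AN in B2.
have rj : 0 < rho ^+ j by rewrite exprn_gt0.
rewrite -(ler_pM2l rj) -[in leLHS](gtr0_norm rj) -(snZ gF)//; last by solve_dom.
have -> : (rho ^+ j)%:C *: (mixed us (x + r *: v) - mixed us x - r%:C *: mixed (v :: us) x) =
   (A N - A 0%N - (N%:R * rho ^+ j.+1)%:C *: mixed (v :: us) x) +
   ((A 0%N - (rho ^+ j)%:C *: mixed us x) - (A N - (rho ^+ j)%:C *: mixed us (x + r *: v))).
  rewrite !scalerBr real_complex_scale EN.
  rewrite [RHS]addrAC; congr (_ - _).
  by rewrite opprB addrA [A N - _ + (_ - _)]addrA subrK addrC addrA subrK.
apply: le_trans (good_le gF sp _ _) _; try by solve_dom.
have -> : rho ^+ j * (eps + C3 * r ^+ 2) =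
   (rho ^+ j * eps) + rho ^+ j * (C3 * r ^+ 2) by rewrite mulrDr.
have E1 : p (A 0%N - (rho ^+ j)%:C *: mixed us x - (A N - (rho ^+ j)%:C *: mixed us (x + r *: v)))
   <= C1 * rho ^+ j.+1 + C1 * rho ^+ j.+1.
  apply: le_trans (sn_leB gF sp _ _) _; try by solve_dom.
  exact: lerD.
have E2 : K / N%:R = 2 * C1 * rho + r * C2 * rho by rewrite /K /rho; ring.
have E3 : N%:R * (C2 * rho ^+ j.+2 + rho ^+ j.+1 * (C3 * r)) =
  rho ^+ j * (r * C2 * rho + C3 * r ^+ 2).
  by rewrite -Nrho !exprS; ring.
have E4 : C1 * rho ^+ j.+1 + C1 * rho ^+ j.+1 = rho ^+ j * (2 * C1 * rho).
  by rewrite exprS; ring.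
rewrite E3 in T; rewrite E4 in E1.
have := ler_wpM2l (ltW rj) NK; rewrite E2; lra.
Qed.

End MixedDerivatives.

Section MixedSmooth.
Variables (R : realType) (F : lcs R) (gF : good F) (V : normedModType R).
Variable h : V -> F.
Hypothesis smooth_lines : forall x v, smooth_curve (fun r : R => h (x + r *: v)).
Hypothesis bounded_dirder : forall p, sn p ->
  forall m v x0, exists d C, [/\ 0 < d, 0 <= C &
  forall x, `|x - x0| < d -> p (dirder h m v x) <= C].

(** For one direction the polarization terms are (1, 0, 0) and (-1, -w, w): the derivative along 0
    vanishes and the two signs of the other term cancel. *)
Lemma mixed1 w x : mixed h [:: w] x = dirder h 1 w x.
Proof.
rewrite /mixed /= big_cons big_seq1 /= !scale1r invr1 scale1r sub0r.
have -> : dirder h 1 0 x = 0.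
  rewrite /dirder /nder /= (_ : (fun r => _) = fun=> h x); last first.
    by apply/funext => r; rewrite scaler0 addr0.
  apply: lderivE => //; [|exact: good0|exact: is_lderiv_cst].
  by apply: near0W => r; exact: domh.
have -> : dirder h 1 (- w) x = - dirder h 1 w x; last first.
  by rewrite add0r rmorphN1 scaleN1r opprK.
have := dseq_comp_aff gF (-1) 0 (dseq_dirder gF smooth_lines x w).
move=> /(nder_of_dseq gF 1) /(congr1 (fun c => c 0)); rewrite mulr0 addr0 scale0r addr0.
rewrite expr1 rmorphN1 scaleN1r => <-; rewrite /dirder; congr (nder 1 _ 0).
by apply/funext => r; rewrite expr0 scale1r /nder /= scale0r !addr0 mulN1r scalerN scaleNr.
Qed.

(** For r >= 0 this is [mixed_taylor] at [x1]. For r < 0 the expansion starts at [x1 + r v] and runs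
    forward to [x1], and the Lipschitz bound for [mixed (v :: us)] moves the derivative to [x1]. *)
Lemma mixed_is_lderiv us v x0 t :
  is_lderiv (fun s : R => mixed h us (x0 + s *: v)) t (mixed h (v :: us) (x0 + t *: v)).
Proof.
have dm us' x : dom (mixed h us' x) by exact: dom_mixed.
apply/(is_lderivP gF) => //; first exact: near0W.
move=> p sp e e0; set x1 := x0 + t *: v.
have [d1 [C1 [d10 C10 H1]]] := mixed_taylor gF smooth_lines sp (bounded_dirder sp) us v x1.
have [d2 [C2 [d20 C20 H2]]] := mixed_lipschitz gF smooth_lines sp (bounded_dirder sp) (v :: us) v x1.
have v0 : 0 < 1 + `|v| by rewrite ltr_pwDl.
pose d := Num.min d1 d2 / (1 + `|v|).
have d12 : 0 < Num.min d1 d2 by rewrite lt_min d10.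
have d0 : 0 < d / 2 by rewrite divr_gt0// divr_gt0.
have CC : 0 < e / (1 + C1 + C2) by apply: divr_gt0 => //; lra.
near=> r.
have r1 : `|r| <= d / 2 by near: r; exact: near0_le.
have r2 : `|r| <= e / (1 + C1 + C2) by near: r; exact: near0_le.
have n0 := normr_ge0 r; have nv := normr_ge0 v.
have Ed : d * (1 + `|v|) = Num.min d1 d2 by rewrite /d divfK// gt_eqF.
have dpos : 0 < d by lra.
have dv : `|r| * `|v| < Num.min d1 d2 by rewrite -Ed; nra.
have dr : `|r| < Num.min d1 d2 by rewrite -Ed; nra.
move: dv dr; rewrite !lt_min => /andP[dv1 dv2] /andP[dr1 dr2].
suff S : p (mixed h us (x0 + (t + r) *: v) - mixed h us x1 - r%:C *: mixed h (v :: us) x1)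
   <= (C1 + C2) * `|r| ^+ 2.
  apply: le_trans S _; rewrite expr2 mulrA; apply: ler_wpM2r => //.
  by move: r2; rewrite ler_pdivlMr; lra.
rewrite scalerDl addrA -/x1.
have [r0|r0] := leP 0 r.
  rewrite ger0_norm// in dr1 *.
  apply: le_trans (H1 x1 r _ _) _; first by rewrite subrr normr0.
    by rewrite r0.
  by apply: ler_wpM2r; rewrite ?exprn_ge0//; lra.
rewrite ltr0_norm// in dv1 dv2 dr1 dr2 *.
set x := x1 + r *: v.
have xx : x1 = x + (- r) *: v by rewrite /x scaleNr addrK.
have bx : `|x - x1| = - r * `|v| by rewrite /x addrC addKr normrZ ltr0_norm.
have h0 : 0 <= - r by lra.
have A1 := H1 x (- r); rewrite -xx bx h0 in A1; have {}A1 := A1 dv1 dr1.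
have A2 := H2 x (- r); rewrite -xx bx h0 in A2; have {}A2 := A2 dv2 dr2.
have -> : mixed h us x - mixed h us x1 - r%:C *: mixed h (v :: us) x1 =
  - ((mixed h us x1 - mixed h us x - (- r)%:C *: mixed h (v :: us) x)
    - (- r)%:C *: (mixed h (v :: us) x1 - mixed h (v :: us) x)).
  rewrite scalerBr [- (_ *: _ - _)]opprB addrA subrK opprD opprB opprK.
  by rewrite rmorphN scaleNr.
rewrite (snN gF)//; last by solve_dom.
apply: le_trans (sn_leB gF sp _ _) _; try by solve_dom.
rewrite (snZ gF)//; last by solve_dom.
rewrite [`|- r|]ger0_norm//.
have := ler_wpM2l h0 A2; rewrite expr1 expr2; rewrite expr2 in A1; lra.
Unshelve. all: by end_near. Qed.

(** The j-th derivative is [mixed] along j copies of [v] in front of [w], so all orders are given at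
    once. *)
Lemma smooth_dirder w v x0 : smooth_curve (fun s : R => dirder h 1 w (x0 + s *: v)).
Proof.
apply/smooth_curveP; exists (fun j s => mixed h (nseq j v ++ [:: w]) (x0 + s *: v)).
  by move=> j s; split; [exact: dom_mixed|exact: (mixed_is_lderiv (nseq j v ++ [:: w]))].
by apply/funext => s /=; rewrite mixed1.
Qed.

End MixedSmooth.

Lemma good_Clcs (R : realType) : good (Clcs R).
Proof.
split=> //.
- by move=> p /= -> x y _ _; exact: normcD.
- by move=> p /= -> a x _; exact: Normc.normcM.
- move=> x _ H; apply: Normc.eq0_normc; exact: (H (fun z => Normc.normc z)).
Qed.

(** * Smooth functions of one real variable *)

Section SmoothFunctionsReal.
Variable R : realType.
Implicit Types (f g : R -> R) (t : R).

(** Grading by the order makes closure under products, composition and inverses an induction on [k],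
    since these operations preserve the order. *)
Fixpoint rdiff (k : nat) f : Prop :=
  if k is k'.+1 then exists2 f' : R -> R, forall t : R, is_derive t (1 : R) f (f' t) & rdiff k' f'
  else True.

Definition rsmooth f := forall k, rdiff k f.

Lemma rdiffW k f : rdiff k.+1 f -> rdiff k f.
Proof. by elim: k f => // k IH f [f' D Hf']; exists f' => //; exact: IH. Qed.

Lemma rdiff_cst k (a : R) : rdiff k (fun=> a).
Proof.
elim: k a => // k IH a; exists (fun=> 0) => // t.
exact: is_derive_cst.
Qed.

Lemma rdiffD k f g : rdiff k f -> rdiff k g -> rdiff k (fun t => f t + g t).
Proof.
elim: k f g => // k IH f g [f' D Hf] [g' D' Hg]; exists (fun t => f' t + g' t); last exact: IH.
by move=> t; exact: is_deriveD.
Qed.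

Lemma rdiffM k f g : rdiff k f -> rdiff k g -> rdiff k (fun t => f t * g t).
Proof.
elim: k f g => // k IH f g Hf Hg; have Wf := rdiffW Hf; have Wg := rdiffW Hg.
case: Hf Hg => [f' D Hf] [g' D' Hg]; exists (fun t => f t * g' t + g t * f' t).
  by move=> t; exact: is_deriveM.
by apply: rdiffD; exact: IH.
Qed.

Lemma rdiff_comp k f g : rdiff k f -> rdiff k g -> rdiff k (f \o g).
Proof.
elim: k f g => // k IH f g Hf Hg; have Wg := rdiffW Hg.
case: Hf Hg => [f' D Hf] [g' D' Hg]; exists (fun t => (f' \o g) t * g' t).
  by move=> t; exact: is_derive1_comp.
by apply: rdiffM => //; exact: IH.
Qed.

Lemma rdiffV k f : (forall t, f t != 0) -> rdiff k f -> rdiff k (fun t => (f t)^-1).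
Proof.
move=> f0; elim: k => // k IH Hf; have Wf := IH (rdiffW Hf).
case: Hf => f' D Hf; exists (fun t => - 1 * ((f t)^-1 * (f t)^-1) * f' t).
  move=> t; have := is_deriveV (f0 t) (D t).
  by rewrite mulN1r /GRing.scale /= -expr2 exprVn.
by do ?apply: rdiffM => //; exact: rdiff_cst.
Qed.

Lemma rsmooth_id : rsmooth id.
Proof. by case=> // k; exists (fun=> 1); [move=> t; exact: is_derive_id|exact: rdiff_cst]. Qed.

Lemma rsmooth_cst a : rsmooth (fun=> a).
Proof. by move=> k; exact: rdiff_cst. Qed.

Lemma rsmoothD f g : rsmooth f -> rsmooth g -> rsmooth (fun t => f t + g t).
Proof. by move=> Hf Hg k; exact: rdiffD. Qed.

Lemma rsmoothM f g : rsmooth f -> rsmooth g -> rsmooth (fun t => f t * g t).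
Proof. by move=> Hf Hg k; exact: rdiffM. Qed.

Lemma rsmooth_comp f g : rsmooth f -> rsmooth g -> rsmooth (f \o g).
Proof. by move=> Hf Hg k; exact: rdiff_comp. Qed.

Lemma rsmoothV f : (forall t, f t != 0) -> rsmooth f -> rsmooth (fun t => (f t)^-1).
Proof. by move=> f0 Hf k; exact: rdiffV. Qed.

Definition rnder k f : R -> R := iter k (@derive1 R R) f.

Lemma rsmooth_derive1 f : rsmooth f ->
  (forall t : R, is_derive t (1 : R) f (derive1 f t)) /\ rsmooth (derive1 f).
Proof.
move=> H; have E f' : (forall t : R, is_derive t (1 : R) f (f' t)) -> derive1 f = f'.
  by move=> D; apply/funext => t; rewrite derive1E; apply: derive_val.
split=> [t|k]; first by have [f' D _] := H 1%N; rewrite (E f').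
by have [f' D Hf'] := H k.+1; rewrite (E f').
Qed.

Lemma rsmooth_nder f : rsmooth f ->
  forall k, (forall t : R, is_derive t (1 : R) (rnder k f) (rnder k.+1 f t)) /\ rsmooth (rnder k f).
Proof.
move=> H; have S k : rsmooth (rnder k f).
  by elim: k => // k IH; exact: (rsmooth_derive1 IH).2.
by move=> k; split; [exact: (rsmooth_derive1 (S k)).1|exact: S].
Qed.

End SmoothFunctionsReal.

(** * Curves differentiable to finite order *)

Section DiffN.
Variables (R : realType).

Fixpoint diffn (E : lcs R) (k : nat) (c : R -> E) : Prop :=
  (forall t, dom (c t)) /\
  if k is k'.+1 then exists2 c' : R -> E, forall t, is_lderiv c t (c' t) & diffn k' c'
  else True.

Lemma diffn_dom (E : lcs R) k (c : R -> E) t : diffn k c -> dom (c t).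
Proof. by case: k => [|k] []. Qed.

Lemma diffnW (E : lcs R) k (c : R -> E) : diffn k.+1 c -> diffn k c.
Proof.
by elim: k c => [|k IH] c [dc [c' D H]]; split => //; exists c' => //; exact: IH.
Qed.

Lemma smooth_diffn (E : lcs R) (c : R -> E) k : smooth_curve c -> diffn k c.
Proof.
move=> /smooth_curveP[d H <-]; move: (d) H; elim: k => [|k IH] {}d H.
  by split=> // t; exact: dseq_dom.
split=> [t|]; first exact: dseq_dom.
by exists (d 1%N) => [t|]; [exact: (H 0%N t).2|apply: (IH (fun k => d k.+1)) => j t; exact: H].
Qed.

(** Each order comes with its own witnesses; uniqueness of derivatives identifies all of them with
    iterated [lderiv], which yields a single sequence. *)
Lemma smooth_curve_diffn (E : lcs R) (gE : good E) (c : R -> E) :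
  (forall k, diffn k c) -> smooth_curve c.
Proof.
move=> H; have step (c1 : R -> E) : (forall k, diffn k c1) ->
    (forall t, is_lderiv c1 t (lderiv c1 t)) /\ (forall k, diffn k (lderiv c1)).
  move=> H1; have dc t : dom (c1 t) := diffn_dom t (H1 0%N).
  have E1 k c' : (forall t, is_lderiv c1 t (c' t)) -> diffn k c' -> lderiv c1 = c'.
    move=> D Hc'; apply/funext => t; apply: lderivE => //; first exact: near0W.
    exact: diffn_dom Hc'.
  split=> [t|k]; first by have [_ [c' D Hc']] := H1 1%N; rewrite (E1 0%N c').
  by have [_ [c' D Hc']] := H1 k.+1; rewrite (E1 k c').
have Hk k : forall j, diffn j (nder k c).
  by elim: k => // k IH; exact: (step _ IH).2.
apply/smooth_curveP; exists (fun k => nder k c) => // k t.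
by split; [exact: diffn_dom (Hk k 0%N)|exact: (step _ (Hk k)).1].
Qed.

Section Closure.
Variables (E : lcs R) (gE : good E).
Implicit Types c : R -> E.

Lemma diffn_lin k (a : R[i]) c1 c2 : diffn k c1 -> diffn k c2 ->
  diffn k (fun t => a *: c1 t + c2 t).
Proof.
elim: k c1 c2 => [|k IH] c1 c2 [d1 H1] [d2 H2]; first by split=> // t; exact: goodP.
split=> [t|]; first exact: goodP.
case: H1 H2 => [c1' D1 H1] [c2' D2 H2]; exists (fun t => a *: c1' t + c2' t); last exact: IH.
move=> t; apply: is_lderivP_lin => //; try exact: near0W.
  exact: diffn_dom H1.
exact: diffn_dom H2.
Qed.

Lemma diffnD k c1 c2 : diffn k c1 -> diffn k c2 -> diffn k (fun t => c1 t + c2 t).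
Proof.
by move=> H1 /(diffn_lin 1 H1); congr diffn; apply/funext => t; rewrite scale1r.
Qed.

Lemma diffn_cst k (x : E) : dom x -> diffn k (fun=> x).
Proof.
elim: k x => [|k IH] x dx; first by split.
split=> //; exists (fun=> 0); last by apply: IH; exact: good0.
by move=> t; exact: is_lderiv_cst.
Qed.

Lemma smooth_lin (a : R[i]) c1 c2 : smooth_curve c1 -> smooth_curve c2 ->
  smooth_curve (fun t => a *: c1 t + c2 t).
Proof.
by move=> H1 H2; apply: smooth_curve_diffn => // k; apply: diffn_lin; exact: smooth_diffn.
Qed.

Lemma smooth_curveD c1 c2 : smooth_curve c1 -> smooth_curve c2 ->
  smooth_curve (fun t => c1 t + c2 t).
Proof.
by move=> H1 H2; apply: smooth_curve_diffn => // k; apply: diffnD; exact: smooth_diffn.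
Qed.

Lemma smooth_cst (x : E) : dom x -> smooth_curve (fun=> x).
Proof. by move=> dx; apply: smooth_curve_diffn => // k; exact: diffn_cst. Qed.

End Closure.

Lemma diffn_bil (E F G : lcs R) (gE : good E) (gF : good F) (gG : good G)
    (mu : E -> F -> G) (bmu : bilin mu) k c d :
  diffn k c -> diffn k d -> diffn k (fun t => mu (c t) (d t)).
Proof.
elim: k c d => [|k IH] c d Hc Hd.
  by split=> // t; apply: (bil_dom bmu); [exact: (diffn_dom t Hc)|exact: (diffn_dom t Hd)].
have Wc := diffnW Hc; have Wd := diffnW Hd.
split=> [t|]; first by apply: (bil_dom bmu); [exact: diffn_dom Hc|exact: diffn_dom Hd].
case: Hc Hd => dc [c' Dc Hc] [dd [d' Dd Hd]].
exists (fun t => mu (c' t) (d t) + mu (c t) (d' t)); last by apply: diffnD => //; exact: IH.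
move=> t; apply: (is_lderiv_bil gE gF gG bmu) => //; try exact: near0W.
  exact: diffn_dom Hc.
exact: diffn_dom Hd.
Qed.

Lemma smooth_bil (E F G : lcs R) (gE : good E) (gF : good F) (gG : good G)
    (mu : E -> F -> G) (bmu : bilin mu) c d :
  smooth_curve c -> smooth_curve d -> smooth_curve (fun t => mu (c t) (d t)).
Proof.
move=> Hc Hd; apply: (smooth_curve_diffn gG) => k.
by apply: (diffn_bil gE gF gG bmu); exact: smooth_diffn.
Qed.

Lemma bilin_scale (E : lcs R) (gE : good E) :
  @bilin R (Clcs R) E E (fun (a : R[i]) x => a *: x).
Proof.
split=> //.
- by move=> x y _ dy; exact: domZ.
- by move=> a x x' y _ _ dy; rewrite scalerDl scalerA.
- by move=> a x y y' _ dy dy'; rewrite scalerDr !scalerA mulrC.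
- move=> p sp; exists (fun z : R[i] => Normc.normc z), p, 1; split=> // x y _ dy.
  by rewrite (goodZ gE)// mul1r.
Qed.

Lemma is_lderiv_real (s : R -> R) (t r : R) : is_derive t (1 : R) s r ->
  @is_lderiv R (Clcs R) (fun t => (s t)%:C) t r%:C.
Proof.
move=> /is_derive1P D; apply/(is_lderivP (good_Clcs R)) => //; first exact: near0W.
move=> p /= -> e e0; have := D e e0; apply: filterS => h.
by rewrite -[_ *: _]rmorphM -!rmorphB normcR.
Qed.

Lemma diffn_real k (s : R -> R) : rdiff k s -> @diffn (Clcs R) k (fun t => (s t)%:C).
Proof.
elim: k s => // k IH s [s' D H]; split=> //; exists (fun t => (s' t)%:C); last exact: IH.
by move=> t; exact: is_lderiv_real.
Qed.

Lemma smooth_scale (E : lcs R) (gE : good E) (s : R -> R) (c : R -> E) :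
  rsmooth s -> smooth_curve c -> smooth_curve (fun t => (s t)%:C *: c t).
Proof.
move=> Hs Hc; apply: (smooth_curve_diffn gE) => k.
apply: (diffn_bil (good_Clcs R) gE gE (bilin_scale gE)); first exact: diffn_real.
exact: smooth_diffn.
Qed.

Lemma smooth_comp (E : lcs R) (gE : good E) (c : R -> E) (s : R -> R) :
  smooth_curve c -> rsmooth s -> smooth_curve (c \o s).
Proof.
move=> Hc Hs; apply: (smooth_curve_diffn gE) => k.
have {}Hc : diffn k c by exact: smooth_diffn.
move: {Hs} (Hs k); elim: k c Hc s => [|k IH] c Hc s Hs.
  by split=> // t; exact: diffn_dom Hc.
split=> [t|]; first exact: diffn_dom Hc.
have Ws := rdiffW Hs.
case: Hc Hs => dc [c' Dc Hc] [s' Ds Hs]; exists (fun t => (s' t)%:C *: (c' \o s) t).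
  move=> t; apply: is_lderiv_comp => //; first exact: near0W.
  exact: diffn_dom Hc.
by apply: (diffn_bil (good_Clcs R) gE gE (bilin_scale gE));
  [exact: diffn_real|exact: IH].
Qed.

End DiffN.

(** * Bump functions and the special curve *)

Section Bump.
Variable R : realType.
Implicit Types (t y : R).

(** The functions t^(-m) exp(-1/t), extended by 0, are closed under differentiation up to linear
    combinations, so the smoothness of all of them is proved together. *)
Definition flat (m : nat) t : R := if 0 < t then t^-1 ^+ m * expR (- t^-1) else 0.

Lemma is_derive1_near (f g : R -> R) (t s : R) :
  (\forall h \near (0 : R), f (t + h) = g (t + h)) ->
  is_derive t (1 : R) f s -> is_derive t (1 : R) g s.
Proof.
move=> H /is_derive1P D; apply/is_derive1P => e e0; have := D e e0.
have H0 : f t = g t by have /= := nbhs_singleton H; rewrite addr0.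
by move=> K; near=> h; rewrite -H0 -(near H h)//; near: h.
Unshelve. all: by end_near. Qed.

(** With z = y / N this is z <= 1 + z <= exp z raised to the power N. *)
Lemma expR_poly_bound (N : nat) y : 0 <= y -> y ^+ N * expR (- y) <= N%:R ^+ N.
Proof.
case: N => [|N] y0; first by rewrite !expr0 mul1r -expR0 ler_expR; lra.
rewrite expRN ler_pdivrMr ?expR_gt0//.
have -> : y = y / N.+1%:R *+ N.+1 by rewrite -mulr_natr divfK// pnatr_eq0.
set z := y / N.+1%:R; have z0 : 0 <= z by rewrite divr_ge0.
rewrite -[z *+ _]mulr_natl expRM_natl exprMn; apply: ler_wpM2l; first exact: exprn_ge0.
rewrite lerXn2r ?nnegrE// ?expR_ge0//.
by apply: le_trans (expR_ge1Dx z); lra.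
Qed.

Lemma is_derive_flat m t :
  is_derive t (1 : R) (flat m) (- m%:R * flat m.+1 t + flat m.+2 t).
Proof.
have [t0|t0|->] := ltgtP t 0.
- apply: (@is_derive1_near (fun=> 0)).
    near=> h; rewrite /flat ifF//; apply/negbTE; rewrite -leNgt.
    have : `|h| <= - t by near: h; apply: near0_le; lra.
    by rewrite ler_norml; lra.
  rewrite /flat !(lt_gtF t0) mulr0 addr0; exact: is_derive_cst.
- apply: (@is_derive1_near (fun t => t^-1 ^+ m * expR (- t^-1))).
    near=> h; rewrite /flat ifT//.
    have : `|h| <= t / 2 by near: h; apply: near0_le; lra.
    by rewrite ler_norml; lra.
  rewrite /flat t0.
  have tn : t != 0 by rewrite gt_eqF.
  have DV : is_derive t (1 : R) (fun t => t^-1) (- t ^- 2 *: 1).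
    by apply: is_deriveV => //; exact: is_derive_id.
  have DN : is_derive t (1 : R) (fun t => - t^-1) (- (- t ^- 2 *: 1)) by exact: is_deriveN.
  have DX := is_deriveX m DV; rewrite exprfctE in DX.
  have DE := is_derive1_comp (is_derive_expR _) DN.
  have := is_deriveM DX DE.
  congr is_derive; rewrite /GRing.scale /= !mulr1 opprK.
  have -> : t ^- 2 = t^-1 * t^-1 by rewrite -expr2 exprVn.
  by case: (m) => [|k] /=; rewrite !exprS; ring.
- rewrite /flat ltxx mulr0 addr0; apply/is_derive1P => e e0.
  (* [expR_poly_bound] at 1/h with exponent m + 2 gives [flat m h <= K h^2], whence the derivative 0
     at 0. *)
  pose K : R := m.+2%:R ^+ m.+2.
  have K0 : 0 < 1 + K by rewrite ltr_pwDl// exprn_ge0.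
  near=> h; rewrite add0r ltxx mulr0 !subr0.
  case: ifPn => [h0|_]; last by rewrite normr0 mulr_ge0// ltW.
  have hi : 0 <= h^-1 by rewrite invr_ge0 ltW.
  have := expR_poly_bound m.+2 hi; rewrite -/K.
  rewrite 2!exprS => B.
  have hn : h != 0 by rewrite gt_eqF.
  have hK : `|h| <= e / (1 + K) by near: h; apply: near0_le; rewrite divr_gt0.
  rewrite ger0_norm; last by rewrite mulr_ge0 ?exprn_ge0 ?expR_ge0.
  rewrite ger0_norm ?(ltW h0)// in hK *.
  pose X := h^-1 ^+ m * expR (- h^-1); rewrite -/X.
  have {}B : h^-1 * (h^-1 * X) <= K by move: B; rewrite /X !mulrA.
  have : X <= K * h * h.
    have := ler_wpM2r (ltW h0) (ler_wpM2r (ltW h0) B).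
    by rewrite (_ : h^-1 * (h^-1 * X) * h * h = X)//; field.
  move=> /le_trans; apply; apply: ler_wpM2r; first exact: ltW.
  by move: hK; rewrite ler_pdivlMr//; nra.
Unshelve. all: by end_near. Qed.

Lemma rdiff_flat k m : rdiff k (flat m).
Proof.
elim: k m => // k IH m; eexists; first by move=> t; exact: is_derive_flat.
by apply: rdiffD => //; apply: rdiffM => //; exact: rdiff_cst.
Qed.

Lemma flat_ge0 m t : 0 <= flat m t.
Proof.
rewrite /flat; case: ifP => // t0; rewrite mulr_ge0 ?expR_ge0// exprn_ge0// invr_ge0.
exact: ltW.
Qed.

Lemma flat_gt0 m t : 0 < t -> 0 < flat m t.
Proof. by move=> t0; rewrite /flat t0 mulr_gt0 ?expR_gt0// exprn_gt0// invr_gt0. Qed.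

Lemma flat_le0 m t : t <= 0 -> flat m t = 0.
Proof. by move=> t0; rewrite /flat ifF// ltNge t0. Qed.

Section Plateau.
Variables (a b : R) (ab : a < b).

(** The bounds [a] and [b] refer to the square of [y], so the function is even and smooth. The two
    summands of the denominator never vanish together because a < b. *)
Definition plateau y : R := flat 0 (b - y * y) / (flat 0 (b - y * y) + flat 0 (y * y - a)).

Lemma plateau_den y : 0 < flat 0 (b - y * y) + flat 0 (y * y - a).
Proof.
have [y1|y1] := ltP (y * y) b.
  by rewrite ltr_wpDr ?flat_ge0// flat_gt0// subr_gt0.
by rewrite ltr_wpDl ?flat_ge0// flat_gt0// subr_gt0 (lt_le_trans ab).
Qed.

Lemma rsmooth_plateau : rsmooth plateau.
Proof.
have sq : rsmooth (fun y : R => y * y) by apply: rsmoothM; exact: rsmooth_id.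
have A : rsmooth (fun y : R => b - y * y).
  rewrite (_ : (fun y => _) = fun y : R => b + (-1) * (y * y)).
    by apply: rsmoothD; [exact: rsmooth_cst|apply: rsmoothM => //; exact: rsmooth_cst].
  by apply/funext => y; rewrite mulN1r.
have B : rsmooth (fun y : R => y * y - a).
  by apply: (rsmoothD sq); exact: rsmooth_cst.
have FA : rsmooth (flat 0 \o fun y : R => b - y * y).
  by apply: rsmooth_comp => // k; exact: rdiff_flat.
have FB : rsmooth (flat 0 \o fun y : R => y * y - a).
  by apply: rsmooth_comp => // k; exact: rdiff_flat.
apply: (rsmoothM FA); apply: rsmoothV; first by move=> y; rewrite gt_eqF// plateau_den.
exact: rsmoothD.
Qed.

Lemma plateau1 y : y * y <= a -> plateau y = 1.
Proof.
move=> yy; rewrite /plateau [flat 0 (y * y - _)]flat_le0; last by lra.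
by rewrite addr0 divff// gt_eqF// flat_gt0// subr_gt0 (le_lt_trans yy).
Qed.

Lemma plateau0 y : b <= y * y -> plateau y = 0.
Proof. by move=> y1; rewrite /plateau flat_le0 ?mul0r//; lra. Qed.

End Plateau.

Lemma rnder_near (f g : R -> R) t k : (\forall s \near t, f s = g s) ->
  \forall s \near t, rnder k f s = rnder k g s.
Proof.
move=> H; elim: k => // k IH; move/nbhs_interior: IH; apply: filterS => s Hs.
by rewrite /rnder !iterS !derive1E; apply: near_eq_derive.
Qed.

Lemma rnder_eq0 (f : R -> R) k y : (forall y, 1 <= `|y| -> f y = 0) ->
  1 < `|y| -> rnder k f y = 0.
Proof.
move=> f0 y1; have z : \forall s \near y, f s = 0.
  near=> s; apply: f0; apply: ltW; near: s.
  by apply: (@cvgr_gt _ _ _ _ _ `|y|) => //; exact: norm_continuous.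
have := nbhs_singleton (rnder_near k z) => ->.
elim: k y {y1 z} => // j IH y; rewrite /rnder iterS -/(rnder j _).
rewrite (_ : rnder j (fun=> 0) = fun=> 0); last by apply/funext.
by rewrite derive1_cst.
Unshelve. all: by end_near. Qed.

(** All derivatives vanish outside [-1, 1], and on that interval a continuous function attains its
    maximum. *)
Lemma rnder_bounded (f : R -> R) k : rsmooth f -> (forall y, 1 <= `|y| -> f y = 0) ->
  exists2 M, 0 <= M & forall y, `|rnder k f y| <= M.
Proof.
move=> Hf f0; have [D _] := rsmooth_nder Hf k.
have cont : {within `[(-1 : R), 1], continuous (fun y => `|rnder k f y|)}.
  apply: continuous_subspaceT => y; apply: continuous_comp; last exact: norm_continuous.
  by apply: differentiable_continuous; apply/derivable1_diffP; have [] := D y.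
have [c _ Hc] := EVT_max (ltac:(lra) : (-1 : R) <= 1) cont.
exists `|rnder k f c| => // y.
have [y1|y1] := leP `|y| 1; first by apply: Hc; rewrite in_itv /= -ler_norml.
by rewrite (rnder_eq0 (f := f) k f0 y1) normr0.
Qed.

End Bump.

Lemma dseq_taylor2_abs (R : realType) (E : lcs R) (gE : good E) (p : E -> R) (sp : sn p)
    (d : nat -> R -> E) (C s r : R) : dseq d ->
  (forall t, p (d 2%N t) <= C) ->
  p (d 0%N (s + r) - d 0%N s - r%:C *: d 1%N s) <= C * r ^+ 2.
Proof.
move=> H B; have [r0|r0] := leP 0 r; first exact: (dseq_taylor2 gE sp H r0 (fun t _ => B t)).
have := dseq_taylor2 gE sp (C := C) (s := - s) (r := - r) (dseq_comp_aff gE (-1) 0 H).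
rewrite !mulN1r !opprK !opprD !opprK !addr0 !expr0 !scale1r expr1 !sqrrN expr1n.
rewrite rmorphN1 scaleN1r rmorphN scaleNr scalerN opprK; apply; first by lra.
by move=> t _; rewrite scale1r; exact: B.
Qed.

(** * Smooth functions with prescribed affine pieces accumulating at 0 *)

Section SpecialCurve.
Variable R : realType.
Implicit Types (t y : R) (n k : nat).

Definition pow2 n : R := 2 ^+ n.
Definition node n : R := (pow2 n)^-1.
(** Inverse half-width: the n-th spike lives within distance [node n / 4] of [node n], and these
    intervals are pairwise disjoint. *)
Definition winv n : R := 4 * pow2 n.
(** k derivatives of a spike cost a factor [winv n ^+ k]. The inverse of [winv n ^+ n] absorbs it
    for n >= k, and the remaining 2^(-n) makes the sum converge. *)
Definition decay n : R := (pow2 n * winv n ^+ n)^-1.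

Lemma pow2_ge1 n : 1 <= pow2 n. Proof. by rewrite exprn_ege1//; lra. Qed.
Lemma pow2_gt0 n : 0 < pow2 n. Proof. by rewrite exprn_gt0. Qed.
Lemma node_gt0 n : 0 < node n. Proof. by rewrite invr_gt0 pow2_gt0. Qed.
Lemma winv_gt0 n : 0 < winv n. Proof. by rewrite mulr_gt0// pow2_gt0. Qed.
Lemma decay_gt0 n : 0 < decay n.
Proof. by rewrite invr_gt0 mulr_gt0 ?pow2_gt0// exprn_gt0// winv_gt0. Qed.
Lemma winv_node n : winv n * node n = 4.
Proof. by rewrite /winv /node mulfK// gt_eqF// pow2_gt0. Qed.

Lemma le_winv m n : (m <= n)%N -> winv m <= winv n.
Proof. by move=> mn; rewrite ler_pM2l// /pow2 ler_eXn2l//; lra. Qed.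

Lemma node_lt m n : (m < n)%N -> node n <= node m / 2.
Proof.
move=> mn; rewrite /node -invfM lef_pV2 ?posrE ?pow2_gt0//; last first.
  by rewrite mulr_gt0// pow2_gt0.
by rewrite mulrC -exprS /pow2 ler_eXn2l//; lra.
Qed.

Variables (a b : nat -> R) (M : R).
Hypotheses (M0 : 0 <= M) (ha : forall n, `|a n| <= decay n)
  (hb : forall n, `|b n| <= M * decay n).

Let plateau : R -> R := plateau 4^-1 1.

Let rsmooth_plateau : rsmooth plateau.
Proof. by apply: rsmooth_plateau; lra. Qed.

Let plateau1 y : `|y| <= 2^-1 -> plateau y = 1.
Proof. by rewrite ler_norml => /andP[y1 y2]; apply: plateau1; [lra|nra]. Qed.

Let plateau0 y : 1 <= `|y| -> plateau y = 0.
Proof.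
move=> y1; apply: plateau0.
by rewrite -expr2 -real_normK ?num_real// expr_ge1.
Qed.

Let plateau' y : R := y * plateau y.

Lemma rsmooth_plateau' : rsmooth plateau'.
Proof. by apply: rsmoothM; [exact: rsmooth_id|exact: rsmooth_plateau]. Qed.

(** The k-th derivative of a_n + b_n (t - node n) times the rescaled plateau; dividing [b n] by
    [winv n] undoes the rescaling of the linear factor in [plateau']. *)
Definition spike n k t : R :=
  winv n ^+ k * (a n * rnder k plateau (winv n * (t - node n)) +
    b n / winv n * rnder k plateau' (winv n * (t - node n))).

Lemma is_derive_spike n k t : is_derive t (1 : R) (spike n k) (spike n k.+1 t).
Proof.
have [D1 _] := rsmooth_nder rsmooth_plateau k.
have [D2 _] := rsmooth_nder rsmooth_plateau' k.
have L s : is_derive s (1 : R) (fun t => winv n * (t - node n)) (winv n).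
  apply/is_derive1P => e e0; apply: near0W => h.
  rewrite (_ : _ - _ - _ = 0); last by ring.
  by rewrite normr0 mulr_ge0// ltW.
have A := is_derive1_comp (D1 _) (L t).
have B := is_derive1_comp (D2 _) (L t).
have S := is_deriveZ (winv n ^+ k) (is_deriveD (is_deriveZ (a n) A) (is_deriveZ (b n / winv n) B)).
have {}S : is_derive t (1 : R) (spike n k) _ := S.
by move: S; congr is_derive; rewrite /spike /GRing.scale /= exprSr; ring.
Qed.

Lemma plateau'0 y : 1 <= `|y| -> plateau' y = 0.
Proof. by move=> y1; rewrite /plateau' plateau0// mulr0. Qed.

Lemma spike_eq0 n k t : 1 < winv n * `|t - node n| -> spike n k t = 0.
Proof.
rewrite -[winv n in X in X -> _](gtr0_norm (winv_gt0 n)) -normrM => H.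
rewrite /spike !rnder_eq0 ?mulr0 ?addr0 ?mulr0//; first [exact: plateau0|exact: plateau'0].
Qed.

(** For n <= k the power is at most [winv k ^+ k]; for n > k it is absorbed by [winv n ^+ n]. With k
    fixed the bound is summable in n. *)
Lemma decay_winv n k : decay n * winv n ^+ k <= winv k ^+ k * node n.
Proof.
rewrite /decay invfM -/(node n) -mulrA mulrC; apply: ler_wpM2r; first exact/ltW/node_gt0.
have [nk|kn] := leqP n k.
  have : winv n ^+ n >= 1.
    rewrite exprn_ege1// /winv; have := pow2_ge1 n; lra.
  move=> h1; apply: (@le_trans _ _ (winv n ^+ k)).
    by rewrite mulrC ler_pdivrMr ?(lt_le_trans ltr01)// ler_peMr// exprn_ge0// ltW// winv_gt0.
  apply: lerXn2r; rewrite ?nnegrE; [exact/ltW/winv_gt0..|exact: le_winv].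
have wn : 0 < winv n ^+ n by rewrite exprn_gt0// winv_gt0.
rewrite mulrC ler_pdivrMr//.
have w1 m : 1 <= winv m by rewrite /winv; have := pow2_ge1 m; lra.
apply: (@le_trans _ _ (winv n ^+ n)); first by rewrite ler_weXn2l// ltnW.
by rewrite ler_peMl ?exprn_ege1// ltW.
Qed.

Lemma spike_bound k : exists2 Q, 0 <= Q & forall n t, `|spike n k t| <= Q * node n.
Proof.
have [Q1 Q10 H1] := rnder_bounded k rsmooth_plateau plateau0.
have [Q2 Q20 H2] := rnder_bounded k rsmooth_plateau' plateau'0.
have wk : 0 <= winv k ^+ k by rewrite exprn_ge0// ltW// winv_gt0.
exists ((Q1 + M * Q2) * winv k ^+ k).
  by rewrite mulr_ge0// addr_ge0// mulr_ge0.
move=> n t; rewrite /spike normrM (ger0_norm (exprn_ge0 _ (ltW (winv_gt0 n)))).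
set y := winv n * _; have dn := decay_gt0 n.
have w1 : 1 <= winv n by rewrite /winv; have := pow2_ge1 n; lra.
have A : `|a n * rnder k plateau y| <= decay n * Q1.
  by rewrite normrM; apply: ler_pM.
have B : `|b n / winv n * rnder k plateau' y| <= (M * decay n) * Q2.
  rewrite normrM; apply: ler_pM => //; rewrite normrM.
  apply: le_trans (hb n); rewrite ler_piMr// normfV gtr0_norm ?winv_gt0//.
  by rewrite invf_le1 ?winv_gt0.
apply: (@le_trans _ _ (winv n ^+ k * (decay n * (Q1 + M * Q2)))).
  apply: ler_wpM2l; first by rewrite exprn_ge0// ltW// winv_gt0.
  by apply: le_trans (ler_normD _ _) _; lra.
have Q0 : 0 <= Q1 + M * Q2 by rewrite addr_ge0// mulr_ge0.
have := ler_wpM2r Q0 (decay_winv n k); congr (_ <= _); by ring.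
Qed.

Definition spikes N k t : R := \sum_(n < N) spike n k t.

Lemma is_derive_spikes N k t : is_derive t (1 : R) (spikes N k) (spikes N k.+1 t).
Proof.
rewrite (_ : spikes N k = \sum_(n < N) spike n k); last first.
  by apply/funext => s; rewrite fct_sumE.
by apply: is_derive_sum => n; exact: is_derive_spike.
Qed.

Lemma sum_node N : \sum_(n < N) node n = 2 - 2 * node N.
Proof.
elim: N => [|N IH]; first by rewrite big_ord0 /node /pow2 expr0 invr1; lra.
rewrite big_ord_recr IH /= /node /pow2 exprS invfM; lra.
Qed.

Lemma spikes_bound k : exists2 Q, 0 <= Q & forall N t, `|spikes N k t| <= Q.
Proof.
have [Q Q0 H] := spike_bound k; exists (Q * 2); first by rewrite mulr_ge0.
move=> N t; apply: le_trans (ler_norm_sum _ _ _) _.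
apply: (@le_trans _ _ (\sum_(n < N) Q * node n)); first exact: ler_sum.
rewrite -mulr_sumr sum_node; apply: ler_wpM2l => //; have := node_gt0 N; lra.
Qed.

(** From this index on the nodes are below t / 2 when t > 0, so no spike reaches t; for t <= 0 every
    spike vanishes at t. *)
Definition rank t : nat := (Num.truncn (2 / t)).+1.

Lemma spike_rank t n k : (rank t <= n)%N -> spike n k t = 0.
Proof.
move=> tn; apply: spike_eq0; rewrite -(ltr_pM2r (node_gt0 n)) mul1r mulrAC winv_node.
have n0 := node_gt0 n.
have [t0|t0] := leP t 0; first by rewrite ler0_norm; lra.
have : node n < t / 2.
  rewrite -[t / 2]invrK ltf_pV2 ?posrE ?pow2_gt0 ?invr_gt0 ?divr_gt0// invf_div.
  apply: (@lt_le_trans _ _ n%:R); last by rewrite /pow2 -natrX ler_nat ltnW// ltn_expl.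
  by apply: (lt_le_trans (truncnS_gt _)); rewrite ler_nat.
by move=> nt; rewrite ger0_norm; lra.
Qed.

Definition spike_sum k t : R := spikes (rank t) k t.

Lemma spikes_rank N k t : (rank t <= N)%N -> spikes N k t = spike_sum k t.
Proof.
move=> tN; rewrite /spike_sum /spikes -(subnK tN); elim: (N - rank t)%N => // j IH.
by rewrite addSn big_ord_recr /= IH spike_rank ?addr0// leq_addl.
Qed.

(** At [t] and [t + h] the values are those of one partial sum, whose Taylor remainder has a
    constant independent of that sum and of [h]. This covers t = 0, where the spikes accumulate. *)
Lemma is_derive_spike_sum k t : is_derive t (1 : R) (spike_sum k) (spike_sum k.+1 t).
Proof.
have [Q Q0 HQ] := spikes_bound k.+2.
apply/is_derive1P => e e0; near=> h.
pose N := maxn (rank t) (rank (t + h)).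
rewrite -!(@spikes_rank N) ?leq_maxl ?leq_maxr//.
have D : @dseq R (Clcs R) (fun j t => (spikes N (j + k) t)%:C).
  by move=> j s; split=> //; apply: is_lderiv_real; exact: is_derive_spikes.
have := @dseq_taylor2_abs _ _ (good_Clcs R) (fun z => Normc.normc z) erefl _ Q t h D.
rewrite -[_%:C *: _]rmorphM -!rmorphB normcR => /(_ _)/le_trans; apply.
  by move=> s; rewrite normcR.
have : `|h| <= e / (1 + Q) by near: h; apply: near0_le; rewrite divr_gt0// ltr_pwDl.
rewrite ler_pdivlMr ?ltr_pwDl// -real_normK ?num_real// expr2 => hQ.
by rewrite mulrA; apply: ler_wpM2r => //; have := normr_ge0 h; lra.
Unshelve. all: by end_near. Qed.

Lemma rdiff_seq (d : nat -> R -> R) k :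
  (forall k t, is_derive t (1 : R) (d k) (d k.+1 t)) -> rdiff k (d 0%N).
Proof.
elim: k d => // k IH d D; exists (d 1%N); first exact: D.
by apply: (IH (fun j => d j.+1)) => j t; exact: D.
Qed.

Lemma spike_sum_node n : \forall h \near (0 : R),
  spike_sum 0 (node n + h) = a n + b n * h.
Proof.
have n0 := node_gt0 n.
near=> h.
(* [winv n] times [node n / 8] is 1/2, so the plateau of the n-th spike equals 1 at [t], and all
   other spikes vanish there. *)
have hn : `|h| <= node n / 8 by near: h; apply: near0_le; rewrite divr_gt0.
set t := node n + h.
pose N := maxn (rank t) n.+1.
have nN : (n < N)%N by rewrite leq_max ltnSn orbT.
rewrite -(@spikes_rank N) ?leq_maxl// /spikes (bigD1 (Ordinal nN))//= big1 ?addr0.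
  rewrite /spike expr0 mul1r /rnder /= /t [node n + h]addrC addrK.
  have w0 := winv_gt0 n.
  have hw : `|winv n * h| <= 2^-1.
    rewrite normrM gtr0_norm//; have := ler_wpM2l (ltW w0) hn; rewrite mulrA winv_node; lra.
  by rewrite /plateau' plateau1// !mulr1 mulrA divfK// gt_eqF.
move=> m; rewrite -val_eqE /= => mn; apply: spike_eq0.
rewrite -(ltr_pM2r (node_gt0 m)) mul1r mulrAC winv_node.
move: hn; rewrite ler_norml => /andP[h1 h2].
have m0 := node_gt0 m.
move: mn; rewrite neq_ltn => /orP[mn|nm].
  by have K := node_lt mn; rewrite /t ltr0_norm; lra.
by have K := node_lt nm; rewrite /t gtr0_norm; lra.
Unshelve. all: by end_near. Qed.

End SpecialCurve.

(** One coordinate of the special curve lemma of convenient calculus. The curve is affine near each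
    node, not merely tangent to a line, so every derivative of a composite at a node is a pure
    directional derivative. *)
Lemma special_curve (R : realType) (a b : nat -> R) (M : R) : 0 <= M ->
  (forall n, `|a n| <= decay R n) -> (forall n, `|b n| <= M * decay R n) ->
  exists2 f : R -> R, rsmooth f & forall n, \forall h \near (0 : R),
    f (node R n + h) = a n + b n * h.
Proof.
move=> M0 ha hb; exists (spike_sum a b 0); last exact: spike_sum_node.
by move=> k; apply: rdiff_seq => j t; exact: is_derive_spike_sum ha hb _ _.
Qed.

(** * Differentials of smooth maps *)

Section Boman.
Variables (R : realType) (F : lcs R) (gF : good F).
Local Notation V := (R * R)%type.
Variable h : V -> F.
Hypothesis smooth_along : forall s t : R -> R, rsmooth s -> rsmooth t ->
  smooth_curve (fun r => h (s r, t r)).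

Lemma rsmooth_aff (a b : R) : rsmooth (fun r : R => a + r * b).
Proof.
apply: rsmoothD; first exact: rsmooth_cst.
by apply: rsmoothM; [exact: rsmooth_id|exact: rsmooth_cst].
Qed.

Lemma smooth_along_lines (x v : V) : smooth_curve (fun r : R => h (x + r *: v)).
Proof.
have := smooth_along (rsmooth_aff x.1 v.1) (rsmooth_aff x.2 v.2).
congr smooth_curve.
Qed.

(* If the derivatives were unbounded near [x0], a smooth curve through suitable
   points close to [x0], with velocities decaying to zero, would be mapped by
   [h] to a curve with an unbounded derivative. *)
Lemma bounded_dirder p : sn p -> forall m (v x0 : V), exists d C, [/\ 0 < d, 0 <= C &
  forall x, `|x - x0| < d -> p (dirder h m v x) <= C].
Proof.
move=> sp m v x0; apply: contrapT => H.
(* The constant n / decay^m compensates the factor decay^m that the m-th derivative acquires from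
   the speed of the curve. *)
have ex n : exists x, `|x - x0| < decay R n /\ n%:R / decay R n ^+ m < p (dirder h m v x).
  apply: contrapT => K; apply: H; exists (decay R n), (n%:R / decay R n ^+ m); split.
  - exact: decay_gt0.
  - by rewrite divr_ge0// exprn_ge0// ltW// decay_gt0.
  - move=> x xd; rewrite leNgt; apply/negP => px; apply: K; by exists x.
have [x Hx] := choice ex.
have M0 : 0 <= `|v| by [].
have le1 (y : V) : `|y.1| <= `|y| by rewrite prod_normE le_max lexx.
have le2 (y : V) : `|y.2| <= `|y| by rewrite prod_normE le_max lexx orbT.
have dn n := decay_gt0 R n.
have [f1 S1 L1] := @special_curve R (fun n => (x n - x0).1) (fun n => decay R n * v.1) `|v| M0
  (fun n => le_trans (le1 _) (ltW (Hx n).1))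
  (fun n => ltac:(rewrite normrM gtr0_norm// mulrC; apply: ler_wpM2r => //; exact: ltW)).
have [f2 S2 L2] := @special_curve R (fun n => (x n - x0).2) (fun n => decay R n * v.2) `|v| M0
  (fun n => le_trans (le2 _) (ltW (Hx n).1))
  (fun n => ltac:(rewrite normrM gtr0_norm// mulrC; apply: ler_wpM2r => //; exact: ltW)).
pose c (t : R) := h (x0.1 + f1 t, x0.2 + f2 t).
have Sc : smooth_curve c.
  by apply: smooth_along; apply: rsmoothD => //; exact: rsmooth_cst.
have Dc := nder_dseq gF Sc.
(* Near the n-th node [c] follows the line through [x n] with velocity [decay R n *: v]. *)
have Ec n : nder m c (node R n) = (decay R n ^+ m)%:C *: dirder h m v (x n).
  rewrite -[node R n]add0r -nder_shift.
  have := nder_of_dseq gF m (dseq_comp_aff gF (decay R n) 0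
    (nder_dseq gF (smooth_along_lines (x n) v))).
  move=> /(congr1 (fun c => c 0)); rewrite mulr0 addr0 => <-.
  have K : \forall s \near (0 : R), c (s + node R n) =
      (decay R n ^+ 0)%:C *: nder 0 (fun r : R => h (x n + r *: v)) (decay R n * s + 0).
    near=> s; rewrite expr0 scale1r addr0 /nder /= /c [s + _]addrC.
    rewrite (near (L1 n) s)// (near (L2 n) s)//=; congr h.
    apply: injective_projections; rewrite /= /GRing.scale /=; ring.
  exact: nbhs_singleton (nder_near m K).
have Lc := is_lderiv_cont gF (near0W (fun t => dseq_dom m (0 + t) Dc)) (dseq_dom m.+1 0 Dc)
  (Dc m 0).2 sp ltr01.
have [d /= d0 Hd] := Lc.
pose B := p (nder m c 0) + 1.
(* This index puts the node into the neighbourhood of 0 where the seminorm of the m-th derivative is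
   at most [B], while at the node it exceeds n > B. *)
pose n := maxn (Num.truncn (d^-1)).+1 (Num.truncn B).+1.
have nd : node R n < d.
  rewrite -[d]invrK /node ltf_pV2 ?posrE ?pow2_gt0 ?invr_gt0//.
  apply: (@lt_le_trans _ _ n%:R); last by rewrite /pow2 -natrX ler_nat ltnW// ltn_expl.
  by apply: (lt_le_trans (truncnS_gt _)); rewrite ler_nat leq_maxl.
have nB : B < n%:R.
  by apply: (lt_le_trans (truncnS_gt _)); rewrite ler_nat leq_maxr.
have := Hd (node R n); rewrite /= sub0r normrN gtr0_norm ?node_gt0// => /(_ nd).
rewrite add0r Ec => A.
have dm : 0 < decay R n ^+ m by rewrite exprn_gt0.
have [_ X] := Hx n; move: X; rewrite ltr_pdivrMr// => X.
have dd : dom (dirder h m v (x n)) by apply: dom_dirder => //; exact: smooth_along_lines.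
have d0' : dom (nder m c 0) := dseq_dom m 0 Dc.
have := sn_lower gF sp (domZ gF (decay R n ^+ m)%:C dd) d0'.
rewrite (snZ gF)// gtr0_norm//; move: A X nB; rewrite /B; lra.
Unshelve. all: by end_near. Qed.

(** [smooth_dirder] with (0, 1) as the direction of the derivative and (1, 0) as the direction in
    which the base point moves. *)
Lemma smooth_partial : smooth_curve (fun s : R => lderiv (fun t : R => h (s, t)) 0).
Proof.
have := smooth_dirder gF smooth_along_lines bounded_dirder (0, 1) (1, 0) 0.
congr smooth_curve; apply/funext => s; rewrite /dirder /nder /=; congr (lderiv _ 0).
apply/funext => t; congr h.
by apply: injective_projections; rewrite /= /GRing.scale /=; ring.
Qed.

End Boman.

Section KDiff.
Variables (R : realType) (E F : lcs R) (gE : good E) (gF : good F).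

Lemma smooth_line (x v : E) : dom x -> dom v -> smooth_curve (fun t : R => x + t%:C *: v).
Proof.
move=> dx dv; apply: (smooth_curveD gE); first exact: smooth_cst.
by apply: smooth_scale => //; [exact: rsmooth_id|exact: smooth_cst].
Qed.

(** For a smooth curve [c] the map (s, t) |-> f (c s + t v) satisfies the hypothesis of
    [smooth_partial], and its t-derivative at t = 0 is the differential along [c]. *)
Lemma smooth_map_diff (f : E -> F) (v : E) : smooth_map f -> dom v ->
  smooth_map (fun x => lderiv (fun t : R => f (x + t%:C *: v)) 0).
Proof.
move=> [df Sf] dv; split=> [x dx|c Sc].
  have D := nder_dseq gF (Sf _ (smooth_line dx dv)).
  exact: (dseq_dom 1 0 D).
apply: (smooth_partial gF (h := fun x => f (c x.1 + x.2%:C *: v))) => s t Ss St.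
apply: (Sf (fun r => c (s r) + (t r)%:C *: v)).
apply: (smooth_curveD gE); first exact: (smooth_comp gE Sc Ss).
by apply: smooth_scale => //; exact: smooth_cst.
Qed.

Lemma smooth_kdiff (f : E -> F) (vs : seq E) : smooth_map f ->
  (forall v, v \in vs -> dom v) -> smooth_map (kdiff f vs).
Proof.
move=> Sf; elim: vs => [|v vs IH] H; first exact: Sf.
by apply: smooth_map_diff; [apply: IH => w wv; apply: H; rewrite in_cons wv orbT|apply: H; exact: mem_head].
Qed.

Lemma kdiff_is_lderiv (f : E -> F) v vs x : smooth_map f ->
  (forall w, w \in v :: vs -> dom w) -> dom x ->
  is_lderiv (fun t : R => kdiff f vs (x + t%:C *: v)) 0 (kdiff f (v :: vs) x).
Proof.
move=> Sf H dx.
have [_ S] := smooth_kdiff (vs := vs) Sf (fun w wv => H w (mem_behead (s := v :: vs) wv)).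
have D := nder_dseq gF (S _ (smooth_line dx (H v (mem_head v vs)))).
exact: (D 0%N 0).2.
Qed.

Lemma dom_kdiff (f : E -> F) vs x : smooth_map f ->
  (forall w, w \in vs -> dom w) -> dom x -> dom (kdiff f vs x).
Proof. by move=> Sf H; apply: (smooth_kdiff Sf H).1. Qed.

End KDiff.

(** * Spaces of smooth functions *)

(** All distributions of a list over two factors, keeping the order in each part: the index set of
    the Leibniz rule, for partial derivatives and for differentials alike. *)
Fixpoint splits (T : Type) (w : seq T) : seq (seq T * seq T) :=
  if w is i :: w' then
    [seq (i :: z.1, z.2) | z <- splits w'] ++ [seq (z.1, i :: z.2) | z <- splits w']
  else [:: ([::], [::])].

Lemma near_open (T : topologicalType) (U : set T) (P : T -> Prop) (x : T) :
  open U -> U x -> (forall y, U y -> P y) -> \forall y \near x, P y.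
Proof. by move=> oU Ux H; apply: filterS H _; exact: open_nbhs_nbhs. Qed.

Lemma cvg0P (R : realType) (T : topologicalType) (q : T -> R) (x : T) :
  q y @[y --> x] --> (0 : R) <-> forall e, 0 < e -> \forall y \near x, `|q y| <= e.
Proof.
split=> [/cvgrPdist_le H e e0|H].
  by apply: filterS (H e e0) => y; rewrite sub0r normrN.
by apply/cvgrPdist_le => e e0; apply: filterS (H e e0) => y; rewrite sub0r normrN.
Qed.

Section SmoothFamilies.
Variables (R : realType) (n : nat).
Local Notation X := 'rV[R]_n.
Implicit Types (U V : set X) (x y : X) (i : 'I_n) (w : seq 'I_n).
Local Notation dir i := (delta_mx 0 i : X).

Lemma near_dir (P : X -> Prop) x (v : X) : (\forall y \near x, P y) ->
  \forall t \near (0 : R), P (x + (0 + t) *: v).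
Proof.
move=> H; have : (fun t : R => x + (0 + t) *: v) t @[t --> (0 : R)] --> x + (0 + 0) *: v.
  apply: cvgD; first exact: cvg_cst.
  by apply: cvgZ; [apply: cvgD; [exact: cvg_cst|exact: cvg_id]|exact: cvg_cst].
by rewrite [0 + 0]addr0 scale0r addr0; apply.
Qed.

Section Local.
Variable E : lcs R.
Implicit Types f g : X -> E.

(** The condition of [smooth_on] at one point, isolated because it depends only on the germ and can
    therefore be glued. *)
Definition smooth_at f x := dom (f x) /\
    forall w : seq 'I_n,
      (forall i, exists2 v : E, dom v &
         is_lderiv (fun t : R => pders w f (x + t *: delta_mx 0 i)) 0 v) /\
      (forall p, sn p -> p (pders w f y - pders w f x) @[y --> x] --> (0 : R)).

Lemma pders_near w f g x : (\forall y \near x, f y = g y) ->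
  \forall y \near x, pders w f y = pders w g y.
Proof.
move=> H; elim: w => //= i w IH.
move/nbhs_interior: IH; apply: filterS => y Hy; rewrite /pder.
apply: lderiv_near; exact: (near_dir (P := fun y => pders w f y = pders w g y)).
Qed.

Lemma smooth_at_near f g x : (\forall y \near x, f y = g y) ->
  smooth_at f x -> smooth_at g x.
Proof.
move=> H [d S]; split; first by rewrite -(nbhs_singleton H).
move=> w; have [D C] := S w; have Hw := pders_near w H; split.
  move=> i; have [v dv Dv] := D i; exists v => //.
  apply: is_lderiv_near Dv.
  exact: (near_dir (P := fun y => pders w f y = pders w g y) (dir i) Hw).
move=> p sp; apply: cvg_trans (C p sp); apply: (@near_eq_cvg _ _ (nbhs x) _).
have E0 : pders w f x = pders w g x := nbhs_singleton Hw.
by near=> y; rewrite E0 (near Hw y).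
Unshelve. all: by end_near.
Qed.

End Local.

Section Families.
Variables (E : lcs R) (gE : good E).
Implicit Types (f g : X -> E) (G : seq 'I_n -> X -> E).

(* Candidates [G w] for the iterated partial derivatives of [G [::]]. *)
Definition smfam U G := forall x, U x -> forall w, [/\ dom (G w x),
  forall i, is_lderiv (fun t : R => G w (x + t *: delta_mx 0 i)) 0 (G (i :: w) x) &
  forall p, sn p -> forall e, 0 < e -> \forall y \near x, p (G w y - G w x) <= e].

Lemma smfam_near_dom U G x w i : open U -> smfam U G -> U x ->
  \forall t \near (0 : R), dom (G w (x + (0 + t) *: dir i)).
Proof.
move=> oU H Ux; apply: (near_dir (P := fun y => dom (G w y))).
by apply: near_open oU Ux _ => y Uy; have [] := H y Uy w.
Qed.

Lemma smfam_pders U G : open U -> smfam U G ->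
  forall w x, U x -> pders w (G [::]) x = G w x.
Proof.
move=> oU H; elim=> // i w IH x Ux /=.
transitivity (lderiv (fun t : R => G w (x + t *: dir i)) 0).
  apply: lderiv_near; apply: (near_dir (P := fun y => pders w (G [::]) y = G w y)).
  by apply: near_open oU Ux _ => y Uy; exact: IH.
have [_ D _] := H x Ux w.
apply: lderivE => //; first exact: (smfam_near_dom w i oU H Ux).
by have [] := H x Ux (i :: w).
Qed.

Lemma smfam_smooth_on U G : open U -> smfam U G -> smooth_on U (G [::]).
Proof.
move=> oU H x Ux; split; first by have [] := H x Ux [::].
move=> w; have [dx D C] := H x Ux w.
have N : \forall y \near x, U y by exact: open_nbhs_nbhs.
split.
  move=> i; exists (G (i :: w) x); first by have [] := H x Ux (i :: w).
  apply: is_lderiv_near (D i).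
  apply: (near_dir (P := fun y => G w y = pders w (G [::]) y)).
  by near=> y; have Uy : U y by [near: y]; rewrite (smfam_pders oU H).
move=> p sp; apply/cvg0P => e e0.
near=> y; have Uy : U y by near: y.
rewrite !(smfam_pders oU H)// ger0_norm.
  by near: y; exact: C.
by apply: (sn_ge0 gE) => //; have [dy _ _] := H y Uy w; solve_dom.
Unshelve. all: by end_near. Qed.

(** The derivatives that [smooth_on] asserts to exist are the ones chosen by [lderiv], so [pders] is
    itself a family of candidates. *)
Lemma smooth_on_smfam U f : open U -> smooth_on U f -> smfam U (fun w => pders w f).
Proof.
move=> oU H.
have dw w x : U x -> dom (pders w f x).
  case: w => [|i w] Ux; first exact: (H x Ux).1.
  have [D _] := (H x Ux).2 w; have [v dv Dv] := D i.
  rewrite /= /pder /lderiv.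
  by have [] := @xgetPex _ (0 : E) [set v | dom v /\ is_lderiv (fun t : R =>
    pders w f (x + t *: delta_mx 0 i)) 0 v] (ex_intro _ v (conj dv Dv)).
move=> x Ux w; have [D C] := (H x Ux).2 w; split; first exact: dw.
  move=> i; have [v dv Dv] := D i; rewrite /= /pder.
  rewrite (lderivE gE _ dv Dv)//.
  apply: (near_dir (P := fun y => dom (pders w f y))).
  by apply: near_open oU Ux _ => y; exact: dw.
move=> p sp e e0; have /cvg0P/(_ e e0) := C p sp => K.
by near=> y; apply: le_trans (ler_norm _) _; near: y.
Unshelve. all: by end_near.
Qed.

Lemma smfam_lin U (a : R[i]) G G' : open U -> smfam U G -> smfam U G' ->
  smfam U (fun w x => a *: G w x + G' w x).
Proof.
move=> oU H H' x Ux w; have [d D C] := H x Ux w; have [d' D' C'] := H' x Ux w.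
have N : \forall y \near x, U y by exact: open_nbhs_nbhs.
split; first exact: goodP.
  move=> i; apply: is_lderivP_lin => //; try exact: (smfam_near_dom w i oU _ Ux).
    by have [] := H x Ux (i :: w).
  by have [] := H' x Ux (i :: w).
move=> p sp e e0; have na := normc_ge0 a.
have e1 : 0 < e / 2 / (1 + Normc.normc a) by rewrite !divr_gt0// ltr_pwDl.
have e2 : 0 < e / 2 by rewrite divr_gt0.
near=> y; have Uy : U y by near: y.
have [dy _ _] := H y Uy w; have [dy' _ _] := H' y Uy w.
have A : p (G w y - G w x) <= e / 2 / (1 + Normc.normc a) by near: y; exact: C.
have B : p (G' w y - G' w x) <= e / 2 by near: y; exact: C'.
rewrite opprD addrACA -scalerBr.
apply: le_trans (good_le gE sp _ _) _; try by solve_dom.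
rewrite (goodZ gE)//; last by solve_dom.
move: A; rewrite ler_pdivlMr ?ltr_pwDl// => A.
have := sn_ge0 gE sp (domB gE dy d); lra.
Unshelve. all: by end_near. Qed.

Lemma smfam0 U : smfam U (fun _ _ => 0).
Proof.
move=> x Ux w; split; [exact: good0|by move=> i; exact: is_lderiv_cst|].
by move=> p sp e e0; near=> y; rewrite subrr (sn0 gE)// ltW.
Unshelve. all: by end_near. Qed.

End Families.

Lemma is_lderiv_sum (E : lcs R) (gE : good E) (T : Type) (s : seq T) (c : T -> R -> E)
    (v : T -> E) t :
  (forall z, \forall h \near (0 : R), dom (c z (t + h))) -> (forall z, dom (v z)) ->
  (forall z, is_lderiv (c z) t (v z)) ->
  is_lderiv (fun u => \sum_(z <- s) c z u) t (\sum_(z <- s) v z).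
Proof.
move=> dc dv D; have dn : forall s', \forall h \near (0 : R), dom (\sum_(z <- s') c z (t + h)).
  elim=> [|z s' IH]; first by apply: near0W => h; rewrite big_nil; exact: good0.
  by near=> h; rewrite big_cons; apply: (domD gE); [near: h; exact: dc|near: h; exact: IH].
elim: s => [|z s IH].
  rewrite big_nil (_ : (fun u => _) = fun=> 0); first exact: is_lderiv_cst.
  by apply/funext => u; rewrite big_nil.
rewrite big_cons -[v z]scale1r (_ : (fun u => _) = fun u => 1 *: c z u + \sum_(z <- s) c z u).
  by apply: is_lderivP_lin => //; apply: (dom_sum gE).
by apply/funext => u; rewrite big_cons scale1r.
Unshelve. all: by end_near. Qed.

Lemma smfam_one U : smfam U (fun w (_ : X) => (if w is [::] then 1 else 0) : Clcs R).
Proof.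
move=> y _ w; split=> //; first by move=> j; exact: is_lderiv_cst (good_Clcs R) _ _.
by move=> p /= -> e e0; near=> z; rewrite subrr Normc.normc0 ltW.
Unshelve. all: by end_near. Qed.

Section Bilinear.
Variables (E F H : lcs R) (gE : good E) (gF : good F) (gH : good H).
Variables (mu : E -> F -> H) (bmu : bilin mu).

(** The recursion of [splits] mirrors the product rule: a new direction goes to the left or to the
    right factor. *)
Lemma smfam_bil U G1 G2 : open U -> smfam U G1 -> smfam U G2 ->
  smfam U (fun w x => \sum_(z <- splits w) mu (G1 z.1 x) (G2 z.2 x)).
Proof.
move=> oU H1 H2 x Ux w.
have N : \forall y \near x, U y by exact: open_nbhs_nbhs.
have d1 w' y : U y -> dom (G1 w' y) by move=> Uy; have [] := H1 y Uy w'.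
have d2 w' y : U y -> dom (G2 w' y) by move=> Uy; have [] := H2 y Uy w'.
have dmu w1 w2 y : U y -> dom (mu (G1 w1 y) (G2 w2 y)).
  by move=> Uy; apply: (bil_dom bmu); [exact: d1|exact: d2].
split.
- by apply: (dom_sum gH) => z; exact: dmu.
- move=> i; rewrite /= big_cat /= !big_map -big_split /=.
  apply: (is_lderiv_sum gH) => z.
  + apply: (near_dir (P := fun y => dom (mu (G1 z.1 y) (G2 z.2 y)))).
    by apply: near_open oU Ux _ => y; exact: dmu.
  + by apply: (domD gH); exact: dmu.
  + have [_ D1 _] := H1 x Ux z.1; have [_ D2 _] := H2 x Ux z.2.
    have := is_lderiv_bil gE gF gH bmu (smfam_near_dom z.1 i oU H1 Ux)
      (smfam_near_dom z.2 i oU H2 Ux) (d1 (i :: z.1) x Ux) (d2 (i :: z.2) x Ux) (D1 i) (D2 i).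
    by rewrite scale0r addr0.
- move=> p sp.
  elim: (splits w) => [|z s IH] e e0.
    by near=> y; rewrite !big_nil subrr (sn0 gH)// ltW.
  have [q1 [q2 [C [s1 s2 C0 Hb]]]] := bil_le bmu sp.
  have [_ _ C1] := H1 x Ux z.1; have [_ _ C2] := H2 x Ux z.2.
  have e2 : 0 < e / 2 by rewrite divr_gt0.
  have g1 := d1 z.1 x Ux; have g2 := d2 z.2 x Ux.
  have n1 := sn_ge0 gE s1 g1; have n2 := sn_ge0 gF s2 g2.
  pose M := (1 + C) * (1 + q2 (G2 z.2 x) + q1 (G1 z.1 x)).
  have M0 : 0 < M by apply: mulr_gt0; lra.
  have eM : 0 < e / 2 / M by rewrite divr_gt0.
  near=> y; have Uy : U y by near: y.
  have g1' := d1 z.1 y Uy; have g2' := d2 z.2 y Uy.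
  have A1 : q1 (G1 z.1 y - G1 z.1 x) <= e / 2 / M by near: y; exact: C1.
  have A2 : q2 (G2 z.2 y - G2 z.2 x) <= e / 2 / M by near: y; exact: C2.
  have A3 : q2 (G2 z.2 y - G2 z.2 x) <= 1 by near: y; exact: C2.
  have A4 : p (\sum_(j <- s) mu (G1 j.1 y) (G2 j.2 y) -
     \sum_(j <- s) mu (G1 j.1 x) (G2 j.2 x)) <= e / 2 by near: y; exact: IH.
  rewrite !big_cons opprD addrACA.
  have ds v : U v -> dom (\sum_(j <- s) mu (G1 j.1 v) (G2 j.2 v)).
    by move=> Uv; apply: (dom_sum gH) => j; exact: dmu.
  have dsx := ds x Ux; have dsy := ds y Uy; have dm1 := dmu z.1 z.2 x Ux; have dm2 := dmu z.1 z.2 y Uy.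
  apply: le_trans (good_le gH sp _ _) _; try by solve_dom.
  have db1 : dom (G1 z.1 y - G1 z.1 x) by solve_dom.
  have db2 : dom (G2 z.2 y - G2 z.2 x) by solve_dom.
  have -> : mu (G1 z.1 y) (G2 z.2 y) - mu (G1 z.1 x) (G2 z.2 x) =
     mu (G1 z.1 y - G1 z.1 x) (G2 z.2 y) + mu (G1 z.1 x) (G2 z.2 y - G2 z.2 x).
    by rewrite (bilBl bmu)// (bilBr bmu)// addrA subrK.
  have B1 := Hb _ _ db1 g2'; have B2 := Hb _ _ g1 db2.
  have := good_le gH sp (bil_dom bmu db1 g2') (bil_dom bmu g1 db2).
  have n3 := sn_ge0 gE s1 db1; have n4 := sn_ge0 gF s2 g2'; have n5 := sn_ge0 gF s2 db2.
  have A5 : q2 (G2 z.2 y) <= 1 + q2 (G2 z.2 x) by have := sn_lower gF s2 g2' g2; lra.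
  have B3 : C * (q1 (G1 z.1 y - G1 z.1 x) * q2 (G2 z.2 y)) <=
     C * (e / 2 / M * (1 + q2 (G2 z.2 x))) by apply: ler_wpM2l => //; exact: ler_pM.
  have B4 : C * (q1 (G1 z.1 x) * q2 (G2 z.2 y - G2 z.2 x)) <= C * (q1 (G1 z.1 x) * (e / 2 / M)).
    by apply: ler_wpM2l => //; exact: ler_wpM2l.
  have EM : e / 2 / M * M = e / 2 by rewrite divfK// gt_eqF.
  have B5 : C * (e / 2 / M * (1 + q2 (G2 z.2 x))) + C * (q1 (G1 z.1 x) * (e / 2 / M)) <= e / 2.
    pose r := e / 2 / M; have r0 : 0 < r := eM.
    rewrite -[leRHS]EM -/r [in leRHS]/M.
    have -> : r * ((1 + C) * (1 + q2 (G2 z.2 x) + q1 (G1 z.1 x))) =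
      C * (r * (1 + q2 (G2 z.2 x))) + C * (q1 (G1 z.1 x) * r) +
      r * (1 + q2 (G2 z.2 x) + q1 (G1 z.1 x)) by ring.
    by rewrite lerDl; apply: mulr_ge0; lra.
  lra.
Unshelve. all: by end_near. Qed.

End Bilinear.
End SmoothFamilies.

Section SupLemmas.
Variable R : realType.

(** Nonnegativity of [M] covers the empty set, whose supremum is 0. *)
Lemma sup_le_bound (S : set R) (M : R) : 0 <= M -> (forall r, S r -> r <= M) -> sup S <= M.
Proof.
move=> M0 H; have [->|/set0P S0] := eqVneq S set0; first by rewrite sup0.
by apply: ge_sup.
Qed.

Lemma le_sup_bound (S : set R) (M r : R) : (forall r, S r -> r <= M) -> S r -> r <= sup S.
Proof. by move=> H Sr; apply: ub_le_sup => //; exists M. Qed.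

Lemma sup_bound_ge0 (S : set R) (M : R) : (forall r, S r -> r <= M) -> (forall r, S r -> 0 <= r) ->
  0 <= sup S.
Proof.
move=> H P; have [->|/set0P[r Sr]] := eqVneq S set0; first by rewrite sup0.
exact: le_trans (P r Sr) (le_sup_bound H Sr).
Qed.

End SupLemmas.

(** * Multi-indices as sorted words *)

Section Words.
Variable n : nat.

Definition word (a : multi n) : seq 'I_n := flatten [seq nseq (a i) i | i <- enum 'I_n].

Lemma count_word (a : multi n) i : count_mem i (word a) = a i.
Proof.
rewrite /word count_flatten -map_comp sumnE big_map big_enum /=.
rewrite (bigD1 i)//= count_nseq /= eqxx mul1n big1 ?addn0// => j ji.
by rewrite count_nseq /= (negbTE ji) mul0n.
Qed.

Lemma size_word (a : multi n) : size (word a) = mdeg a.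
Proof.
rewrite /word size_flatten /shape -map_comp sumnE big_map big_enum /=.
by apply: eq_bigr => i _; rewrite /= size_nseq.
Qed.

Let leo (i j : 'I_n) := (i <= j)%N.

Lemma sorted_word (a : multi n) : sorted leo (word a).
Proof.
have tr : transitive leo by move=> i j k; exact: leq_trans.
rewrite sorted_pairwise// /word.
have : pairwise leo (enum 'I_n).
  rewrite -sorted_pairwise//; have := iota_sorted 0 n; rewrite -val_enum_ord.
  by rewrite sorted_map.
elim: (enum _) => //= i s IH /andP[Hi Hs]; rewrite pairwise_cat IH// andbT; apply/andP; split.
  apply/allrelP => x y; rewrite mem_nseq => /andP[_ /eqP ->] /flattenP[t /mapP[j js ->]].
  by rewrite mem_nseq => /andP[_ /eqP ->]; exact: (allP Hi).
by elim: (a i) => //= k IHk; rewrite IHk andbT; apply/allP => x; rewrite mem_nseq => /andP[_ /eqP->]; exact: leqnn.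
Qed.

Lemma word_of_sorted (w : seq 'I_n) : sorted leo w -> w = word [ffun i => count_mem i w].
Proof.
move=> sw; apply: (@sorted_eq _ leo).
- by move=> i j k; exact: leq_trans.
- by move=> i j ij; apply: val_inj; apply/eqP; rewrite eqn_leq; exact: ij.
- exact: sw.
- exact: sorted_word.
- by apply/allP => i _ /=; rewrite count_word ffunE.
Qed.

Lemma splits_subseq (T : eqType) (w : seq T) z : z \in splits w ->
  subseq z.1 w /\ subseq z.2 w.
Proof.
elim: w z => [|i w IH] z /=; first by rewrite inE => /eqP ->.
rewrite mem_cat => /orP[] /mapP[z' /IH[s1 s2] ->]; split.
- by rewrite /= eqxx.
- exact: subseq_trans s2 (subseq_cons _ _).
- exact: subseq_trans s1 (subseq_cons _ _).
- by rewrite /= eqxx.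
Qed.

Lemma size_splits (T : Type) (w : seq T) : size (splits w) = (2 ^ size w)%N.
Proof. by elim: w => //= i w IH; rewrite size_cat !size_map IH expnS mul2n addnn. Qed.

(** The parts of a sorted word are subsequences, hence sorted, hence words of multi-indices. So the
    Leibniz terms of [mder] are again expressed through [mder], with no larger order. *)
Lemma splits_word (a : multi n) z : z \in splits (word a) ->
  exists b c : multi n, [/\ z.1 = word b, z.2 = word c, (mdeg b <= mdeg a)%N &
    (mdeg c <= mdeg a)%N].
Proof.
move=> /splits_subseq[s1 s2].
have tr : transitive leo by move=> i j k; exact: leq_trans.
have w1 := word_of_sorted (subseq_sorted tr s1 (sorted_word a)).
have w2 := word_of_sorted (subseq_sorted tr s2 (sorted_word a)).
exists [ffun i => count_mem i z.1], [ffun i => count_mem i z.2]; split => //.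
  by rewrite -!size_word -w1 size_subseq.
by rewrite -!size_word -w2 size_subseq.
Qed.

Definition multi0 : multi n := [ffun => 0%N].

Lemma mdeg0 : mdeg multi0 = 0%N.
Proof. by rewrite /mdeg big1// => i _; rewrite ffunE. Qed.

Lemma word0 : word multi0 = [::].
Proof. by apply: size0nil; rewrite size_word mdeg0. Qed.

End Words.

(** * Locally convex structure on spaces of smooth functions *)

Section CinfGood.
Variables (R : realType) (n : nat).
Local Notation X := 'rV[R]_n.
Implicit Types (U K : set X) (x y : X).

Lemma mderE (E : lcs R) (a : multi n) (f : X -> E) x : mder a f x = pders (word a) f x.
Proof. by []. Qed.

Lemma mder0 (E : lcs R) (f : X -> E) x : mder (multi0 n) f x = f x.
Proof. by rewrite mderE word0. Qed.

Lemma compactly_insideP K U : open U -> compactly_inside K U -> K `<=` U.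
Proof. by move=> /interior_id oU [_]; rewrite oU. Qed.

Section Gen.
Variables (E : lcs R) (gE : good E) (U : set X) (oU : open U).
Implicit Types f g : X -> E.

Lemma dom_pders f w x : smooth_on U f -> U x -> dom (pders w f x).
Proof. by move=> /(smooth_on_smfam gE oU) H Ux; have [] := H x Ux w. Qed.

Lemma dom_mder f a x : smooth_on U f -> U x -> dom (mder a f x).
Proof. exact: dom_pders. Qed.

(** The local bounds [p (pders w f x) + 1] given by continuity become uniform on [K] through the
    near-covering form of compactness. *)
Lemma pders_bounded f K p w : smooth_on U f -> compactly_inside K U -> sn p ->
  exists2 M, 0 <= M & forall x, K x -> p (pders w f x) <= M.
Proof.
move=> Sf KU sp; have [cK _] := KU; have KsU := compactly_insideP oU KU.
have SF := smooth_on_smfam gE oU Sf.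
move/compact_near_coveringP: cK => cK.
have := cK R (pinfty_nbhs R) (fun M x => p (pders w f x) <= M) _.
have H : forall x, K x -> \forall x' \near x & M \near pinfty_nbhs R, p (pders w f x') <= M.
  move=> x Kx; have Ux := KsU x Kx; have [dx _ C] := SF x Ux w.
  exists ([set y | U y /\ p (pders w f y - pders w f x) <= 1],
          [set M | p (pders w f x) + 1 <= M]).
    split => /=; last first.
      by exists (p (pders w f x) + 1); split; [exact: num_real|move=> M /ltW].
    by near=> y; split; near: y; [exact: open_nbhs_nbhs|exact: C].
  move=> [y M] /= [[Uy py] pM]; apply: le_trans pM.
  have dy := dom_pders w Sf Uy.
  by have := sn_lower gE sp dy dx; lra.
move=> /(_ _ H)[M [Mr HM]].
exists (Num.max 0 (M + 1)); first by rewrite le_max lexx.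
move=> x Kx; apply: (HM (Num.max 0 (M + 1))) => //.
by rewrite lt_max ltrDl ltr01 orbT.
Unshelve. all: by end_near. Qed.

Lemma mder_bounded f K p m : smooth_on U f -> compactly_inside K U -> sn p ->
  exists2 M, 0 <= M & forall x (a : multi n), K x -> (mdeg a <= m)%N -> p (mder a f x) <= M.
Proof.
move=> Sf KU sp.
have [N HN] := choice (fun w => (fun (H : exists2 M, _ & _) =>
  match H with ex_intro2 M A B => ex_intro (fun M => 0 <= M /\
   forall x, K x -> p (pders w f x) <= M) M (conj A B) end) (pders_bounded w Sf KU sp)).
(* There are finitely many words of length at most m; the sum of their bounds serves them all. *)
exists (\sum_(k < m.+1) \sum_(w : k.-tuple 'I_n) N w).
  by apply: sumr_ge0 => k _; apply: sumr_ge0 => w _; exact: (HN w).1.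
move=> x a Kx am; apply: (le_trans ((HN (word a)).2 x Kx)).
have sa : (mdeg a < m.+1)%N by [].
have szw : size (word a) == Ordinal sa by rewrite size_word.
rewrite (bigD1 (Ordinal sa))//= (bigD1 (Tuple szw))//= -addrA lerDl.
apply: addr_ge0; apply: sumr_ge0 => k _; first exact: (HN _).1.
by apply: sumr_ge0 => w _; exact: (HN w).1.
Qed.

Lemma sup_der_ge f K p m x (a : multi n) : smooth_on U f -> compactly_inside K U -> sn p ->
  K x -> (mdeg a <= m)%N -> p (mder a f x) <= sup_der p K m f.
Proof.
move=> Sf KU sp Kx am; have [M M0 H] := mder_bounded m Sf KU sp.
by apply: (@le_sup_bound _ _ M) => [r [[y b] /= [Ky bm] <-]|]; [exact: H|exists (x, a)].
Qed.

Lemma sup_der_le f K p m (M : R) : 0 <= M ->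
  (forall x (a : multi n), K x -> (mdeg a <= m)%N -> p (mder a f x) <= M) ->
  sup_der p K m f <= M.
Proof. by move=> M0 H; apply: sup_le_bound => // r [[y b] /= [Ky bm] <-]; exact: H. Qed.

Lemma sup_der_ge0 f K p m : smooth_on U f -> compactly_inside K U -> sn p ->
  0 <= sup_der p K m f.
Proof.
move=> Sf KU sp; have [M M0 H] := mder_bounded m Sf KU sp.
apply: (@sup_bound_ge0 _ _ M) => r [[y b] /= [Ky bm] <-]; first exact: H.
by apply: sn_ge0 => //; apply: dom_mder => //; exact: (compactly_insideP oU KU).
Qed.

Lemma smooth_on_lin f g (a : R[i]) : smooth_on U f -> smooth_on U g ->
  smooth_on U (a *: (f : X -> E) + g).
Proof.
move=> /(smooth_on_smfam gE oU) Hf /(smooth_on_smfam gE oU) Hg.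
exact: (smfam_smooth_on gE oU (smfam_lin gE a oU Hf Hg)).
Qed.

Lemma pders_lin f g (a : R[i]) w x : smooth_on U f -> smooth_on U g -> U x ->
  pders w (a *: (f : X -> E) + g) x = a *: pders w f x + pders w g x.
Proof.
move=> /(smooth_on_smfam gE oU) Hf /(smooth_on_smfam gE oU) Hg Ux.
exact: (smfam_pders gE oU (smfam_lin gE a oU Hf Hg)).
Qed.

Lemma smooth_on0 : smooth_on U (0 : X -> E).
Proof. exact: (smfam_smooth_on gE oU (smfam0 gE (U := U))). Qed.

Lemma pders0 w x : U x -> pders w (0 : X -> E) x = 0.
Proof. by move=> Ux; exact: (smfam_pders gE oU (smfam0 gE (U := U))). Qed.

Lemma pdersZ f (a : R[i]) w x : smooth_on U f -> U x ->
  pders w (a *: (f : X -> E)) x = a *: pders w f x.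
Proof.
move=> Sf Ux; rewrite -[a *: f]addr0 pders_lin//; last exact: smooth_on0.
by rewrite pders0// addr0.
Qed.

Lemma good_Cinf : good (Cinf U E).
Proof.
(* This inequality, applied to the inverse scalar as well, yields the homogeneity. *)
have Zle p (K : set X) m (a : R[i]) f : smooth_on U f -> compactly_inside K U -> sn p ->
    sup_der p K m (a *: (f : X -> E)) <= Normc.normc a * sup_der p K m f.
  move=> Sf KU sp; apply: sup_der_le.
    by rewrite mulr_ge0 ?normc_ge0// sup_der_ge0.
  move=> x b Kx bm; have Ux := compactly_insideP oU KU Kx.
  rewrite mderE pdersZ// (goodZ gE)//; last exact: dom_pders.
  by apply: ler_wpM2l; [exact: normc_ge0|exact: sup_der_ge].
split.
- by split; [exact: smooth_on0|].
- move=> a f g [Sf f0] [Sg g0]; split; first exact: smooth_on_lin.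
  by move=> x Ux; rewrite !fctE f0// g0// scaler0 addr0.
- move=> _ [K [m [p [KU sp ->]]]] f g [Sf f0] [Sg g0].
  apply: sup_der_le; first by apply: addr_ge0; exact: sup_der_ge0.
  move=> x a Kx am; have Ux := compactly_insideP oU KU Kx.
  have -> : mder a (f + g) x = pders (word a) f x + pders (word a) g x.
    by rewrite -[f in f + g]scale1r mderE pders_lin// scale1r.
  apply: le_trans (good_le gE sp (dom_pders _ Sf Ux) (dom_pders _ Sg Ux)) _.
  by apply: lerD; exact: sup_der_ge.
- move=> _ [K [m [p [KU sp ->]]]] a f [Sf f0].
  have [->|a0] := eqVneq a 0.
    rewrite Normc.normc0 mul0r; apply/eqP; rewrite eq_le scale0r; apply/andP; split.
      by apply: sup_der_le => // x b Kx bm; rewrite mderE pders0 ?(sn0 gE)//; exact: (compactly_insideP oU KU).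
    by apply: sup_der_ge0 => //; exact: smooth_on0.
  apply/eqP; rewrite eq_le Zle//=.
  have na : Normc.normc a != 0 by apply: contra_neq a0; exact: Normc.eq0_normc.
  have na0 : 0 < Normc.normc a by rewrite lt_neqAle eq_sym na normc_ge0.
  have Saf : smooth_on U (a *: (f : X -> E)).
    by rewrite -[a *: f]addr0; apply: smooth_on_lin => //; exact: smooth_on0.
  have := Zle p K m a^-1 _ Saf KU sp; rewrite scalerA mulVf// scale1r.
  by rewrite Normc.normcV mulrC ler_pdivlMr// mulrC.
- move=> f [Sf f0] H; apply/funext => x; have [Ux|Ux] := pselect (U x); last exact: f0.
  apply: (good_sep gE); first exact: (Sf x Ux).1.
  (* Separation: a single point is compact, and the seminorm of order 0 over it is [p] of the
     value. *)
  move=> p sp; have KU : compactly_inside [set x] U.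
    by split; [exact: compact_set1|move=> y ->; rewrite ((interior_id U).1 oU)].
  have := H _ (ex_intro _ [set x] (ex_intro _ 0%N (ex_intro _ p (And3 KU sp erefl)))) => H0.
  apply/eqP; rewrite eq_le (sn_ge0 gE)//; last exact: (Sf x Ux).1.
  rewrite andbT -H0 -[f x in leLHS]mder0.
  by apply: sup_der_ge => //; rewrite mdeg0.
Qed.

End Gen.
End CinfGood.

(** * Leibniz rule *)

Section Leibniz.
Variables (R : realType) (E F : lcs R) (gE : good E) (gF : good F).

Lemma dom_sum_seq (T : eqType) (s : seq T) (G : T -> F) :
  (forall z, z \in s -> dom (G z)) -> dom (\sum_(z <- s) G z).
Proof.
move=> H; rewrite (eq_big_seq (fun z => if z \in s then G z else 0)) => [|z ->//].
by apply: dom_sum => // z; case: ifP => [/H//|_]; exact: good0.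
Qed.

Lemma is_lderiv_sum_seq (T : eqType) (s : seq T) (c : T -> R -> F) (v : T -> F) t :
  (forall z, z \in s -> forall h, dom (c z h)) -> (forall z, z \in s -> dom (v z)) ->
  (forall z, z \in s -> is_lderiv (c z) t (v z)) ->
  is_lderiv (fun u => \sum_(z <- s) c z u) t (\sum_(z <- s) v z).
Proof.
move=> dc dv D.
rewrite (eq_big_seq (fun z => if z \in s then v z else 0)) => [|z ->//].
rewrite (_ : (fun u => _) = fun u => \sum_(z <- s) if z \in s then c z u else 0); last first.
  by apply/funext => u; apply: eq_big_seq => z ->.
apply: (is_lderiv_sum gF) => z; case: (boolP (z \in s)) => [zs|_].
- by apply: near0W => h; exact: dc.
- by apply: near0W => h; exact: good0.
- exact: dv.
- exact: good0.
- exact: D.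
- exact: is_lderiv_cst.
Qed.

Lemma splits_mem (T : eqType) (w : seq T) z v : z \in splits w ->
  (v \in z.1 -> v \in w) /\ (v \in z.2 -> v \in w).
Proof. by move=> /splits_subseq[s1 s2]; split; apply: mem_subseq. Qed.

Variables (mu : F -> F -> F) (bmu : bilin mu).

Lemma smooth_map_bil (f g : E -> F) : smooth_map f -> smooth_map g ->
  smooth_map (fun x => mu (f x) (g x)).
Proof.
move=> [df Sf] [dg Sg]; split=> [x dx|c Sc]; first by apply: (bil_dom bmu); [exact: df|exact: dg].
by apply: (smooth_bil gF gF gF bmu); [exact: Sf|exact: Sg].
Qed.

(** [kdiff_is_lderiv] provides a true derivative for each factor of each term; only then does the
    choice made by [kdiff] turn into the sum. *)
Lemma kdiff_bil (f g : E -> F) vs x : smooth_map f -> smooth_map g ->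
  (forall v, v \in vs -> dom v) -> dom x ->
  kdiff (fun x => mu (f x) (g x)) vs x =
  \sum_(z <- splits vs) mu (kdiff f z.1 x) (kdiff g z.2 x).
Proof.
move=> Sf Sg; elim: vs x => [|v vs IH] x H dx; first by rewrite big_seq1.
have dv : dom v by apply: H; exact: mem_head.
have {}IH y : dom y -> kdiff (fun x => mu (f x) (g x)) vs y =
    \sum_(z <- splits vs) mu (kdiff f z.1 y) (kdiff g z.2 y).
  by apply: IH => w wv; apply: H; rewrite in_cons wv orbT.
have dl t : dom (x + t%:C *: v) by solve_dom.
have x0 : x + 0%:C *: v = x by rewrite scale0r addr0.
have Hz z : z \in splits vs -> (forall w, w \in v :: z.1 -> dom w) /\
    (forall w, w \in v :: z.2 -> dom w).
  move=> zs; split=> w; rewrite in_cons => /orP[/eqP->//|wz];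
    apply: H; rewrite in_cons; apply/orP; right; have [A B] := splits_mem w zs;
    by [apply: A|apply: B].
have tl (z : seq E) : (forall w, w \in v :: z -> dom w) -> forall w, w \in z -> dom w.
  by move=> K w wz; apply: K; rewrite in_cons wz orbT.
have dk1 z y : z \in splits vs -> dom y -> dom (kdiff f z.1 y).
  by move=> /Hz[/tl K _] dy; exact: dom_kdiff.
have dk2 z y : z \in splits vs -> dom y -> dom (kdiff g z.2 y).
  by move=> /Hz[_ /tl K] dy; exact: dom_kdiff.
have dk1' z y : z \in splits vs -> dom y -> dom (kdiff f (v :: z.1) y).
  by move=> /Hz[K _] dy; exact: dom_kdiff.
have dk2' z y : z \in splits vs -> dom y -> dom (kdiff g (v :: z.2) y).
  by move=> /Hz[_ K] dy; exact: dom_kdiff.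
have bd := bil_dom bmu.
transitivity (lderiv (fun t : R => \sum_(z <- splits vs)
    mu (kdiff f z.1 (x + t%:C *: v)) (kdiff g z.2 (x + t%:C *: v))) 0).
  by rewrite /=; congr (lderiv _ 0); apply/funext => t; exact: IH.
rewrite [splits (v :: vs)]/= big_cat /= !big_map -big_split /=.
apply: (lderivE gF).
- apply: near0W => h; apply: dom_sum_seq => z zs; apply: bd; [exact: dk1|exact: dk2].
- by apply: dom_sum_seq => z zs; apply: (domD gF); apply: bd;
    [exact: dk1'|exact: dk2|exact: dk1|exact: dk2'].
apply: is_lderiv_sum_seq => z zs.
- by move=> h; apply: bd; [exact: dk1|exact: dk2].
- by apply: (domD gF); apply: bd; [exact: dk1'|exact: dk2|exact: dk1|exact: dk2'].
have := is_lderiv_bil gF gF gF bmu (near0W (fun h => dk1 z _ zs (dl (0 + h))))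
  (near0W (fun h => dk2 z _ zs (dl (0 + h)))) (dk1' z x zs dx) (dk2' z x zs dx)
  (kdiff_is_lderiv gE gF Sf (Hz z zs).1 dx) (kdiff_is_lderiv gE gF Sg (Hz z zs).2 dx).
by rewrite x0.
Qed.

Lemma smooth_map_lin (a : R[i]) (f g : E -> F) : smooth_map f -> smooth_map g ->
  smooth_map (fun x => a *: f x + g x).
Proof.
move=> [df Sf] [dg Sg]; split=> [x dx|c Sc]; first by apply: (goodP gF); [exact: df|exact: dg].
by apply: (smooth_lin gF); [exact: Sf|exact: Sg].
Qed.

Lemma kdiff_lin (a : R[i]) (f g : E -> F) vs x : smooth_map f -> smooth_map g ->
  (forall v, v \in vs -> dom v) -> dom x ->
  kdiff (fun x => a *: f x + g x) vs x = a *: kdiff f vs x + kdiff g vs x.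
Proof.
move=> Sf Sg; elim: vs x => [|v vs IH] x H dx //.
have dv : dom v by apply: H; exact: mem_head.
have tl w : w \in vs -> dom w by move=> wv; apply: H; rewrite in_cons wv orbT.
have dl t : dom (x + t%:C *: v) by solve_dom.
transitivity (lderiv (fun t : R =>
    a *: kdiff f vs (x + t%:C *: v) + kdiff g vs (x + t%:C *: v)) 0).
  by rewrite /=; congr (lderiv _ 0); apply/funext => t; apply: IH.
have d1 y : dom y -> dom (kdiff f vs y) by move=> dy; exact: dom_kdiff.
have d2 y : dom y -> dom (kdiff g vs y) by move=> dy; exact: dom_kdiff.
have d1' : dom (kdiff f (v :: vs) x) by exact: dom_kdiff.
have d2' : dom (kdiff g (v :: vs) x) by exact: dom_kdiff.
apply: (lderivE gF).
- by apply: near0W => h; apply: (goodP gF); [exact: d1|exact: d2].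
- exact: (goodP gF).
apply: is_lderivP_lin => //.
- by apply: near0W => h; exact: d1.
- by apply: near0W => h; exact: d2.
- exact: (kdiff_is_lderiv gE gF Sf).
- exact: (kdiff_is_lderiv gE gF Sg).
Qed.

End Leibniz.

Section KDiffMap.
Variables (R : realType) (E F E' F' : lcs R).
Variables (gE : good E) (gF : good F) (gE' : good E') (gF' : good F').

(** Linearity of [p] maps lines to lines, and linearity and continuity of [q] carry the derivative
    of [f] over to that of [g]. Applied to restrictions to a smaller open set. *)
Lemma kdiff_intertwine (p : E -> E') (q : F -> F') (f : E -> F) (g : E' -> F') vs x :
  (forall (a : R[i]) y z, p (a *: y + z) = a *: p y + p z) ->
  (forall (a : R[i]) y z, q (a *: y + z) = a *: q y + q z) ->
  (forall y, dom y -> dom (p y)) -> (forall y, dom y -> dom (q y)) ->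
  (forall r, sn r -> exists2 s, sn s & forall y, dom y -> r (q y) <= s y) ->
  (forall y, dom y -> q (f y) = g (p y)) ->
  smooth_map f -> (forall v, v \in vs -> dom v) -> dom x ->
  q (kdiff f vs x) = kdiff g [seq p v | v <- vs] (p x).
Proof.
move=> pl ql pd qd qc fg Sf; elim: vs x => [|v vs IH] x H dx; first exact: fg.
have dv : dom v by apply: H; exact: mem_head.
have tl w : w \in vs -> dom w by move=> wv; apply: H; rewrite in_cons wv orbT.
have dl t : dom (x + t%:C *: v) by solve_dom.
have d1 y : dom y -> dom (kdiff f vs y) by move=> dy; exact: dom_kdiff.
have d1' : dom (kdiff f (v :: vs) x) by exact: dom_kdiff.
transitivity (lderiv (fun t : R => q (kdiff f vs (x + t%:C *: v))) 0); last first.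
  rewrite /=; congr (lderiv _ 0); apply/funext => t; rewrite IH//; congr kdiff.
  by rewrite addrC pl addrC.
apply/esym/(lderivE gF').
- by apply: near0W => h; apply: qd; exact: d1.
- exact: qd.
apply/(is_lderivP gF').
- by apply: near0W => h; apply: qd; exact: d1.
- exact: qd.
move=> r sr e e0; have [s ss rs] := qc r sr.
have q0 : q 0 = 0 by have := ql (-1) 0 0; rewrite scaler0 addr0 scaleN1r => ->; rewrite addNr.
have qZ (a : R[i]) y : q (a *: y) = a *: q y by rewrite -[a *: y]addr0 ql q0 addr0.
have qB y z : q (y - z) = q y - q z by rewrite addrC -scaleN1r ql scaleN1r addrC.
have D := kdiff_is_lderiv gE gF Sf H dx.
have := (is_lderivP gF (near0W (fun h => d1 _ (dl (0 + h)))) d1').1 D s ss e e0.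
move=> K; near=> h; rewrite -qZ -!qB; apply: (le_trans (rs _ _)).
  have := d1 _ (dl (0 + h)); have := d1 _ (dl 0); move=> ? ?; by solve_dom.
by near: h.
Unshelve. all: by end_near. Qed.

End KDiffMap.

(** * Test functions and products of smooth functions *)

Section TestFunctions.
Variables (R : realType) (n : nat).
Local Notation X := 'rV[R]_n.
Local Notation C := R[i].
Implicit Types (U K L : set X) (x y : X) (f g : X -> C).

Lemma pders_eq0 (E : lcs R) (gE : good E) w (f : X -> E) x :
  (\forall y \near x, f y = 0) -> pders w f x = 0.
Proof.
move=> H; have -> : pders w f x = pders w (0 : X -> E) x.
  exact: (nbhs_singleton (pders_near w (g := (0 : X -> E)) H)).
exact: (pders0 gE openT).
Qed.

Lemma tsupportC f y : ~ tsupport f y -> f y = 0.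
Proof. by move=> H; apply/eqP/negPn/negP => fy; apply: H; exact: subset_closure. Qed.

Lemma near_tsupportC f y : ~ tsupport f y -> \forall z \near y, f z = 0.
Proof.
move=> H; apply: (@near_open _ (~` tsupport f)) => // [|z]; last exact: tsupportC.
by apply: closed_openC; exact: closed_closure.
Qed.

Lemma tsupport_sub (f : X -> C) (A : set X) : closed A -> (forall y, ~ A y -> f y = 0) ->
  tsupport f `<=` A.
Proof.
move=> cA H; rewrite ((closure_id A).1 cA); apply: closureS => y /= fy.
by apply: contrapT => nA; move: fy; rewrite H// eqxx.
Qed.

Lemma tsupport_lin (a : C) f g : tsupport (a *: (f : X -> C^o) + g) `<=` tsupport f `|` tsupport g.
Proof.
apply: tsupport_sub; first by apply: closedU; exact: closed_closure.
move=> y H; rewrite !fctE !tsupportC ?scaler0 ?addr0// => ?; apply: H; [by right|by left].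
Qed.

Lemma norm_f_compact U K m f : open U -> compactly_inside K U -> smooth_on U (f : X -> Clcs R) ->
  forall x (a : multi n), K x -> (mdeg a <= m)%N ->
  Normc.normc (@mder R n (Clcs R) a f x) <= norm_f K m f.
Proof.
move=> oU KU Sf x a Kx am.
exact: (sup_der_ge (good_Clcs R) oU (p := fun z : R[i] => Normc.normc z)).
Qed.

Lemma norm_f_ge0 U K m f : open U -> compactly_inside K U -> smooth_on U (f : X -> Clcs R) ->
  0 <= norm_f K m f.
Proof. by move=> oU KU Sf; exact: (sup_der_ge0 (good_Clcs R) oU). Qed.

Lemma sn_norm_f U K m : compactly_inside K U -> @sn R (CinfC U) (norm_f K m).
Proof. by move=> KU; exists K, m, (fun z : C => Normc.normc z). Qed.

Variables (Omega : set X) (oO : open Omega).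

Lemma is_test_lin (a : C) f g : is_test Omega f -> is_test Omega g ->
  is_test Omega (a *: (f : X -> C^o) + g).
Proof.
move=> [df cf sf] [dg cg sg]; split.
- exact: (goodP (good_Cinf (good_Clcs R) oO)).
- apply: (subclosed_compact _ (compactU cf cg)); first exact: closed_closure.
  exact: tsupport_lin.
- by move=> y /tsupport_lin[/sf|/sg].
Qed.

Lemma is_test0 : is_test Omega (0 : X -> C).
Proof.
have E0 : tsupport (0 : X -> C) = set0.
  by apply/seteqP; split=> // y; apply: tsupport_sub => //; exact: closed0.
by split; [exact: (good0 (good_Cinf (good_Clcs R) oO))|rewrite E0; exact: compact0|rewrite E0].
Qed.

(** Derivatives vanish off the support, so values on [L] are bounded by those on a set [K]
    containing the support. In this way the y-derivatives in the seminorms are controlled by the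
    topology of D(Omega). *)
Lemma norm_f_test L l : compactly_inside L Omega -> test_seminorm Omega (norm_f L l).
Proof.
move=> LO; have gC := good_Cinf (good_Clcs R) oO.
have sC : @sn R (CinfC Omega) (norm_f L l) := sn_norm_f l LO.
split.
- by move=> f g [df _ _] [dg _ _]; exact: (good_le gC sC).
- by move=> a f [df _ _]; exact: (goodZ gC sC).
- move=> K KO; exists 1, l => f [[Sf _] _ _] fK; rewrite mul1r.
  apply: sup_der_le; first exact: norm_f_ge0 oO KO Sf.
  move=> x a Lx al; have [fx|fx] := pselect (tsupport f x).
    by apply: (norm_f_compact oO KO Sf) => //; exact: fK.
  rewrite mderE (pders_eq0 (good_Clcs R)); last exact: near_tsupportC.
  by rewrite Normc.normc0; exact: norm_f_ge0 oO KO Sf.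
Qed.

(** Evaluations separate test functions, and their continuity lets D(Omega)-valued derivatives be
    read off pointwise. *)
Lemma eval_test y : test_seminorm Omega (fun f => Normc.normc (f y)).
Proof.
split.
- by move=> f g _ _; exact: normcD.
- by move=> a f _; exact: Normc.normcM.
- move=> K KO; exists 1, 0%N => f [[Sf _] _ _] fK; rewrite mul1r.
  have [fy|fy] := pselect (tsupport f y).
    rewrite -[f y](mder0 (E := Clcs R)).
    by apply: (norm_f_compact oO KO Sf); [exact: fK|rewrite mdeg0].
  by rewrite tsupportC// Normc.normc0; exact: norm_f_ge0 oO KO Sf.
Qed.

Lemma good_Dtest : good (Dtest Omega).
Proof.
split.
- exact: is_test0.
- exact: is_test_lin.
- by move=> p [H _ _]; exact: H.
- by move=> p [_ H _]; exact: H.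
- move=> f _ H; apply/funext => y; apply: Normc.eq0_normc.
  exact: (H _ (eval_test y)).
Qed.

Lemma smooth_on_mul U (E : lcs R) (gE : good E) (f : X -> R[i]) (g : X -> E) : open U ->
  smooth_on U (f : X -> Clcs R) -> smooth_on U g ->
  smooth_on U (fun x => f x *: g x) /\ forall w x, U x ->
    pders w (fun x => f x *: g x) x =
    \sum_(z <- splits w) @pders R n (Clcs R) z.1 f x *: pders z.2 g x.
Proof.
move=> oU Sf Sg; have gC := good_Clcs R.
pose G w x : E := \sum_(z <- splits w) @pders R n (Clcs R) z.1 f x *: pders z.2 g x.
have S : smfam U G := smfam_bil gC gE gE (bilin_scale gE) oU (smooth_on_smfam gC oU Sf)
  (smooth_on_smfam gE oU Sg).
have G0 : G [::] = fun x => f x *: g x by apply/funext => x; rewrite /G big_seq1.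
rewrite -G0; split; first exact: smfam_smooth_on.
by move=> w x Ux; exact: (smfam_pders gE oU S).
Qed.

Lemma norm_f_mul U K m f g : open U -> compactly_inside K U ->
  smooth_on U (f : X -> Clcs R) -> smooth_on U (g : X -> Clcs R) ->
  norm_f K m (fun x => f x * g x) <= (2 ^ m)%:R * (norm_f K m f * norm_f K m g).
Proof.
move=> oU KU Sf Sg; have gC := good_Clcs R.
have nf := norm_f_ge0 m oU KU Sf; have ng := norm_f_ge0 m oU KU Sg.
have N0 : 0 <= norm_f K m f * norm_f K m g by rewrite mulr_ge0.
apply: sup_der_le; first by rewrite mulr_ge0.
move=> x a Kx am; have Ux := compactly_insideP oU KU Kx.
rewrite mderE (smooth_on_mul gC oU Sf Sg).2//.
(* All Leibniz terms have the same bound, and there are 2^(mdeg a) <= 2^m of them. *)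
apply: (@le_trans _ _ (\sum_(z <- splits (word a)) norm_f K m f * norm_f K m g)); last first.
  rewrite big_const_seq count_predT size_splits size_word iter_addr_0 -[leLHS]mulr_natl.
  by apply: ler_wpM2r => //; rewrite ler_nat leq_exp2l.
rewrite big_seq [leRHS]big_seq.
elim/big_ind2: _ => [|u v u' v' uv uv'|z zs].
- by rewrite Normc.normc0.
- by apply: le_trans (normcD _ _) _; exact: lerD.
have [b [c [-> -> ba ca]]] := splits_word zs.
rewrite Normc.normcM; apply: ler_pM; do ?exact: normc_ge0.
  by apply: (norm_f_compact oU KU Sf) => //; exact: leq_trans ba am.
by apply: (norm_f_compact oU KU Sg) => //; exact: leq_trans ca am.
Qed.

Lemma bilin_CinfC U : open U -> @bilin R (CinfC U) (CinfC U) (CinfC U) (fun f g x => f x * g x).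
Proof.
move=> oU; split.
- move=> f g [Sf f0] [Sg g0]; split; first exact: (smooth_on_mul (good_Clcs R) oU Sf Sg).1.
  by move=> x Ux; rewrite f0// mul0r.
- move=> a f f' g _ _ _; apply/funext => x.
  by change ((a * f x + f' x) * g x = a * (f x * g x) + f' x * g x); ring.
- move=> a f g g' _ _ _; apply/funext => x.
  by change (f x * (a * g x + g' x) = a * (f x * g x) + f x * g' x); ring.
move=> _ [K [m [p [KU -> ->]]]].
have s1 := sn_norm_f m KU.
exists (norm_f K m), (norm_f K m), (2 ^ m)%:R; split=> // f g [Sf f0] [Sg g0].
exact: (norm_f_mul m oU KU Sf Sg).
Qed.

End TestFunctions.

(** * Localization *)

Section Localization.
Variables (R : realType) (n : nat).
Local Notation X := 'rV[R]_n.
Local Notation C := R[i].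
Implicit Types (U V W K L : set X) (x y : X).

Lemma restr_in V (T : nmodType) (f : X -> T) x : V x -> restr V f x = f x.
Proof. by move=> Vx; rewrite /restr patchT// inE. Qed.

Lemma restr_out V (T : nmodType) (f : X -> T) x : ~ V x -> restr V f x = 0.
Proof. by move=> Vx; rewrite /restr patchC// inE. Qed.

Lemma restr_lin V (E : lmodType C) (a : C) (f g : X -> E) :
  restr V (a *: f + g) = a *: (restr V f : X -> E) + restr V g.
Proof.
apply/funext => x; rewrite !fctE; have [Vx|Vx] := pselect (V x).
  by rewrite !restr_in.
by rewrite !restr_out// scaler0 addr0.
Qed.

Lemma near_restr V (T : nmodType) (f : X -> T) x : open V -> V x ->
  \forall y \near x, f y = restr V f y.
Proof. by move=> oV Vx; apply: near_open oV Vx _ => y Vy; rewrite restr_in. Qed.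

Lemma mder_near (E : lcs R) (a : multi n) (f g : X -> E) x :
  (\forall y \near x, f y = g y) -> mder a f x = mder a g x.
Proof. by move=> H; exact: (nbhs_singleton (pders_near (word a) H)). Qed.

Lemma mder_restr (E : lcs R) V (a : multi n) (f : X -> E) x : open V -> V x ->
  mder a (restr V f) x = mder a f x.
Proof. by move=> oV Vx; apply/esym/mder_near; exact: near_restr. Qed.

Lemma sup_der_congr (E : lcs R) p K m (f g : X -> E) :
  (forall x (a : multi n), K x -> mder a f x = mder a g x) -> sup_der p K m f = sup_der p K m g.
Proof.
move=> H; rewrite /sup_der; congr sup; apply/seteqP.
by split=> r [[x a] /= [Kx am] <-]; exists (x, a); rewrite //= H.
Qed.

Lemma dom_restr (E : lcs R) U V (f : X -> E) : open V -> V `<=` U ->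
  @dom R (Cinf U E) f -> @dom R (Cinf V E) (restr V f).
Proof.
move=> oV VU [Sf f0]; split; last by move=> x Vx; rewrite restr_out.
by move=> x Vx; apply: smooth_at_near (Sf x (VU x Vx)); exact: near_restr.
Qed.

Lemma compactly_insideS K U V : open V -> V `<=` U -> compactly_inside K V -> compactly_inside K U.
Proof.
move=> /interior_id oV VU [cK KV]; split=> // x /KV; exact: (interiorS VU).
Qed.

Variables (Omega : set X) (oO : open Omega).

Lemma good_CinfD U : open U -> good (CinfD Omega U).
Proof. by move=> oU; apply: good_Cinf => //; exact: good_Dtest. Qed.

Lemma good_CinfC U : open U -> good (CinfC U).
Proof. by move=> oU; apply: good_Cinf => //; exact: good_Clcs. Qed.

(** The sheaf property passes to all differentials, by [kdiff_intertwine] for the restriction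
    maps. *)
Lemma kdiff_restr (S : sheaf_family R n) U V vs phi : basic_space Omega S ->
  open U -> U `<=` Omega -> open V -> V `<=` U ->
  (forall v, v \in vs -> @dom R (CinfD Omega U) v) -> @dom R (CinfD Omega U) phi ->
  restr V (@kdiff R (CinfD Omega U) (CinfC U) (S U) vs phi) =
  @kdiff R (CinfD Omega V) (CinfC V) (S V) [seq restr V v | v <- vs] (restr V phi).
Proof.
move=> BS oU UO oV VU dvs dphi; have [SU sheaf] := BS U oU UO.
apply: (@kdiff_intertwine R (CinfD Omega U) (CinfC U) (CinfD Omega V) (CinfC V)
  (good_CinfD oU) (good_CinfC oU) (good_CinfC oV)
  (@restr R n V _) (@restr R n V _)) => //.
- by move=> a f g; exact: (@restr_lin V (Dtest Omega)).
- by move=> a f g; exact: (@restr_lin V (Clcs R)).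
- by move=> f; exact: dom_restr.
- by move=> f; exact: dom_restr.
- move=> _ [K [m [p [KV sp ->]]]]; exists (@sup_der R n (Clcs R) p K m).
    by exists K, m, p; split => //; exact: compactly_insideS KV.
  move=> f df; rewrite (@sup_der_congr (Clcs R) p K m (restr V f) f)//.
  by move=> x a Kx; apply: mder_restr => //; exact: (compactly_insideP oV KV).
- by move=> f df; exact: sheaf.
Qed.

End Localization.

(** * Open cubes and cut-off functions *)

Section Cutoff.
Variables (R : realType) (n : nat).
Local Notation X := 'rV[R]_n.
Implicit Types (x y : X).

Definition box x (r : R) : set X := [set y | forall i, `|y ord0 i - x ord0 i| < r].

Lemma near_coord y (i : 'I_n) (P : R -> Prop) : (\forall t \near y ord0 i, P t) ->
  \forall y' \near y, P ((y' : X) ord0 i).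
Proof.
move=> /nbhs_ballP[e e0 eP]; apply/nbhs_ballP; exists e => // z yz.
by apply: eP; exact: (yz.2 ord0 i).
Qed.

Lemma open_box x r : open (box x r).
Proof.
rewrite openE => y yb; rewrite /interior.
apply: (@filter_forall _ _ (fun i (y' : X) => `|y' ord0 i - x ord0 i| < r) (nbhs y) _) => i.
apply: (near_coord (P := fun t => `|t - x ord0 i| < r)).
have := yb i; rewrite -subr_gt0 => ri.
apply/nbhs_ballP; exists (r - `|y ord0 i - x ord0 i|) => // t.
rewrite /ball /= distrC => ti; have -> : t - x ord0 i = (t - y ord0 i) + (y ord0 i - x ord0 i).
  by rewrite addrA subrK.
by apply: le_lt_trans (ler_normD _ _) _; lra.
Qed.

Lemma box_center x r : 0 < r -> box x r x.
Proof. by move=> r0 i; rewrite subrr normr0. Qed.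

Lemma box_sub (U : set X) x : open U -> U x -> exists2 r, 0 < r & box x r `<=` U.
Proof.
move=> oU Ux; have /nbhs_ballP[r r0 rU] := open_nbhs_nbhs (conj oU Ux).
exists r => // y yr; apply: rU; split=> // i j; rewrite (ord1 i) /ball /= distrC.
exact: yr.
Qed.

(** By compactness each coordinate bound holds for all radii close enough to [r] from below, and
    finitely many coordinates share one such radius. The gap between [r1] and [r] leaves room for a
    cut-off. *)
Lemma compact_box (K : set X) x r : 0 < r -> compact K -> K `<=` box x r ->
  exists r1, [/\ 0 <= r1, r1 < r & forall y, K y -> forall i, `|y ord0 i - x ord0 i| <= r1].
Proof.
move=> r0 /compact_near_coveringP cK Kr.
have H (i : 'I_n) : \forall s \near r^'-, K `<=` (fun y => `|y ord0 i - x ord0 i| < s).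
  apply: (cK R (r^'-) (fun s y => `|y ord0 i - x ord0 i| < s)) => y Ky.
  have yr := Kr y Ky i; set d := `|y ord0 i - x ord0 i| in yr.
  exists ([set y' : X | `|y' ord0 i - x ord0 i| < (d + r) / 2], [set s | (d + r) / 2 < s]).
    split=> /=.
      apply: (near_coord (P := fun t => `|t - x ord0 i| < (d + r) / 2)).
      apply/nbhs_ballP; exists ((r - d) / 2) => /=; first by rewrite divr_gt0// subr_gt0.
      move=> t; rewrite /ball /= distrC => ti.
      have -> : t - x ord0 i = (t - y ord0 i) + (y ord0 i - x ord0 i) by rewrite addrA subrK.
      by apply: le_lt_trans (ler_normD _ _) _; rewrite -/d; lra.
    by apply: nbhs_left_gt; lra.
  by move=> [y' s] /= [A B]; exact: lt_trans A B.
have /filter_forall A := H.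
have [r1 /= [B [C D]]] : exists s, (forall i, K `<=` (fun y => `|y ord0 i - x ord0 i| < s)) /\
    (0 < s /\ s < r).
  apply: (@filter_ex _ (r^'-)); near=> s; split; [by near: s; exact: A|split].
    by near: s; exact: nbhs_left_gt.
  by near: s; exact: nbhs_left_lt.
exists r1; split=> //; first exact: ltW.
by move=> y Ky i; apply: ltW; exact: B.
Unshelve. all: by end_near. Qed.

Lemma smooth_on_coord (g : R -> R) (i : 'I_n) (c : R) : rsmooth g ->
  smooth_on setT (fun y : X => (g (y ord0 i - c))%:C : Clcs R).
Proof.
(* Candidate derivatives: only words made of the letter [i] contribute, and their length is the
   order of the derivative of [g]. *)
move=> Sg; pose G (w : seq 'I_n) (y : X) : Clcs R :=
  if all (pred1 i) w then (rnder (size w) g (y ord0 i - c))%:C else 0.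
have H : smfam setT G.
  move=> y _ w; split=> //.
  - move=> j; rewrite /G /=.
    case: (boolP (all (pred1 i) w)) => aw; last first.
      by rewrite andbF; exact: is_lderiv_cst (good_Clcs R) _ _.
    rewrite andbT; have [ji|ji] := eqVneq j i.
      have [D _] := rsmooth_nder Sg (size w).
      have L : is_derive (0 : R) (1 : R) (fun t => (y ord0 i - c) + t) 1.
        apply/is_derive1P => e e0; apply: near0W => h.
        rewrite (_ : y ord0 i - c + (0 + h) - _ - _ = 0); last by ring.
        by rewrite normr0 mulr_ge0// ltW.
      have := is_lderiv_real (is_derive1_comp (D _) L); rewrite addr0 mulr1.
      rewrite (_ : (fun t : R => _) = fun t : R =>
        (rnder (size w) g ((y + t *: delta_mx ord0 j) ord0 i - c))%:C)//.
      by apply/funext => t /=; rewrite !mxE ji !eqxx mulr1 addrAC.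
    rewrite (_ : (fun t : R => _) = fun=> (rnder (size w) g (y ord0 i - c))%:C).
      exact: is_lderiv_cst (good_Clcs R) _ _.
    by apply/funext => t; rewrite !mxE [i == j]eq_sym (negbTE ji) andbF mulr0 addr0.
  - move=> p /= -> e e0; rewrite /G; case: ifP => _; last first.
      by near=> z; rewrite subrr Normc.normc0 ltW.
    have [D _] := rsmooth_nder Sg (size w).
    have cg : continuous (rnder (size w) g).
      by move=> t; apply: differentiable_continuous; apply/derivable1_diffP; have [] := D t.
    near=> z; rewrite -rmorphB normcR; near: z.
    apply: (near_coord (P := fun t => `|rnder (size w) g (t - c) - rnder (size w) g (y ord0 i - c)| <= e)).
    have cc : (fun t => rnder (size w) g (t - c)) t @[t --> y ord0 i] -->
        rnder (size w) g (y ord0 i - c).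
      by apply: (@cvg_comp _ _ _ (fun t => t - c) (rnder (size w) g) _ (nbhs (y ord0 i - c)) _ _ (cg _));
        apply: cvgB; [exact: cvg_id|exact: cvg_cst].
    by have /cvgrPdist_le/(_ e e0) := cc; apply: filterS => t; rewrite distrC.
exact: (smfam_smooth_on (good_Clcs R) openT H).
Unshelve. all: by end_near. Qed.

Lemma smooth_on_prod (s : seq 'I_n) (f : 'I_n -> X -> R[i]) :
  (forall i, smooth_on setT (f i : X -> Clcs R)) ->
  smooth_on setT ((fun y => \prod_(i <- s) f i y) : X -> Clcs R).
Proof.
move=> H; elim: s => [|i s IH].
  rewrite (_ : (fun y => _) = fun=> (1 : R[i])); last by apply/funext => y; rewrite big_nil.
  exact: (smfam_smooth_on (good_Clcs R) openT (@smfam_one R n setT)).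
rewrite (_ : (fun y => _) = fun y => f i y * \prod_(j <- s) f j y).
  exact: (smooth_on_mul (good_Clcs R) openT (H i) IH).1.
by apply/funext => y; rewrite big_cons.
Qed.

Lemma cutoff x (r1 r2 : R) : 0 <= r1 -> r1 < r2 -> exists chi : X -> R[i],
  [/\ smooth_on setT (chi : X -> Clcs R),
     forall y, (forall i, `|y ord0 i - x ord0 i| <= r1) -> chi y = 1 &
     forall y i, r2 <= `|y ord0 i - x ord0 i| -> chi y = 0].
Proof.
move=> r10 r12; have r12s : r1 ^+ 2 < r2 ^+ 2 by rewrite ltrXn2r ?nnegrE ?(le_trans r10 (ltW r12)).
exists (fun y => \prod_(i <- enum 'I_n) (plateau (r1 ^+ 2) (r2 ^+ 2) (y ord0 i - x ord0 i))%:C); split.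
- apply: smooth_on_prod => i; apply: smooth_on_coord; exact: rsmooth_plateau.
- move=> y H; apply: big1 => i _; rewrite plateau1//.
  by rewrite -expr2 -real_normK ?num_real// lerXn2r ?nnegrE.
- move=> y i H; rewrite (bigD1_seq i) ?mem_enum ?enum_uniq//= plateau0 ?mul0r//.
  by rewrite -expr2 -[leRHS]real_normK ?num_real// lerXn2r ?nnegrE// (le_trans r10)// ltW.
Qed.

End Cutoff.

(** * Seminorms of the basic space *)

Section IntegralBound.
Variable R : realType.
Local Notation mu := (@lebesgue_measure R).

(* The library's integral of a nonnegative function is the supremum over the
   simple functions below it, hence monotone even without measurability. *)
Lemma ge0_integral_le (f g : R -> \bar R) :
  (forall x, 0 <= f x)%E -> (forall x, f x <= g x)%E ->
  (\int[mu]_(x in setT) f x <= \int[mu]_(x in setT) g x)%E.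
Proof.
move=> f0 fg; have g0 x : (0 <= g x)%E by exact: le_trans (f0 x) (fg x).
rewrite !ge0_integralTE//; apply: ereal_sup_le; apply: image_subset => h /= H x.
exact: le_trans (H x) (fg x).
Qed.

(** The positive and the negative part are at most M on [-rho, rho] and vanish outside; two numbers
    in [0, 2 rho M] differ by at most 2 rho M. *)
Lemma Rintegral_bound (f : R -> R) (M rho : R) : 0 <= M -> 0 <= rho ->
  (forall t, `|f t| <= M) -> (forall t, rho < `|t| -> f t = 0) ->
  `|\int[mu]_(t in setT) f t| <= M * (2 * rho).
Proof.
move=> M0 r0 fM f0; set F := fun t => (f t)%:E.
pose A := `[(- rho)%R, rho]%classic : set R.
have bound (g : R -> \bar R) : (forall t, 0 <= g t)%E -> (forall t, g t <= `|F t|)%E ->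
    exists a : R, [/\ (\int[mu]_(t in setT) g t = a%:E)%E, 0 <= a & a <= M * (2 * rho)].
  move=> g0 gf; have I0 : (0 <= \int[mu]_(t in setT) g t)%E by exact: integral_ge0.
  have : (\int[mu]_(t in setT) g t <= (M * (2 * rho))%:E)%E.
    apply: (@le_trans _ _ (\int[mu]_(t in setT) ((cst M%:E) \_ A) t)%E).
      apply: ge0_integral_le => // t; apply: (le_trans (gf t)); rewrite /F patchE.
      case: ifPn => [_|]; first by rewrite /= lee_fin.
      rewrite notin_setE /A /= in_itv /= => /negP; rewrite -ler_norml -ltNge => /f0 ->.
      by rewrite normr0.
    rewrite -integral_mkcond integral_cst//=; last exact: measurable_itv.
    rewrite lebesgue_measure_itv /= lte_fin; case: ifP => _.
      by rewrite -EFinB -EFinM lee_fin; rewrite opprK; lra.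
    by rewrite mule0 lee_fin !mulr_ge0.
  case: (\int[mu]_(t in setT) g t)%E I0 => [a| |]//; rewrite !lee_fin => a0 aM.
  by exists a.
rewrite /Rintegral integralE.
have Fp t : ((F ^\+) t <= `|F t|)%E.
  by rewrite funeposE /F /= -EFin_max lee_fin ge_max ler_norm normr_ge0.
have Fn t : ((F ^\-) t <= `|F t|)%E.
  by rewrite funenegE /F /= -EFin_max lee_fin ge_max normr_ge0 andbT -normrN ler_norm.
have [a [-> a0 aM]] := bound (F ^\+)%E (fun t => funepos_ge0 F t) Fp.
have [b [-> b0 bM]] := bound (F ^\-)%E (fun t => funeneg_ge0 F t) Fn.
by rewrite -EFinB /= ler_norml; apply/andP; split; lra.
Qed.

Lemma rintegral_bound (n : nat) (g : 'rV[R]_n -> R) (M rho : R) : 0 <= M -> 0 <= rho ->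
  (forall y, `|g y| <= M) -> (forall (y : 'rV[R]_n) i, rho < `|y ord0 i| -> g y = 0) ->
  `|rintegral g| <= M * (2 * rho) ^+ n.
Proof.
elim: n g M => [|n IH] g M M0 r0 gM g0 /=; first by rewrite expr0 mulr1.
rewrite exprSr mulrA; have r2 : 0 <= 2 * rho by rewrite mulr_ge0.
apply: Rintegral_bound => //; first by rewrite mulr_ge0// exprn_ge0.
  move=> t; apply: IH => // y i yi.
  apply: (g0 _ (rshift 1 i)); move: yi; congr (_ < `|_|); exact/esym/row_mxEr.
(* For |t| > rho the inner function is identically zero, and the inductive bound with constant 0
   makes its integral vanish. *)
move=> t tr; apply/eqP; rewrite -normr_le0 -(mul0r ((2 * rho) ^+ n)).
have g00 y : g (row_mx (const_mx t : 'rV[R]_1) y) = 0.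
  apply: (g0 _ (lshift n (ord0 : 'I_1))); move: tr; congr (_ < `|_|).
  by rewrite [RHS](row_mxEl (const_mx t : 'rV[R]_1) y ord0 ord0) mxE.
by apply: IH => // y; rewrite g00 ?normr0.
Qed.

Lemma normc_le_ReIm (z : R[i]) : Normc.normc z <= `|complex.Re z| + `|complex.Im z|.
Proof.
case: z => a b /=; rewrite -[leRHS]ger0_norm ?addr_ge0// -sqrtr_sqr ler_wsqrtr//.
rewrite sqrrD !real_normK ?num_real//; have := mulr_ge0 (normr_ge0 a) (normr_ge0 b).
by rewrite -[_ *+ 2]mulr_natl; lra.
Qed.

Lemma Re_le_normc (z : R[i]) : `|complex.Re z| <= Normc.normc z.
Proof. by case: z => a b /=; rewrite -sqrtr_sqr ler_wsqrtr// lerDl sqr_ge0. Qed.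

Lemma Im_le_normc (z : R[i]) : `|complex.Im z| <= Normc.normc z.
Proof. by case: z => a b /=; rewrite -sqrtr_sqr ler_wsqrtr// lerDr sqr_ge0. Qed.

Lemma cintegral_bound (n : nat) (g : 'rV[R]_n -> R[i]) (M rho : R) : 0 <= M -> 0 <= rho ->
  (forall y, Normc.normc (g y) <= M) -> (forall (y : 'rV[R]_n) i, rho < `|y ord0 i| -> g y = 0) ->
  Normc.normc (cintegral g) <= 2 * (2 * rho) ^+ n * M.
Proof.
move=> M0 r0 gM g0; apply: le_trans (normc_le_ReIm _) _ => /=.
have A : `|rintegral (fun y => complex.Re (g y))| <= M * (2 * rho) ^+ n.
  apply: rintegral_bound => // [y|y i yi]; first exact: le_trans (Re_le_normc _) (gM y).
  by rewrite (g0 _ _ yi).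
have B : `|rintegral (fun y => complex.Im (g y))| <= M * (2 * rho) ^+ n.
  apply: rintegral_bound => // [y|y i yi]; first exact: le_trans (Im_le_normc _) (gM y).
  by rewrite (g0 _ _ yi).
by lra.
Qed.

Lemma compact_coord_bounded (n : nat) (L : set 'rV[R]_n) : compact L ->
  exists2 rho, 0 <= rho & forall y, L y -> forall i, `|y ord0 i| <= rho.
Proof.
move=> /compact_near_coveringP cL.
have H (i : 'I_n) : \forall s \near +oo, L `<=` (fun y => `|y ord0 i| <= s).
  apply: (cL R (pinfty_nbhs R) (fun s y => `|y ord0 i| <= s)) => y Ly.
  exists ([set y' : 'rV[R]_n | `|y' ord0 i - y ord0 i| < 1], [set s | `|y ord0 i| + 1 < s]).
    split=> /=; last by exists (`|y ord0 i| + 1); split; [exact: num_real|].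
    apply: (near_coord (P := fun t => `|t - y ord0 i| < 1)).
    by apply/nbhs_ballP; exists 1 => //= t; rewrite /ball /= distrC.
  move=> [y' s] /= [A B].
  have : `|y' ord0 i| <= `|y' ord0 i - y ord0 i| + `|y ord0 i|.
    by rewrite -{1}[y' ord0 i](subrK (y ord0 i)) ler_normD.
  lra.
have /filter_forall A := H.
have [rho [B C]] : exists s : R, (forall i, L `<=` (fun y => `|y ord0 i| <= s)) /\ 0 <= s.
  apply: (@filter_ex _ (pinfty_nbhs R)); near=> s; split; first by near: s; exact: A.
  by near: s; exact: nbhs_pinfty_ge.
by exists rho => // y Ly i; exact: B.
Unshelve. all: by end_near. Qed.

End IntegralBound.

(** * Comparison of the seminorms *)

Section Norms.
Variables (R : realType) (n : nat) (Omega U : set 'rV[R]_n).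
Local Notation X := 'rV[R]_n.
Local Notation C := R[i].
Hypotheses (oO : open Omega) (oU : open U) (UO : U `<=` Omega).
Implicit Types (K L : set X) (phi : X -> X -> C).

Let gD := good_Dtest oO.

Lemma xder_test a phi x : @dom R (CinfD Omega U) phi -> U x -> is_test Omega (xder Omega a phi x).
Proof. by move=> [Sphi _] Ux; exact: (dom_mder gD oU a Sphi Ux). Qed.

(** Evaluation at [y] is continuous, so a derivative in D(Omega) is also a pointwise one, here of a
    function of [x] that vanishes identically on [U] when [y] is off [L]. *)
Lemma pders_supp L phi : CinfDL Omega U L phi -> forall w x y, U x -> ~ L y ->
  @pders R n (Dtest Omega) w phi x y = 0.
Proof.
move=> [[Sphi _] Lphi]; have SF := smooth_on_smfam gD oU Sphi.
elim=> [|i w IH] x y Ux Ly.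
  by apply: tsupportC => /= H; apply: Ly; have [_] := Lphi x Ux; exact.
have [_ D _] := SF x Ux w.
have D1 : @is_lderiv R (Clcs R) (fun t : R =>
    @pders R n (Dtest Omega) w phi (x + t *: delta_mx 0 i) y) 0
    (@pders R n (Dtest Omega) (i :: w) phi x y).
  by move=> p /= ->; exact: (D i _ (eval_test oO y)).
apply: (is_lderiv_unique (good_Clcs R) _ _ _ D1) => //; first exact: near0W.
apply: is_lderiv_near (is_lderiv_cst (good_Clcs R) 0 0).
apply: (near_dir (P := fun x => 0 = @pders R n (Dtest Omega) w phi x y)).
by apply: near_open oU Ux _ => x' Ux'; rewrite IH.
Qed.

Variables (K L : set X) (KU : compactly_inside K U) (LU : compactly_inside L U).

Let KsU : K `<=` U := compactly_insideP oU KU.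
Let LO : compactly_inside L Omega := compactly_insideS oU UO LU.
Let KO : compactly_inside K Omega := compactly_insideS oU UO KU.

(** [norm_f L l] is a continuous seminorm on D(Omega); bounding it on the x-derivatives over [K]
    bounds all derivatives in both variables. *)
Lemma norm_phi_bounded c l phi : @dom R (CinfD Omega U) phi ->
  exists M, forall r, (exists x y (a b : multi n),
    [/\ K x, L y, (mdeg a <= c)%N, (mdeg b <= l)%N &
    r = Normc.normc (@mder R n (Clcs R) b (xder Omega a phi x) y)]) -> r <= M.
Proof.
move=> dphi; have [Sphi _] := dphi.
have [M M0 H] := mder_bounded gD oU c Sphi KU (norm_f_test oO l LO).
exists M => _ [x [y [a [b [Kx Ly ac bl ->]]]]].
have [[St _] _ _] := xder_test a dphi (KsU Kx).
exact: le_trans (norm_f_compact oO LO St Ly bl) (H x a Kx ac).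
Qed.

Lemma norm_phi_ge c l phi x y (a b : multi n) : @dom R (CinfD Omega U) phi -> K x -> L y ->
  (mdeg a <= c)%N -> (mdeg b <= l)%N ->
  Normc.normc (@mder R n (Clcs R) b (xder Omega a phi x) y) <= norm_phi Omega K c L l phi.
Proof.
move=> dphi Kx Ly ac bl; have [M H] := norm_phi_bounded c l dphi.
by apply: (le_sup_bound H); exists x, y, a, b.
Qed.

Lemma norm_phi_ge0 c l phi : @dom R (CinfD Omega U) phi -> 0 <= norm_phi Omega K c L l phi.
Proof.
move=> dphi; have [M H] := norm_phi_bounded c l dphi.
by apply: (sup_bound_ge0 H) => _ [x [y [a [b [_ _ _ _ ->]]]]]; exact: normc_ge0.
Qed.

Lemma norm_phi_mono c l c' l' phi : @dom R (CinfD Omega U) phi -> (c <= c')%N -> (l <= l')%N ->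
  norm_phi Omega K c L l phi <= norm_phi Omega K c' L l' phi.
Proof.
move=> dphi cc ll; apply: sup_le_bound; first exact: (norm_phi_ge0 c' l' dphi).
move=> _ [x [y [a [b [Kx Ly ac bl ->]]]]].
by apply: norm_phi_ge => //; [exact: leq_trans ac cc|exact: leq_trans bl ll].
Qed.

(** The integrand vanishes for [y] off [L], and on [L] it is at most the bound of [B] times the
    seminorm of [phi]; [L] fits into a cube of side 2 rho. [A] is independent of [phi] and also
    bounds the derivatives of [f]. *)
Lemma pairing_bound c B : @bounded_subset R (CinfC Omega) B -> exists2 A, 0 <= A &
  forall l phi, CinfDL Omega U L phi ->
  forall x (a : multi n) f, K x -> (mdeg a <= c)%N -> B f ->
    Normc.normc (pairing Omega f a phi x) <= A * norm_phi Omega K c L l phi /\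
    Normc.normc (@mder R n (Clcs R) a f x) <= A.
Proof.
move=> [dB bB].
have [M1 H1] := bB _ (sn_norm_f 0 LO); have [M2 H2] := bB _ (sn_norm_f c KO).
have [rho r0 Lr] := compact_coord_bounded LU.1.
(* The maxima with 0 cover an empty [B], for which [M1] and [M2] may be negative. *)
pose A1 := 2 * (2 * rho) ^+ n * Num.max 0 M1.
have A10 : 0 <= A1 by rewrite !mulr_ge0 ?exprn_ge0 ?mulr_ge0// le_max lexx.
have M20 : 0 <= Num.max 0 M2 by rewrite le_max lexx.
exists (A1 + Num.max 0 M2); first exact: addr_ge0.
move=> l phi Lphi x a f Kx ac Bf; have dphi := Lphi.1.
have N0 := norm_phi_ge0 c l dphi.
have [Sf _] := dB f Bf; split; last first.
  apply: (le_trans (norm_f_compact oO KO Sf Kx ac)); apply: (le_trans (H2 f Bf)).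
  by have : M2 <= Num.max 0 M2 by [rewrite le_max lexx orbT]; lra.
apply: (@le_trans _ _ (A1 * norm_phi Omega K c L l phi)); last first.
  by apply: ler_wpM2r => //; lra.
rewrite -mulrA; apply: cintegral_bound => //.
- by rewrite mulr_ge0// le_max lexx.
- move=> y; rewrite Normc.normcM; have [Ly|Ly] := pselect (L y); last first.
    by rewrite [xder _ _ _ _ _](pders_supp Lphi _ (KsU Kx) Ly) Normc.normc0 mulr0 mulr_ge0// le_max lexx.
  apply: ler_pM; do ?exact: normc_ge0.
    rewrite le_max; apply/orP; right; apply: le_trans (H1 f Bf).
    rewrite -[f y](mder0 (E := Clcs R)).
    by apply: (norm_f_compact oO LO Sf) => //; rewrite mdeg0.
  rewrite -[xder _ _ _ _ _](mder0 (E := Clcs R)).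
  by apply: norm_phi_ge => //; rewrite mdeg0.
- move=> y i yi; have Ly : ~ L y by move=> /Lr/(_ i); rewrite leNgt yi.
  by rewrite [xder _ _ _ _ _](pders_supp Lphi _ (KsU Kx) Ly) mulr0.
Qed.

Lemma norm_B_ub c l B : @bounded_subset R (CinfC Omega) B -> exists2 A, 0 <= A &
  forall phi, CinfDL Omega U L phi ->
    (forall x (a : multi n) f, K x -> (mdeg a <= c)%N -> B f ->
      Normc.normc (pairing Omega f a phi x) <= A * norm_phi Omega K c L l phi) /\
    (forall x (a : multi n) f, K x -> (mdeg a <= c)%N -> B f ->
      Normc.normc (pairing Omega f a phi x - @mder R n (Clcs R) a f x) <=
      A * norm_phi Omega K c L l phi + A).
Proof.
move=> bB; have [A A0 H] := pairing_bound c bB; exists A => // phi Lphi.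
split=> x a f Kx ac Bf; have [H1 H2] := H l phi Lphi x a f Kx ac Bf; first exact: H1.
apply: le_trans (normcD _ _) _; apply: lerD => //.
by rewrite (snN (E := Clcs R) (good_Clcs R) (p := fun z : C => Normc.normc z)).
Qed.

(** The extra summand [A] in the second estimate bounds the derivatives of the functions in [B],
    which are the contribution of delta. *)
Lemma norm_B_le c l B : @bounded_subset R (CinfC Omega) B -> exists2 A, 0 <= A &
  forall phi, CinfDL Omega U L phi ->
    norm_B Omega K c B phi <= A * norm_phi Omega K c L l phi /\
    dist_delta Omega K c B phi <= A * norm_phi Omega K c L l phi + A.
Proof.
move=> bB; have [A A0 H] := norm_B_ub c l bB; exists A => // phi Lphi.
have [H1 H2] := H phi Lphi; have N0 := norm_phi_ge0 c l Lphi.1.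
have AN : 0 <= A * norm_phi Omega K c L l phi by rewrite mulr_ge0.
split; apply: sup_le_bound => //; do ?exact: addr_ge0.
  by move=> _ [x [a [f [Kx ac Bf ->]]]]; exact: H1.
by move=> _ [x [a [f [Kx ac Bf ->]]]]; exact: H2.
Qed.

Lemma norm_B_bounded c B phi : @bounded_subset R (CinfC Omega) B ->
  CinfDL Omega U L phi -> exists M,
  (forall r, (exists x (a : multi n) f, [/\ K x, (mdeg a <= c)%N, B f &
     r = Normc.normc (pairing Omega f a phi x)]) -> r <= M) /\
  (forall r, (exists x (a : multi n) f, [/\ K x, (mdeg a <= c)%N, B f &
     r = Normc.normc (pairing Omega f a phi x - @mder R n (Clcs R) a f x)]) -> r <= M).
Proof.
move=> bB Lphi; have [A A0 H] := norm_B_ub c 0 bB; have [H1 H2] := H phi Lphi.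
exists (A * norm_phi Omega K c L 0 phi + A).
split=> _ [x [a [f [Kx ac Bf ->]]]]; last exact: H2.
by apply: le_trans (H1 x a f Kx ac Bf) _; rewrite lerDl.
Qed.

(** Enlarging a set enlarges its supremum as long as the larger set is bounded above; this is where
    boundedness of [B'] enters. *)
Lemma norm_B_mono c c' B B' phi : @bounded_subset R (CinfC Omega) B' ->
  CinfDL Omega U L phi -> (c <= c')%N -> B `<=` B' ->
  norm_B Omega K c B phi <= norm_B Omega K c' B' phi /\
  dist_delta Omega K c B phi <= dist_delta Omega K c' B' phi.
Proof.
move=> bB Lphi cc BB; have [M [b1 b2]] := norm_B_bounded c' bB Lphi.
split; apply: sup_le_bound.
- by apply: (sup_bound_ge0 b1) => _ [x [a [f [_ _ _ ->]]]]; exact: normc_ge0.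
- move=> _ [x [a [f [Kx ac Bf ->]]]]; apply: (le_sup_bound b1).
  by exists x, a, f; split=> //; [exact: leq_trans ac cc|exact: BB].
- by apply: (sup_bound_ge0 b2) => _ [x [a [f [_ _ _ ->]]]]; exact: normc_ge0.
- move=> _ [x [a [f [Kx ac Bf ->]]]]; apply: (le_sup_bound b2).
  by exists x, a, f; split=> //; [exact: leq_trans ac cc|exact: BB].
Qed.

Lemma norm_B_ge0 c B phi : @bounded_subset R (CinfC Omega) B -> CinfDL Omega U L phi ->
  0 <= norm_B Omega K c B phi /\ 0 <= dist_delta Omega K c B phi.
Proof.
move=> bB Lphi; have [M [b1 b2]] := norm_B_bounded c bB Lphi.
by split; [apply: (sup_bound_ge0 b1)|apply: (sup_bound_ge0 b2)];
  move=> _ [x [a [f [_ _ _ ->]]]]; exact: normc_ge0.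
Qed.

End Norms.

(** * Polynomials with nonnegative coefficients *)

Import (canonicals) mpoly.

Section NonnegPoly.
Variable R : realType.

(** Polynomials are handled through the functions they define, so that sums, products and
    substitutions are operations on functions. *)
Definition nnpoly (N : nat) (F : ('I_N -> R) -> R) : Prop :=
  exists2 lam : mpoly.mpoly N R, nonneg_coef lam & forall v, F v = mpoly.meval v lam.

Lemma nnpolyE N (lam : mpoly.mpoly N R) : nonneg_coef lam -> nnpoly (fun v => mpoly.meval v lam).
Proof. by exists lam. Qed.

Lemma nnpoly_cst N (a : R) : 0 <= a -> nnpoly (fun _ : 'I_N -> R => a).
Proof.
move=> a0; exists (mpoly.mpolyC N a) => [m|v]; last by rewrite mpoly.mevalC.
by rewrite mpoly.mcoeffC mulr_ge0.
Qed.

Lemma nnpoly_var N (i : 'I_N) : nnpoly (fun v => v i).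
Proof.
exists (mpoly.mpolyX R (mpoly.mnm1 i)) => [m|v]; last by rewrite mpoly.mevalXU.
by rewrite mpoly.mcoeffX.
Qed.

Lemma nnpolyD N F G : @nnpoly N F -> @nnpoly N G -> nnpoly (fun v => F v + G v).
Proof.
move=> [p p0 Fp] [q q0 Gq]; exists (p + q) => [m|v]; last by rewrite mpoly.mevalD Fp Gq.
by rewrite mpoly.mcoeffD addr_ge0.
Qed.

Lemma nnpolyM N F G : @nnpoly N F -> @nnpoly N G -> nnpoly (fun v => F v * G v).
Proof.
move=> [p p0 Fp] [q q0 Gq]; exists (p * q) => [m|v]; last by rewrite mpoly.mevalM Fp Gq.
by rewrite mpoly.mcoeffM sumr_ge0// => k _; rewrite mulr_ge0.
Qed.

Lemma nnpolyX N F k : @nnpoly N F -> nnpoly (fun v => F v ^+ k).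
Proof.
move=> HF; elim: k => [|k IH].
  by rewrite (_ : (fun v => _) = fun=> 1); [exact: nnpoly_cst|apply/funext => v; rewrite expr0].
rewrite (_ : (fun v => _) = fun v => F v * F v ^+ k); first exact: nnpolyM.
by apply/funext => v; rewrite exprS.
Qed.

(** Expanding [F] into monomials reduces substitution to sums, products and powers. *)
Lemma nnpoly_comp N N' F (G : 'I_N -> ('I_N' -> R) -> R) : @nnpoly N F ->
  (forall i, nnpoly (G i)) -> nnpoly (fun v => F (fun i => G i v)).
Proof.
move=> [p p0 Fp] HG.
rewrite (_ : (fun v => _) = fun v => \sum_(m <- mpoly.msupp p)
  mpoly.mcoeff m p * \prod_(i < N) G i v ^+ (mpoly.fun_of_multinom m i)); last first.
  by apply/funext => v; rewrite Fp mpoly.mevalE.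
elim: (mpoly.msupp p : seq _) => [|m s IH].
  rewrite (_ : (fun v => _) = fun=> 0); first exact: nnpoly_cst.
  by apply/funext => v; rewrite big_nil.
rewrite (_ : (fun v => _) = fun v =>
  mpoly.mcoeff m p * \prod_(i < N) G i v ^+ (mpoly.fun_of_multinom m i) +
  \sum_(m <- s) mpoly.mcoeff m p * \prod_(i < N) G i v ^+ (mpoly.fun_of_multinom m i)); last first.
  by apply/funext => v; rewrite big_cons.
apply: nnpolyD => //; apply: nnpolyM; first exact: nnpoly_cst.
elim: (index_enum _) => [|i r IHr].
  rewrite (_ : (fun v => _) = fun=> 1); first exact: nnpoly_cst.
  by apply/funext => v; rewrite big_nil.
rewrite (_ : (fun v => _) = fun v => G i v ^+ (mpoly.fun_of_multinom m i) *
  \prod_(i <- r) G i v ^+ (mpoly.fun_of_multinom m i)); last first.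
  by apply/funext => v; rewrite big_cons.
by apply: nnpolyM => //; exact: nnpolyX.
Qed.

Lemma nnpoly_mono N F : @nnpoly N F -> forall v w, (forall i, 0 <= v i) ->
  (forall i, v i <= w i) -> F v <= F w.
Proof.
move=> [p p0 Fp] v w v0 vw; rewrite !Fp !mpoly.mevalE.
apply: ler_sum => m _; apply: ler_wpM2l => //.
apply: ler_prod => i _; rewrite exprn_ge0//=; apply: lerXn2r => //; rewrite nnegrE//.
exact: le_trans (v0 i) (vw i).
Qed.

End NonnegPoly.

(** * Moderate and negligible elements *)

Section Dominated.
Variables (R : realType) (n : nat) (Omega : set 'rV[R]_n).
Local Notation X := 'rV[R]_n.
Local Notation C := R[i].
Hypothesis oO : open Omega.
Implicit Types (U K L : set X) (B : set (X -> C)).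

Definition yval K c L l k (phi : 'I_k.+1 -> X -> X -> C) : 'I_k.+1 -> R :=
  fun i => norm_phi Omega K c L l (phi i).

Definition zval K c B k (phi : 'I_k.+1 -> X -> X -> C) : 'I_k.+1 -> R :=
  fun i => if i == ord0 then dist_delta Omega K c B (phi i) else norm_B Omega K c B (phi i).

(* [neg] selects between the estimates of negligible and moderate elements;
   allowing [zval] in the moderate case is harmless by [norm_B_le]. *)
Definition dominated (neg : bool) U K L k (Q : ('I_k.+1 -> X -> X -> C) -> R) :=
  exists c l (F : ('I_(k.+1 + k.+1) -> R) -> R), [/\ nnpoly F,
    neg -> forall y, F (join_val y (fun=> 0)) = 0 &
    exists2 B, @bounded_subset R (CinfC Omega) B &
    forall phi, (forall i, CinfDL Omega U L (phi i)) ->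
      Q phi <= F (join_val (yval K c L l phi) (zval K c B phi))].

Lemma join_val_ge0 k (y z : 'I_k.+1 -> R) : (forall i, 0 <= y i) -> (forall i, 0 <= z i) ->
  forall i, 0 <= join_val y z i.
Proof. by move=> y0 z0 i; rewrite /join_val; case: splitP => j _. Qed.

Lemma join_val_le k (y z y' z' : 'I_k.+1 -> R) : (forall i, y i <= y' i) ->
  (forall i, z i <= z' i) -> forall i, join_val y z i <= join_val y' z' i.
Proof. by move=> y0 z0 i; rewrite /join_val; case: splitP => j _. Qed.

Lemma bounded_subsetU (E : lcs R) (A B : set E) :
  bounded_subset A -> bounded_subset B -> bounded_subset (A `|` B).
Proof.
move=> [dA bA] [dB bB]; split; first by move=> x [/dA|/dB].
move=> p sp; have [M HM] := bA p sp; have [N HN] := bB p sp.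
by exists (Num.max M N) => x [/HM|/HN]; rewrite le_max => ->; rewrite ?orbT.
Qed.

Lemma bounded_subset0 (E : lcs R) : bounded_subset (set0 : set E).
Proof. by split=> // p _; exists 0. Qed.

Section Fixed.
Variables (U K L : set X) (oU : open U) (UO : U `<=` Omega).
Hypotheses (KU : compactly_inside K U) (LU : compactly_inside L U).

Lemma yval_ge0 c l k (phi : 'I_k.+1 -> X -> X -> C) :
  (forall i, CinfDL Omega U L (phi i)) -> forall i, 0 <= yval K c L l phi i.
Proof. by move=> H i; exact: (norm_phi_ge0 oO oU UO KU LU c l (H i).1). Qed.

Lemma zval_ge0 c B k (phi : 'I_k.+1 -> X -> X -> C) : @bounded_subset R (CinfC Omega) B ->
  (forall i, CinfDL Omega U L (phi i)) -> forall i, 0 <= zval K c B phi i.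
Proof.
move=> bB H i; rewrite /zval; have [? ?] := norm_B_ge0 oO oU UO KU LU c bB (H i).
by case: ifP.
Qed.

(** Brings two estimates to common parameters. A polynomial with nonnegative coefficients is
    monotone on nonnegative arguments, and the seminorms grow with [c], [l] and [B]. *)
Lemma dominated_widen k (F : ('I_(k.+1 + k.+1) -> R) -> R) c l B c' l' B'
    (phi : 'I_k.+1 -> X -> X -> C) : nnpoly F ->
  @bounded_subset R (CinfC Omega) B -> @bounded_subset R (CinfC Omega) B' ->
  (c <= c')%N -> (l <= l')%N -> B `<=` B' -> (forall i, CinfDL Omega U L (phi i)) ->
  F (join_val (yval K c L l phi) (zval K c B phi)) <=
  F (join_val (yval K c' L l' phi) (zval K c' B' phi)).
Proof.
move=> nF bB bB' cc ll BB H; apply: nnpoly_mono => // i.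
  by apply: join_val_ge0; [exact: yval_ge0|exact: zval_ge0].
apply: join_val_le => {}i; first exact: (norm_phi_mono oO oU UO KU LU (H i).1).
have [? ?] := norm_B_mono oO oU UO KU LU bB' (H i) cc BB.
by rewrite /zval; case: ifP.
Qed.

Lemma dominated_le neg k (Q Q' : ('I_k.+1 -> X -> X -> C) -> R) :
  (forall phi, (forall i, CinfDL Omega U L (phi i)) -> Q phi <= Q' phi) ->
  dominated neg U K L Q' -> dominated neg U K L Q.
Proof.
move=> QQ [c [l [F [nF F0 [B bB H]]]]]; exists c, l, F; split=> //; exists B => // phi Hphi.
exact: le_trans (QQ phi Hphi) (H phi Hphi).
Qed.

Lemma dominated_cst k (a : R) : 0 <= a -> dominated false U K L (fun _ : 'I_k.+1 -> _ => a).
Proof.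
move=> a0; exists 0%N, 0%N, (fun=> a); split=> //; first exact: nnpoly_cst.
by exists set0; [exact: bounded_subset0|].
Qed.

Lemma dominated0 neg k : dominated neg U K L (fun _ : 'I_k.+1 -> _ => 0).
Proof.
exists 0%N, 0%N, (fun=> 0); split=> //; first exact: nnpoly_cst.
by exists set0; [exact: bounded_subset0|].
Qed.

Lemma dominatedD neg k (Q Q' : ('I_k.+1 -> X -> X -> C) -> R) :
  dominated neg U K L Q -> dominated neg U K L Q' ->
  dominated neg U K L (fun phi => Q phi + Q' phi).
Proof.
move=> [c [l [F [nF F0 [B bB H]]]]] [c' [l' [F' [nF' F0' [B' bB' H']]]]].
have bU := bounded_subsetU bB bB'.
exists (maxn c c'), (maxn l l'), (fun v => F v + F' v); split.
- exact: nnpolyD.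
- by move=> ne y; rewrite F0// F0'// addr0.
exists (B `|` B') => // phi Hphi; apply: lerD.
  by apply: le_trans (H phi Hphi) _; apply: dominated_widen; rewrite ?leq_maxl//; exact: subsetUl.
by apply: le_trans (H' phi Hphi) _; apply: dominated_widen; rewrite ?leq_maxr//; exact: subsetUr.
Qed.

Lemma dominatedZ neg k (a : R) (Q : ('I_k.+1 -> X -> X -> C) -> R) : 0 <= a ->
  dominated neg U K L Q -> dominated neg U K L (fun phi => a * Q phi).
Proof.
move=> a0 [c [l [F [nF F0 [B bB H]]]]]; exists c, l, (fun v => a * F v); split.
- by apply: nnpolyM => //; exact: nnpoly_cst.
- by move=> ne y; rewrite F0// mulr0.
by exists B => // phi Hphi; apply: ler_wpM2l => //; exact: H.
Qed.

(** A product of polynomials vanishes at z = 0 as soon as one factor does, whence the disjunction of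
    the flags. *)
Lemma dominatedM neg neg' k (Q Q' : ('I_k.+1 -> X -> X -> C) -> R) :
  (forall phi, (forall i, CinfDL Omega U L (phi i)) -> 0 <= Q phi) ->
  (forall phi, (forall i, CinfDL Omega U L (phi i)) -> 0 <= Q' phi) ->
  dominated neg U K L Q -> dominated neg' U K L Q' ->
  dominated (neg || neg') U K L (fun phi => Q phi * Q' phi).
Proof.
move=> Q0 Q0' [c [l [F [nF F0 [B bB H]]]]] [c' [l' [F' [nF' F0' [B' bB' H']]]]].
have bU := bounded_subsetU bB bB'.
exists (maxn c c'), (maxn l l'), (fun v => F v * F' v); split.
- exact: nnpolyM.
- by move=> /orP[ne|ne] y; [rewrite F0// mul0r|rewrite F0'// mulr0].
exists (B `|` B') => // phi Hphi; apply: ler_pM; [exact: Q0|exact: Q0'| |].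
  by apply: le_trans (H phi Hphi) _; apply: dominated_widen; rewrite ?leq_maxl//; exact: subsetUl.
by apply: le_trans (H' phi Hphi) _; apply: dominated_widen; rewrite ?leq_maxr//; exact: subsetUr.
Qed.

Lemma dominated_sum neg k (T : Type) (s : seq T) (Q : T -> ('I_k.+1 -> X -> X -> C) -> R) :
  (forall z, dominated neg U K L (Q z)) ->
  dominated neg U K L (fun phi => \sum_(z <- s) Q z phi).
Proof.
move=> H; elim: s => [|z s IH].
  by apply: dominated_le (dominated0 neg k) => phi _; rewrite big_nil.
by apply: dominated_le (dominatedD (H z) IH) => phi _; rewrite big_cons.
Qed.

(** [g] sends 0, and nothing else, to 0 because z_0 measures the distance to delta while the other
    z_i are plain pairings. *)
Lemma dominated_reindex neg k k' (g : 'I_k'.+1 -> 'I_k.+1)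
    (Q : ('I_k'.+1 -> X -> X -> C) -> R) : (forall i, (g i == ord0) = (i == ord0)) ->
  dominated neg U K L Q -> dominated neg U K L (fun phi => Q (phi \o g)).
Proof.
move=> g0 [c [l [F [nF F0 [B bB H]]]]].
pose G (i : 'I_(k'.+1 + k'.+1)) : 'I_(k.+1 + k.+1) :=
  match fintype.split i with inl j => lshift k.+1 (g j) | inr j => rshift k.+1 (g j) end.
have GE y z : (fun i => join_val y z (G i)) = join_val (y \o g) (z \o g).
  apply/funext => i; rewrite /join_val /G; case: (fintype.split i) => j.
    by rewrite (unsplitK (inl (g j))).
  by rewrite (unsplitK (inr (g j))).
exists c, l, (fun v => F (fun i => v (G i))); split.
- by apply: (nnpoly_comp (G := fun i v => v (G i))) => // i; exact: nnpoly_var.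
- by move=> ne y; rewrite GE; exact: F0.
exists B => // phi Hphi; rewrite GE.
have := H (phi \o g) (fun i => Hphi (g i)).
rewrite (_ : zval K c B (phi \o g) = zval K c B phi \o g)//.
by apply/funext => i; rewrite /zval /= g0.
Qed.

End Fixed.

Definition est neg (S : sheaf_family R n) U := forall K L, compactly_inside K U ->
  compactly_inside L U -> forall m k, dominated neg U K L
    (fun phi : 'I_k.+1 -> X -> X -> C => norm_f K m (kdiffS Omega S U phi)).

Definition elements neg : set (sheaf_family R n) :=
  [set S | basic_space Omega S /\ forall x, Omega x -> exists U,
    [/\ open U, U x, U `<=` Omega & est neg S U]].

Lemma negligibleE : negligible_elements Omega = elements true.
Proof.
apply/seteqP; split=> S [BS H]; split=> // x Ox; have [U [oU Ux UO E]] := H x Ox;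
  exists U; split=> // K L KU LU m k.
  have [c [l [lam [l0 lz] [B bB HB]]]] := E K L KU LU m k.
  by exists c, l, (fun v => mpoly.meval v lam); split=> //; [exact: nnpolyE|exists B].
have [c [l [F [[lam l0 FE] F0 [B bB HB]]]]] := E K L KU LU m k.
exists c, l, lam; first by split=> // y; rewrite -FE F0.
by exists B => // phi Hphi; rewrite -FE; exact: HB.
Qed.

Lemma moderateE : moderate_elements Omega = elements false.
Proof.
apply/seteqP; split=> S [BS H]; split=> // x Ox; have [U [oU Ux UO E]] := H x Ox;
  exists U; split=> // K L KU LU m k.
  have [c [l [lam l0 HB]]] := E K L KU LU m k.
  exists c, l, (fun v => mpoly.meval (fun i => v (lshift k.+1 i)) lam); split=> //.
    by apply: (nnpoly_comp (G := fun i v => v (lshift k.+1 i)) (nnpolyE l0)) => i; exact: nnpoly_var.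
  (* The polynomial uses the y variables only, so the empty family of functions serves. *)
  exists set0; first exact: bounded_subset0.
  move=> phi Hphi; apply: le_trans (HB phi Hphi) _; rewrite le_eqVlt; apply/orP; left.
  by apply/eqP; congr mpoly.meval; apply/funext => i; rewrite /join_val (unsplitK (inl i)).
have [c [l [F [nF F0 [B bB HB]]]]] := E K L KU LU m k.
have [A A0 HA] := norm_B_le oO oU UO KU LU c l bB.
(* A y_j + A dominates both kinds of z variables; substituting it leaves a polynomial in y alone. *)
pose G (i : 'I_(k.+1 + k.+1)) (y : 'I_k.+1 -> R) : R :=
  join_val y (fun j => A * y j + A) i.
have [lam l0 FE] : nnpoly (fun y => F (fun i => G i y)).
  apply: nnpoly_comp => // i; rewrite /G /join_val; case: (fintype.split i) => j.
    exact: nnpoly_var.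
  by apply: nnpolyD; [apply: nnpolyM; [exact: nnpoly_cst|exact: nnpoly_var]|exact: nnpoly_cst].
exists c, l; exists lam => // phi Hphi; rewrite -FE.
apply: le_trans (HB phi Hphi) _; apply: nnpoly_mono => // i.
  by apply: join_val_ge0; [exact: (yval_ge0 oU UO KU LU)|exact: (zval_ge0 oU UO KU LU)].
apply: join_val_le => // j; have [h1 h2] := HA _ (Hphi j).
rewrite /zval; case: ifP => _ //.
by apply: le_trans h1 _; rewrite lerDl.
Qed.

End Dominated.

(** * Passage to smaller cubes, sums and products *)

Section Transfer.
Variables (R : realType) (n : nat) (Omega : set 'rV[R]_n).
Local Notation X := 'rV[R]_n.
Local Notation C := R[i].
Hypothesis oO : open Omega.
Implicit Types (U V K L : set X).

(** The values are test functions on [Omega]; having their supports in [L], inside [U], makes them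
    test functions on [U]. *)
Lemma CinfDL_of_support U L (psi : X -> X -> C) : U `<=` Omega -> L `<=` U ->
  @dom R (CinfD Omega U) psi -> (forall x, U x -> tsupport (psi x) `<=` L) ->
  CinfDL Omega U L psi.
Proof.
move=> UO LU dpsi supp; split=> // x Ux; split; last exact: supp.
have [[Sf f0] cf _] : is_test Omega (psi x) := (dpsi.1 x Ux).1.
have sU : tsupport (psi x) `<=` U by move=> y /(supp x Ux)/LU.
split=> //; split; first by move=> y Uy; exact: (Sf y (UO y Uy)).
by move=> y Uy; apply: tsupportC => /sU.
Qed.

(** [phi] may be singular at the boundary of the cube. The factor in [x] is 1 up to [r1] and 0 from
    (r1 + r) / 2 on, so that the extension by zero is smooth, and supports in [y] do not grow. *)
Lemma extend_from_box U L (x0 : X) (r r1 : R) (phi : X -> X -> C) : open U -> U `<=` Omega ->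
  box x0 r `<=` U -> 0 <= r1 -> r1 < r -> compactly_inside L (box x0 r) ->
  CinfDL Omega (box x0 r) L phi ->
  exists2 psi, CinfDL Omega U L psi &
    forall x : X, (forall i, `|x ord0 i - x0 ord0 i| <= r1) -> psi x = phi x.
Proof.
move=> oU UO VU r10 r1r LV [[Sphi phi0] Lphi]; set V := box x0 r in VU LV Sphi phi0 Lphi.
have oV : open V by exact: open_box.
have gD := good_Dtest oO.
have r2 : r1 < (r1 + r) / 2 by lra.
have [chi [Schi chi1 chi0]] := cutoff x0 r10 r2.
pose psi (x : X) : Dtest Omega := chi x *: (phi x : Dtest Omega).
have SchiV : smooth_on V (chi : X -> Clcs R) by move=> x _; exact: Schi.
have [SV _] := smooth_on_mul gD oV SchiV Sphi.
have psi_out x : ~ V x -> psi x = 0 by move=> Vx; rewrite /psi phi0// scaler0.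
exists psi; last first.
  by move=> x xr; rewrite /psi chi1// scale1r.
apply: CinfDL_of_support => //.
- exact: subset_trans (compactly_insideP oV LV) VU.
- split; last by move=> x Ux; apply: psi_out => /VU.
  move=> x Ux; have [Vx|Vx] := pselect (V x).
    by have := SV x Vx.
  apply: (@smooth_at_near R n (Dtest Omega) (0 : X -> Dtest Omega)); last first.
    exact: (smooth_on0 gD oU Ux).
  (* A point off the cube has a coordinate at distance at least [r], hence a neighbourhood on which
     the cut-off is 0. *)
  have [i ri] : exists i, r <= `|x ord0 i - x0 ord0 i|.
    by apply: contrapT => H; apply: Vx => i; rewrite ltNge; apply/negP => ri; apply: H; exists i.
  have : \forall y \near x, (r1 + r) / 2 < `|(y : X) ord0 i - x0 ord0 i|.
    apply: (near_coord (P := fun t => (r1 + r) / 2 < `|t - x0 ord0 i|)).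
    apply/nbhs_ballP; exists ((r - r1) / 2) => /=; first by rewrite divr_gt0// subr_gt0.
    move=> t; rewrite /ball /= => ti.
    have : `|x ord0 i - x0 ord0 i| <= `|x ord0 i - t| + `|t - x0 ord0 i| by exact: ler_distD.
    lra.
  by apply: filterS => y /ltW yi; rewrite /psi (chi0 y i yi) scale0r.
- move=> x Ux; have [Vx|Vx] := pselect (V x); last first.
    by rewrite psi_out//; apply: tsupport_sub => //; exact: (compact_closed _ LV.1).
  have [_ Lx] := Lphi x Vx.
  apply: tsupport_sub; first exact: (compact_closed _ LV.1).
  move=> y Ly; rewrite /psi; change (chi x * phi x y = 0).
  by have -> : phi x y = 0; [apply: tsupportC => /Lx|rewrite mulr0].
Qed.

(** Both sides of the estimate depend only on germs along [K]: the seminorms directly, and the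
    differential because it commutes with restriction to [W]. *)
Lemma est_box neg (S : sheaf_family R n) U (x0 : X) (r : R) : basic_space Omega S ->
  open U -> U `<=` Omega -> 0 < r -> box x0 r `<=` U ->
  est Omega neg S U -> est Omega neg S (box x0 r).
Proof.
move=> BS oU UO r0 VU E K L KV LV m k; set V := box x0 r in VU KV LV *.
have oV : open V by exact: open_box.
have VO : V `<=` Omega by exact: subset_trans VU UO.
have [r1 [r10 r1r Kr]] := compact_box r0 KV.1 (compactly_insideP oV KV).
(* [r2 > r1] makes [phi] and its extension agree on an open set around [K], and [r2 < r] leaves room
   for the cut-off. *)
have [r2 r12 r2r] : exists2 r2, r1 < r2 & r2 < r by exists ((r1 + r) / 2); lra.
have r20 : 0 <= r2 by lra.
have [c [l [F [nF F0 [B bB HB]]]]] :=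
  E K L (compactly_insideS oV VU KV) (compactly_insideS oV VU LV) m k.
exists c, l, F; split=> //; exists B => // phi Hphi.
have [psi Hpsi] := choice (fun i => (fun H : exists2 psi, _ & _ =>
  match H with ex_intro2 psi A B => ex_intro (fun psi => CinfDL Omega U L psi /\
    forall x : X, (forall i, `|x ord0 i - x0 ord0 i| <= r2) -> psi x = phi i x) psi (conj A B) end)
  (extend_from_box oU UO VU r20 r2r LV (Hphi i))).
pose W := box x0 r2.
have oW : open W by exact: open_box.
have KW : K `<=` W by move=> y /Kr H i; apply: le_lt_trans (H i) r12.
have WV : W `<=` V by move=> y H i; exact: lt_trans (H i) r2r.
have psiW i x : W x -> psi i x = phi i x.
  by move=> Wx; apply: (Hpsi i).2 => j; exact: ltW.
have near_psi i x : K x -> \forall y \near x, psi i y = phi i y.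
  by move=> Kx; apply: near_open oW (KW x Kx) _ => y; exact: psiW.
have rW i : restr W (phi i) = restr W (psi i).
  apply/funext => x; have [Wx|Wx] := pselect (W x); last by rewrite !restr_out.
  by rewrite !restr_in// psiW.
have xE i x a : K x -> xder Omega a (phi i) x = xder Omega a (psi i) x.
  by move=> Kx; apply/esym/(@mder_near R n (Dtest Omega)); exact: near_psi.
have pE i x a f : K x -> pairing Omega f a (phi i) x = pairing Omega f a (psi i) x.
  by move=> Kx; rewrite /pairing xE.
have yE : yval Omega K c L l phi = yval Omega K c L l psi.
  apply/funext => i; rewrite /yval /norm_phi; congr sup; apply/seteqP.
  by split=> q [x [y [a [b [Kx Ly ac bl ->]]]]]; exists x, y, a, b; split=> //; rewrite xE.
have zE : zval Omega K c B phi = zval Omega K c B psi.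
  apply/funext => i; rewrite /zval /dist_delta /norm_B.
  by case: ifP => _; congr sup; apply/seteqP;
    split=> q [x [a [f [Kx ac Bf ->]]]]; exists x, a, f; split=> //; rewrite pE.
have mapW : [seq restr W v | v <- [seq phi (lift ord0 i) | i <- enum 'I_k]] =
    [seq restr W v | v <- [seq psi (lift ord0 i) | i <- enum 'I_k]].
  by rewrite -!map_comp; apply: eq_map => i /=; exact: rW.
have KE : restr W (kdiffS Omega S V phi) = restr W (kdiffS Omega S U psi).
  rewrite /kdiffS (kdiff_restr oO BS oV VO oW WV)//; last first.
  - exact: (Hphi ord0).1.
  - by move=> v /mapP[i _ ->]; exact: (Hphi _).1.
  rewrite (kdiff_restr oO BS oU UO oW (subset_trans WV VU))//; last first.
  - exact: (Hpsi ord0).1.1.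
  - by move=> v /mapP[i _ ->]; exact: (Hpsi _).1.1.
  by rewrite rW mapW.
have -> : norm_f K m (kdiffS Omega S V phi) = norm_f K m (kdiffS Omega S U psi).
  apply: sup_der_congr => x a Kx.
  by rewrite -(@mder_restr R n (Clcs R) W)// ?KE ?mder_restr//; exact: KW.
by rewrite yE zE; apply: HB => i; exact: (Hpsi i).1.
Qed.

Lemma basic_lin (a : C) (S T : sheaf_family R n) : basic_space Omega S -> basic_space Omega T ->
  basic_space Omega (fun U phi x => a * S U phi x + T U phi x).
Proof.
move=> BS BT U oU UO; have [SU sS] := BS U oU UO; have [TU sT] := BT U oU UO; split.
  exact: (@smooth_map_lin R (CinfD Omega U) (CinfC U) (good_CinfC oU) a _ _ SU TU).
move=> V oV VU phi dphi; apply/funext => x.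
have [Vx|Vx] := pselect (V x).
  by rewrite restr_in// -sS// -sT// !restr_in.
by rewrite restr_out// -sS// -sT// !restr_out// mulr0 addr0.
Qed.

Lemma basic_mul (S T : sheaf_family R n) : basic_space Omega S -> basic_space Omega T ->
  basic_space Omega (famM S T).
Proof.
move=> BS BT U oU UO; have [SU sS] := BS U oU UO; have [TU sT] := BT U oU UO; split.
  exact: (@smooth_map_bil R (CinfD Omega U) (CinfC U) (good_CinfC oU) _ (bilin_CinfC oU) _ _ SU TU).
move=> V oV VU phi dphi; apply/funext => x; rewrite /famM.
have [Vx|Vx] := pselect (V x).
  by rewrite restr_in// -sS// -sT// !restr_in.
by rewrite restr_out// -sS// -sT// !restr_out// mulr0.
Qed.

Section Fixed.
Variables (V : set X) (oV : open V) (VO : V `<=` Omega).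

Let gE := good_CinfD oO oV.
Let gF := @good_CinfC R n V oV.

Local Notation kdiffV S s phi := (@kdiff R (CinfD Omega V) (CinfC V) (S V)
  [seq phi (lift ord0 i) | i <- s] (phi ord0)).

Lemma mem_directions k (phi : 'I_k.+1 -> X -> X -> C) (s : seq 'I_k) L :
  (forall i, CinfDL Omega V L (phi i)) ->
  forall v, v \in [seq phi (lift ord0 i) | i <- s] -> @dom R (CinfD Omega V) v.
Proof. by move=> H v /mapP[i _ ->]; exact: (H _).1. Qed.

Lemma dom_kdiffV (S : sheaf_family R n) L k (phi : 'I_k.+1 -> X -> X -> C) (s : seq 'I_k) :
  basic_space Omega S -> (forall i, CinfDL Omega V L (phi i)) ->
  @dom R (CinfC V) (kdiffV S s phi).
Proof.
move=> BS H; have [SV _] := BS V oV VO.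
exact: (dom_kdiff gE gF SV (mem_directions (s := s) H) (H ord0).1).
Qed.

Lemma est_lin neg (a : C) S T : basic_space Omega S -> basic_space Omega T ->
  est Omega neg S V -> est Omega neg T V ->
  est Omega neg (fun U phi x => a * S U phi x + T U phi x) V.
Proof.
move=> BS BT ES ET K L KV LV m k.
have [SV _] := BS V oV VO; have [TV _] := BT V oV VO.
apply: dominated_le (dominatedD oO oV VO KV LV
  (dominatedZ (normc_ge0 a) (ES K L KV LV m k)) (ET K L KV LV m k)) => phi Hphi.
have -> : kdiffS Omega (fun U phi x => a * S U phi x + T U phi x) V phi =
    a *: (kdiffS Omega S V phi : CinfC V) + kdiffS Omega T V phi.
  exact: (kdiff_lin gE gF a SV TV (mem_directions (s := enum 'I_k) Hphi) (Hphi ord0).1).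
have dS : @dom R (CinfC V) (kdiffS Omega S V phi).
  exact: dom_kdiffV Hphi.
have dT : @dom R (CinfC V) (kdiffS Omega T V phi).
  exact: dom_kdiffV Hphi.
have sC := sn_norm_f m KV.
apply: le_trans (good_le gF sC (domZ gF a dS) dT) _.
by rewrite (goodZ gF sC).
Qed.

Lemma splits_map (T T' : Type) (f : T -> T') (s : seq T) :
  splits (map f s) = [seq (map f z.1, map f z.2) | z <- splits s].
Proof. by elim: s => //= i s ->; rewrite map_cat -!map_comp. Qed.

(** A Leibniz term involves only some of the directions, so the estimate of order [size s] is
    applied to relabelled arguments: [g] fixes the base point 0 and maps i + 1 to the i-th selected
    direction. *)
Lemma est_directions neg S K L m k (s : seq 'I_k) : est Omega neg S V ->
  compactly_inside K V -> compactly_inside L V ->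
  dominated Omega neg V K L (fun phi : 'I_k.+1 -> X -> X -> C =>
    norm_f K m (kdiffV S s phi)).
Proof.
move=> ES KV LV.
pose g (i : 'I_(size s).+1) : 'I_k.+1 :=
  if unlift ord0 i is Some j then lift ord0 (tnth (in_tuple s) j) else ord0.
have g0 i : (g i == ord0) = (i == ord0).
  by rewrite /g; case: unliftP => [j ->|->]; rewrite ?eqxx.
apply: dominated_le (dominated_reindex g0 (ES K L KV LV m (size s))) => phi _.
have gord0 : g ord0 = ord0 by rewrite /g unlift_none.
have gs : [seq phi (lift ord0 i) | i <- s] = [seq (phi \o g) (lift ord0 i) | i <- enum 'I_(size s)].
  have Es : [seq tnth (in_tuple s) i | i <- enum 'I_(size s)] = s := map_tnth_enum (in_tuple s).
  rewrite -[in LHS]Es -map_comp; apply: eq_map => j /=.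
  by rewrite /g liftK.
by rewrite /kdiffS gs /= gord0.
Qed.

(** The Leibniz rule distributes the directions over the two factors, and [norm_f_mul] treats the
    x-derivatives at the cost of 2^m. Every resulting product carries the disjunction of the flags,
    and so does their sum. *)
Lemma est_mul neg neg' S T : basic_space Omega S -> basic_space Omega T ->
  est Omega neg S V -> est Omega neg' T V -> est Omega (neg || neg') (famM S T) V.
Proof.
move=> BS BT ES ET K L KV LV m k.
have [SV _] := BS V oV VO; have [TV _] := BT V oV VO.
pose Q (S : sheaf_family R n) (s : seq 'I_k) (phi : 'I_k.+1 -> X -> X -> C) : R :=
  norm_f K m (kdiffV S s phi).
have Q0 S' s phi : basic_space Omega S' -> (forall i, CinfDL Omega V L (phi i)) -> 0 <= Q S' s phi.
  by move=> BS' Hphi; apply: norm_f_ge0 oV KV _; exact: (dom_kdiffV s BS' Hphi).1.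
have D : dominated Omega (neg || neg') V K L (fun phi =>
    \sum_(z <- splits (enum 'I_k)) (2 ^ m)%:R * (Q S z.1 phi * Q T z.2 phi)).
  apply: dominated_sum => // z; apply: dominatedZ => //.
  apply: dominatedM => //; [by move=> phi; exact: Q0|by move=> phi; exact: Q0| |];
    exact: est_directions.
apply: dominated_le D => phi Hphi.
have dmap := mem_directions (s := enum 'I_k) Hphi.
have -> : kdiffS Omega (famM S T) V phi = \sum_(z <- splits (enum 'I_k))
   (fun x => kdiffV S z.1 phi x * kdiffV T z.2 phi x)
    :> CinfC V.
  have := kdiff_bil gE gF (bilin_CinfC oV) SV TV dmap (Hphi ord0).1.
  by rewrite splits_map big_map.
have sC := sn_norm_f m KV.
apply: le_trans (sn_sum gF _ sC _) _.
  by move=> z; apply: (bil_dom (bilin_CinfC oV)); exact: dom_kdiffV Hphi.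
apply: ler_sum => z _; apply: norm_f_mul oV KV _ _;
  [exact: (dom_kdiffV _ BS Hphi).1|exact: (dom_kdiffV _ BT Hphi).1].
Qed.

Lemma kdiff_cst (E F : lcs R) (gF' : good F) (y : F) (vs : seq E) (x : E) : dom y ->
  kdiff (fun=> y) vs x = if vs is [::] then y else 0.
Proof.
move=> dy; elim: vs x => // v vs IH x /=.
rewrite (_ : (fun t => _) = fun=> if vs is [::] then y else 0); last by apply/funext => t; exact: IH.
apply: (lderivE gF').
- by apply: near0W => _; case: (vs) => // *; exact: good0.
- exact: good0.
- exact: is_lderiv_cst.
Qed.

End Fixed.

Lemma smooth_map_cst (E F : lcs R) (gF : good F) (y : F) : dom y -> smooth_map (fun _ : E => y).
Proof. by move=> dy; split=> // c _; exact: smooth_cst. Qed.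

Lemma dom_one U : open U -> @dom R (CinfC U) (restr U (fun=> 1)).
Proof.
move=> oU; apply: (@dom_restr R n (Clcs R) setT) => //; split; last by move=> x /(_ I).
exact: (smfam_smooth_on (good_Clcs R) openT (@smfam_one R n setT)).
Qed.

Lemma basic_fam1 : basic_space Omega (@fam1 R n).
Proof.
move=> U oU UO; split.
  by apply: smooth_map_cst; [exact: good_CinfC|exact: dom_one].
move=> V oV VU phi _; apply/funext => x; rewrite /fam1.
have [Vx|Vx] := pselect (V x); last by rewrite !restr_out.
by rewrite !restr_in//; exact: VU.
Qed.

Lemma basic_fam0 : basic_space Omega (@fam0 R n).
Proof.
move=> U oU UO; split.
  apply: (@smooth_map_cst (CinfD Omega U) (CinfC U) (good_CinfC oU) 0).
  exact: (good0 (good_CinfC oU)).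
move=> V oV VU phi _; apply/funext => x; rewrite /fam0.
have [Vx|Vx] := pselect (V x); last by rewrite !restr_out.
by rewrite !restr_in.
Qed.

Lemma elements_fam0 neg : elements Omega neg (@fam0 R n).
Proof.
split; first exact: basic_fam0.
move=> x Ox; exists Omega; split=> // K L KO LO m k.
apply: dominated_le (dominated0 Omega Omega K L neg k) => phi Hphi.
apply: sup_der_le => // y a Ky am.
have -> : kdiffS Omega (@fam0 R n) Omega phi = 0 :> CinfC Omega.
  rewrite /kdiffS (@kdiff_cst (CinfD Omega Omega) (CinfC Omega) (good_CinfC oO) 0).
    by case: ([seq phi (lift ord0 i) | i <- enum 'I_k]).
  exact: (good0 (good_CinfC oO)).
rewrite mderE (pders0 (good_Clcs R) oO); last exact: (compactly_insideP oO KO).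
by rewrite Normc.normc0.
Qed.

Lemma elements_fam1 : elements Omega false (@fam1 R n).
Proof.
split; first exact: basic_fam1.
move=> x Ox; exists Omega; split=> // K L KO LO m k.
apply: dominated_le (dominated_cst Omega Omega K L k ler01) => phi Hphi.
apply: sup_der_le => // y a Ky am.
have Oy := compactly_insideP oO KO Ky.
have -> : kdiffS Omega (@fam1 R n) Omega phi =
   (if [seq phi (lift ord0 i) | i <- enum 'I_k] is [::] then restr Omega (fun=> 1) else 0)
   :> CinfC Omega.
  by apply: (@kdiff_cst (CinfD Omega Omega) (CinfC Omega) (good_CinfC oO)); exact: dom_one.
case: ([seq phi (lift ord0 i) | i <- enum 'I_k]) => [|? ?].
  rewrite (mder_restr (E := Clcs R))// mderE.
  rewrite (smfam_pders (good_Clcs R) openT (@smfam_one R n setT))//.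
  by case: (word a) => [|? ?]; rewrite ?Normc.normc1 ?Normc.normc0.
by rewrite mderE (pders0 (good_Clcs R) oO)// Normc.normc0.
Qed.

Lemma common_box neg neg' S T x : elements Omega neg S -> elements Omega neg' T -> Omega x ->
  exists V, [/\ open V, V x, V `<=` Omega, est Omega neg S V & est Omega neg' T V].
Proof.
move=> [BS HS] [BT HT] Ox.
have [U1 [oU1 U1x U1O E1]] := HS x Ox; have [U2 [oU2 U2x U2O E2]] := HT x Ox.
have [r r0 rU] := box_sub (openI oU1 oU2) (conj U1x U2x).
exists (box x r); split.
- exact: open_box.
- exact: box_center.
- by move=> y /rU[/U1O].
- by apply: (est_box BS oU1 U1O r0) E1 => y /rU[].
- by apply: (est_box BT oU2 U2O r0) E2 => y /rU[].
Qed.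

Lemma elements_lin neg (a : C) S T : elements Omega neg S -> elements Omega neg T ->
  elements Omega neg (fun U phi x => a * S U phi x + T U phi x).
Proof.
move=> ES ET; split; first by apply: basic_lin; [exact: ES.1|exact: ET.1].
move=> x Ox; have [V [oV Vx VO E1 E2]] := common_box ES ET Ox.
by exists V; split=> //; apply: est_lin => //; [exact: ES.1|exact: ET.1].
Qed.

Lemma elements_mul neg neg' S T : elements Omega neg S -> elements Omega neg' T ->
  elements Omega (neg || neg') (famM S T).
Proof.
move=> ES ET; split; first by apply: basic_mul; [exact: ES.1|exact: ET.1].
move=> x Ox; have [V [oV Vx VO E1 E2]] := common_box ES ET Ox.
by exists V; split=> //; apply: est_mul => //; [exact: ES.1|exact: ET.1].
Qed.

Lemma elements_weaken : elements Omega true `<=` elements Omega false.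
Proof.
move=> S [BS H]; split=> // x Ox; have [U [oU Ux UO E]] := H x Ox; exists U; split=> //.
by move=> K L KU LU m k; have [c [l [F [nF _ HB]]]] := E K L KU LU m k; exists c, l, F.
Qed.

(** Closure under a S + T yields both operations: sums for a = 1 and multiples for T = 0. *)
Lemma elements_subspace neg (A : set (sheaf_family R n)) : elements Omega neg `<=` A ->
  subspace_of A (elements Omega neg).
Proof.
move=> sub; split=> //.
- exact: elements_fam0.
- move=> S T HS HT; have := elements_lin 1 HS HT.
  congr (elements _ _ _); apply/funext => U; apply/funext => phi; apply/funext => x.
  by rewrite mul1r.
- move=> a S HS; have := elements_lin a HS (elements_fam0 neg).
  congr (elements _ _ _); apply/funext => U; apply/funext => phi; apply/funext => x.
  by rewrite /fam0 addr0.
Qed.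

End Transfer.

Theorem proposition11 (R : realType) (n : nat) (Omega : set 'rV[R]_n)
    (hOmega : open Omega) :
  subalgebra_of (basic_space Omega) (moderate_elements Omega) /\
  ideal_of (moderate_elements Omega) (negligible_elements Omega).
Proof.
rewrite moderateE// negligibleE//; split.
  split; first by apply: elements_subspace => // S [].
    exact: elements_fam1.
  by move=> S T HS HT; exact: (elements_mul hOmega HS HT).
split; first by apply: elements_subspace => //; exact: elements_weaken.
(* The flags are [false] and [true], and their disjunction [true] says that the product is
   negligible. *)
by move=> S T HS HT; exact: (elements_mul hOmega HS HT).
Qed.
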